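(* Let $\theta:\mathbb{Z}^d\to\mathbb{R}^d$ be an embedding. For $f\in C_c(\mathbb{R}^d)$ the norm $\|\cdot\|_{X_\theta}$ can be expressed as $$\|f\|_{X_\theta}=\sup_{\zeta\in\mathbb{T}^d}\sqrt{[\![\hat f,\hat f]\!]_\theta(\zeta)}=\sup_{\xi\in\widehat{\mathbb{R}^d}}\sqrt{\frac{1}{|\det A_\theta|}\sum_{\beta\in(A_\theta^* )^{-1}\mathbb{Z}^d}\overline{\hat f(\xi+\beta)}\hat f(\xi+\beta)}.$$ Furthermore, for all $f\in C_c(\mathbb{R}^d)$, $\|f\|_2\le\|f\|_{X_\theta}$, implying that the completion of $C_c(\mathbb{R}^d)$ with respect to the norm $\|\cdot\|_{X_\theta}$ is contained in $L^2(\mathbb{R}^d)$ (i.e. the continuous extension to the completion of the inclusion $C_c(\mathbb{R}^d)\subset L^2(\mathbb{R}^d)$ is injective).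
   Context: Conventions. $\mathbb{T}^d=\mathbb{R}^d/\mathbb{Z}^d$; $\widehat{\mathbb{R}^d}$ is identified with $\mathbb{R}^d$ through $(x,\xi)=e^{2\pi i x\cdot\xi}$; $(\gamma,\zeta)=e^{2\pi i\gamma\cdot\zeta}$ for $\gamma\in\mathbb{Z}^d,\zeta\in\mathbb{T}^d$. Fourier transforms: $\hat f(\xi)=\int_{\mathbb{R}^d}f(x)(x,\xi)\,dx$ on $\mathbb{R}^d$, $\hat a(\zeta)=\sum_\gamma a(\gamma)(\gamma,\zeta)$ on $\mathbb{Z}^d$. $\iota:\mathbb{Z}^d\to\mathbb{R}^d$ is the natural inclusion and $\hat\iota:\widehat{\mathbb{R}^d}\to\mathbb{T}^d$ the quotient map. An embedding $\theta$ is an injective group homomorphism that is a homeomorphism onto its image; $A_\theta$ is the unique nonsingular linear map of $\mathbb{R}^d$ with $\theta=A_\theta\iota$, and $\hat\theta=\hat\iota A_\theta^*$. $[f,g]_\theta(\gamma)=\int_{\mathbb{R}^d}\overline{f(x-\theta(\gamma))}g(x)\,dx$ for $\gamma\in\mathbb{Z}^d$; $[\![p,q]\!]_\theta(\zeta)=\frac{1}{|\det A_\theta|}\sum_{\hat\theta(\xi)=\zeta}\overline{p(\xi)}q(\xi)$ for $\zeta\in\mathbb{T}^d$. For $f\in C_c(\mathbb{R}^d)$, $\|f\|_{X_\theta}=\sup_{\zeta\in\mathbb{T}^d}\sqrt{\widehat{[f,f]_\theta}(\zeta)}$, which is a norm on $C_c(\mathbb{R}^d)$. *)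

(* Defs.v *)
From HB Require Import structures.
From mathcomp Require Import all_boot all_order all_algebra.
From mathcomp Require Import ring_quotient generic_quotient.
From mathcomp Require Import all_classical all_reals all_analysis.
From mathcomp Require Import complex.

Set Implicit Arguments.
Unset Strict Implicit.
Unset Printing Implicit Defensive.

Import Order.TTheory GRing.Theory Num.Theory.
Import numFieldNormedType.Exports.

Local Open Scope classical_set_scope.
Local Open Scope ring_scope.
Local Open Scope quotient_scope.

(* Elements of R^d and Z^d are row vectors. A d x d matrix A stands for the
   linear map x |-> A x, which reads x *m A^T on rows; its adjoint A^* is then
   xi |-> xi *m A. *)

Fact rV_display : measure_display.
Proof. exact: default_measure_display. Qed.

(* The sigma-algebra generated by the coordinates, i.e., the Borel sets of
   R^d. *)
Section rV_measurable.
Variables (R : realType) (n : nat).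

Let coord (i : 'I_n) (x : 'rV[R]_n) : measurableTypeR R := x ord0 i.

Let rV_set0 : g_sigma_preimage coord set0.
Proof. exact: sigma_algebra0. Qed.

Let rV_setC A : g_sigma_preimage coord A -> g_sigma_preimage coord (~` A).
Proof. exact: sigma_algebraC. Qed.

Let rV_bigcup (F : (set 'rV[R]_n)^nat) :
  (forall i, g_sigma_preimage coord (F i)) ->
  g_sigma_preimage coord (\bigcup_i (F i)).
Proof. exact: sigma_algebra_bigcup. Qed.

HB.instance Definition _ := @isMeasurable.Build rV_display
  'rV[R]_n (g_sigma_preimage coord) rV_set0 rV_setC rV_bigcup.

Lemma measurable_coord (i : 'I_n) :
  measurable_fun [set: 'rV[R]_n] (fun x : 'rV[R]_n => x ord0 i).
Proof.
move=> _ Y mY; rewrite setTI; apply: sub_sigma_algebra => /=.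
rewrite -bigcup_seq/=; exists i => /=; first by rewrite mem_index_enum.
by exists Y => //; rewrite setTI.
Qed.

Lemma measurable_fun_rV d (T : measurableType d) (f : T -> 'rV[R]_n) :
  (forall i, measurable_fun [set: T] (fun x => f x ord0 i)) ->
  measurable_fun [set: T] f.
Proof.
move=> mf; apply: (@measurability _ _ _ _ _ _
  (\big[setU/set0]_(i < n) preimage_set_system setT (coord i) measurable)).
  by [].
move=> _ [B + <-]; rewrite -bigcup_seq => -[i _ [A mA <-]].
rewrite !setTI; have := mf i measurableT A.
by rewrite setTI; apply.
Qed.

End rV_measurable.

Section lebesgue_rV.
Variable R : realType.

Definition cons_rV n (p : measurableTypeR R * 'rV[R]_n) : 'rV[R]_n.+1 :=
  \row_i (if unlift ord0 i is Some j then p.2 ord0 j else p.1).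

Lemma cons_rV0 n p : @cons_rV n p ord0 ord0 = p.1.
Proof. by rewrite mxE unlift_none. Qed.

Lemma cons_rVS n p j : @cons_rV n p ord0 (lift ord0 j) = p.2 ord0 j.
Proof. by rewrite mxE liftK. Qed.

Lemma measurable_cons_rV n : measurable_fun [set: _] (@cons_rV n).
Proof.
apply: measurable_fun_rV => i; case: (unliftP ord0 i) => [j|] ->.
- under eq_fun do rewrite cons_rVS.
  by apply: (measurableT_comp (measurable_coord j)); exact: measurable_snd.
- under eq_fun do rewrite cons_rV0.
  exact: measurable_fst.
Qed.

Section step.
Variables (n : nat) (m : {sigma_finite_measure set 'rV[R]_n -> \bar R}).

Definition leb_step : set 'rV[R]_n.+1 -> \bar R :=
  pushforward (@lebesgue_measure R \x m)%E (@cons_rV n).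

Let leb_step0 : leb_step set0 = 0%E.
Proof. by rewrite /leb_step /pushforward preimage_set0 measure0. Qed.

Let leb_step_ge0 A : (0 <= leb_step A)%E.
Proof. by rewrite /leb_step /pushforward; exact: measure_ge0. Qed.

Let leb_step_sigma_additive : semi_sigma_additive leb_step.
Proof.
move=> F mF tF mUF; rewrite /leb_step /pushforward preimage_bigcup.
have mpre A : measurable A -> measurable (@cons_rV n @^-1` A).
  by move=> mA; rewrite -[X in measurable X]setTI; exact: measurable_cons_rV.
apply: measure_semi_sigma_additive => [k||].
- exact: mpre.
- apply/trivIsetP => /= i j _ _ ij; rewrite -preimage_setI.
  by move/trivIsetP : tF => /(_ _ _ _ _ ij) ->//; rewrite preimage_set0.
- by rewrite -preimage_bigcup; exact: mpre.
Qed.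

HB.instance Definition _ := isMeasure.Build _ _ _ leb_step
  leb_step0 leb_step_ge0 leb_step_sigma_additive.

Let leb_step_sigma_finite : sigma_finite setT leb_step.
Proof.
have /sigma_finiteP[F [TF ndF Foo]] := sigma_finiteT (@lebesgue_measure R).
have /sigma_finiteP[G [TG ndG Goo]] := sigma_finiteT m.
pose g (x : 'rV[R]_n.+1) : measurableTypeR R * 'rV[R]_n :=
  (x ord0 ord0, \row_j x ord0 (lift ord0 j)).
have gK : cancel (@cons_rV n) g.
  move=> [t v]; rewrite /g cons_rV0; congr (_, _).
  by apply/rowP => j; rewrite mxE cons_rVS.
have mg : measurable_fun setT g.
  apply/measurable_fun_pairP; split; first exact: measurable_coord.
  apply: measurable_fun_rV => i /=.
  by under eq_fun do rewrite mxE; exact: measurable_coord.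
exists (fun k => g @^-1` (F k `*` G k)).
  rewrite -preimage_bigcup (_ : \bigcup_k _ = setT) ?preimage_setT//.
  rewrite predeqE => -[t v]; split=> // _.
  have [i _ Fi] : (\bigcup_i F i) t by rewrite -TF.
  have [j _ Gj] : (\bigcup_i G i) v by rewrite -TG.
  exists (maxn i j) => //; split => /=.
  - by move: t Fi; exact/subsetPset/ndF/leq_maxl.
  - by move: v Gj; exact/subsetPset/ndG/leq_maxr.
move=> k; have [mF Fk] := Foo k; have [mG Gk] := Goo k; split.
  by rewrite -[X in measurable X]setTI; apply: mg => //; exact: measurableX.
rewrite /leb_step /pushforward -comp_preimage.
rewrite (_ : g \o @cons_rV n = id) ?preimage_id; last first.
  by apply/funext => p /=; exact: gK.
rewrite product_measure1E//.
by rewrite lte_mul_pinfty// ge0_fin_numE.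
Qed.

HB.instance Definition _ := Measure_isSigmaFinite.Build _ _ _ leb_step
  leb_step_sigma_finite.

End step.

Fixpoint leb n : {sigma_finite_measure set 'rV[R]_n -> \bar R} :=
  if n is k.+1 then leb_step (leb k) else dirac (0 : 'rV[R]_0).

Lemma leb_box n (a b : 'rV[R]_n) : (forall i, a ord0 i <= b ord0 i) ->
  leb n [set x | forall i, a ord0 i <= x ord0 i <= b ord0 i] =
  (\prod_(i < n) (b ord0 i - a ord0 i))%:E.
Proof.
elim: n a b => [a b _|n IH a b ab] /=.
  by rewrite diracE big_ord0 mem_set //= => -[].
rewrite big_ord_recl EFinM.
pose a' : 'rV[R]_n := \row_j a ord0 (lift ord0 j).
pose b' : 'rV[R]_n := \row_j b ord0 (lift ord0 j).
pose box := [set x : 'rV[R]_n | forall i, a' ord0 i <= x ord0 i <= b' ord0 i].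
have ab' i : a' ord0 i <= b' ord0 i by rewrite !mxE.
have mbox : measurable box.
  rewrite (_ : box = \bigcap_(i in [set: 'I_n])
    ((fun x : 'rV[R]_n => x ord0 i) @^-1` `[a' ord0 i, b' ord0 i])).
    apply: fin_bigcap_measurable => // i _.
    by rewrite -[X in measurable X]setTI; exact: measurable_coord.
  apply/seteqP; split => x /= h i; first by rewrite /= in_itv /= h.
  by have := h i I; rewrite /= in_itv.
rewrite /leb_step /pushforward.
rewrite [X in product_measure1 _ _ X](_ : _ =
    `[a ord0 ord0, b ord0 ord0] `*` box); last first.
  apply/seteqP; split => -[t v] /=.
    move=> h; split => /=.
      by have := h ord0; rewrite cons_rV0 in_itv.
    by move=> i; have := h (lift ord0 i); rewrite cons_rVS !mxE.
  rewrite in_itv /= => -[h1 h2] i; case: (unliftP ord0 i) => [j|] ->.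
    by have := h2 j; rewrite cons_rVS !mxE.
  by rewrite cons_rV0.
rewrite product_measure1E // (IH a' b') //.
congr (_ * _)%E; last by congr EFin; apply: eq_bigr => i _; rewrite !mxE.
rewrite /= lebesgue_measure_itv /= lte_fin.
have [_|ba|->] := ltgtP (a ord0 ord0) (b ord0 ord0); rewrite ?subrr //.
by have := ab ord0; rewrite leNgt ba.
Qed.

End lebesgue_rV.

Section complex_operators.
Variable R : realType.
Local Notation C := R[i].

Definition cabs (z : C) : R := complex.Re `|z|.

Definition Cintegral n (f : 'rV[R]_n -> C) : C :=
  Complex (\int[leb R n]_x complex.Re (f x)) (\int[leb R n]_x complex.Im (f x)).

Definition Csummable (T : choiceType) (D : set T) (a : T -> C) : Prop :=
  summable D (fun i => (cabs (a i))%:E).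

Definition Rsum (T : choiceType) (D : set T) (a : T -> R) : R :=
  fine (\esum_(i in D) ((EFin \o a)^\+ i)%E -
        \esum_(i in D) ((EFin \o a)^\- i)%E)%E.

(* The unordered sum of a over D; only meaningful when a is summable. *)
Definition Csum (T : choiceType) (D : set T) (a : T -> C) : C :=
  Complex (Rsum D (fun i => complex.Re (a i))) (Rsum D (fun i => complex.Im (a i))).

(* e^(2 pi i t) *)
Definition expi (t : R) : C := Complex (cos (2 * pi * t)) (sin (2 * pi * t)).

Definition dot n (x y : 'rV[R]_n) : R := \sum_(i < n) x ord0 i * y ord0 i.

End complex_operators.

Section torus.
Variables (R : realType) (d : nat).

Definition iota (gamma : 'rV[int]_d) : 'rV[R]_d := map_mx intr gamma.

Definition int_rV : {pred 'rV[R]_d} :=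
  [pred x : 'rV[R]_d | [forall i, x ord0 i \is a Num.int]].

Lemma int_rV_zmod_closed : zmod_closed int_rV.
Proof.
split; first by apply/forallP => i; rewrite mxE rpred0.
move=> x y /forallP hx /forallP hy; apply/forallP => i.
by rewrite !mxE; apply: rpredB.
Qed.

HB.instance Definition _ := GRing.isZmodClosed.Build 'rV[R]_d int_rV
  int_rV_zmod_closed.

Definition torus := Quotient.quot (int_rV : zmodClosed _).
Definition iotahat (xi : 'rV[R]_d) : torus := \pi_torus xi.

(* The pairing of Z^d with T^d. Any representative of zeta gives the same value,
   because gamma is integral. *)
Definition chi (gamma : 'rV[int]_d) (zeta : torus) : R[i] :=
  expi (dot (iota gamma) (repr zeta)).

Definition fourierR (f : 'rV[R]_d -> R[i]) (xi : 'rV[R]_d) : R[i] :=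
  Cintegral (fun x => f x * expi (dot x xi)).

Definition fourierZ (a : 'rV[int]_d -> R[i]) (zeta : torus) : R[i] :=
  Csum setT (fun gamma => a gamma * chi gamma zeta).

End torus.

(* An injection that is continuous and open onto its image, i.e., a
   homeomorphism onto its image. *)
Definition topological_embedding (T U : topologicalType) (f : T -> U) : Prop :=
  [/\ injective f, continuous f &
      forall A, open A -> exists2 B, open B & f @` A = range f `&` B].

Section embedding.
Variables (R : realType) (d : nat).
Variable theta : 'rV[int]_d -> 'rV[R]_d.

Definition is_embedding : Prop :=
  @topological_embedding (discrete_topology 'rV[int]_d) 'rV[R]_d theta.

(* The unique nonsingular A with theta = A o iota. *)
Definition A_theta : 'M[R]_d :=
  xget 1%:M [set A : 'M[R]_d |
    A \in unitmx /\ forall gamma, theta gamma = iota R gamma *m A^T].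

Definition thetahat (xi : 'rV[R]_d) : torus R d := iotahat (xi *m A_theta).

Definition bracket (f g : 'rV[R]_d -> R[i]) (gamma : 'rV[int]_d) : R[i] :=
  Cintegral (fun x => (f (x - theta gamma))^* * g x).

Definition dual_bracket (p q : 'rV[R]_d -> R[i]) (zeta : torus R d) : R[i] :=
  (`|\det A_theta|^-1)%:C%C *
  Csum [set xi | thetahat xi = zeta] (fun xi => (p xi)^* * q xi).

(* (A_theta^* )^-1 Z^d *)
Definition dual_lattice : set 'rV[R]_d :=
  range (fun gamma => iota R gamma *m invmx A_theta).

Definition lattice_sum (p : 'rV[R]_d -> R[i]) (xi : 'rV[R]_d) : R[i] :=
  (`|\det A_theta|^-1)%:C%C *
  Csum dual_lattice (fun beta => (p (xi + beta))^* * p (xi + beta)).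

(* [normX] takes values in the extended reals so that the supremum makes sense
   without a prior boundedness proof. *)
Definition normX (f : 'rV[R]_d -> R[i]) : \bar R :=
  ereal_sup (range (fun zeta : torus R d =>
    (Num.sqrt (complex.Re (fourierZ (bracket f f) zeta)))%:E)).

End embedding.

Section Cc.
Variables (R : realType) (d : nat).

Definition Cc_pred : {pred 'rV[R]_d -> R[i]} := [pred f : 'rV[R]_d -> R[i] |
  `[< continuous (f : 'rV[R]_d -> (R[i])^o) /\
      compact (closure [set x | f x != 0]) >]].

Lemma Cc_submod_closed : submod_closed Cc_pred.
Proof.
split.
  apply/asboolP; split; first exact: cst_continuous.
  rewrite (_ : [set x | _] = set0) ?closure0; first exact: compact0.
  by apply/seteqP; split => x //=; rewrite eqxx.
move=> a f g /asboolP[cf kf] /asboolP[cg kg]; apply/asboolP; split.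
  move=> x; apply: (@continuousD _ (R[i])^o _ (fun x => a *: (f x : (R[i])^o)) g);
    last exact: cg.
  by apply: continuousZr; [exact: cf].
apply: (subclosed_compact _ (compactU kf kg)); first exact: closed_closure.
rewrite -closureU; apply: closure_subset => x /=.
apply: contra_neqP => /not_orP[/negP/negPn/eqP fx0 /negP/negPn/eqP gx0].
by rewrite !fctE fx0 gx0 scaler0 addr0.
Qed.

HB.instance Definition _ := GRing.isSubmodClosed.Build R[i]
  ('rV[R]_d -> R[i]) Cc_pred Cc_submod_closed.

Record Cc := { Cc_val :> 'rV[R]_d -> R[i]; _ : Cc_val \in Cc_pred }.
HB.instance Definition _ := [isSub for Cc_val].
HB.instance Definition _ := [Choice of Cc by <:].
HB.instance Definition _ := [SubChoice_isSubLmodule of Cc by <:].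

End Cc.

Section L2.
Variables (R : realType) (d : nat).

Definition L2norm (F : 'rV[R]_d -> R[i]) : \bar R :=
  Lnorm (leb R d) 2%:E (fun x => (cabs (F x))%:E).

Definition L2fun_pred : {pred 'rV[R]_d -> R[i]} :=
  [pred F : 'rV[R]_d -> R[i] |
  `[< [/\ measurable_fun setT (fun x => complex.Re (F x)),
          measurable_fun setT (fun x => complex.Im (F x)) &
          (L2norm F < +oo)%E] >]].

Record L2fun := { L2fun_val :> 'rV[R]_d -> R[i]; _ : L2fun_val \in L2fun_pred }.
HB.instance Definition _ := [isSub for L2fun_val].
HB.instance Definition _ := [Choice of L2fun by <:].

Definition L2fun_eq (F G : L2fun) : bool :=
  `[< (F : 'rV[R]_d -> R[i]) = G %[ae leb R d] >].

Lemma L2fun_eq_equiv : equiv_class_of L2fun_eq.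
Proof.
split => [F|F G|G F H].
- exact/asboolP/ae_eq_refl.
- by apply/asboolP/asboolP => /ae_eq_sym.
- by move=> /asboolP FG /asboolP GH; apply/asboolP; exact: ae_eq_trans FG GH.
Qed.

Canonical L2fun_equiv := EquivRelPack L2fun_eq_equiv.
Canonical L2fun_enc := defaultEncModRel L2fun_eq.

Definition L2 := {eq_quot L2fun_eq}.
HB.instance Definition _ := Choice.on L2.
HB.instance Definition _ := EqQuotient.on L2.

Definition L2dist (u v : L2) : \bar R :=
  L2norm ((repr u : 'rV[R]_d -> R[i]) - (repr v : 'rV[R]_d -> R[i])).

(* u is the class of F *)
Definition L2class_of (F : 'rV[R]_d -> R[i]) (u : L2) : Prop :=
  F \in L2fun_pred /\ (repr u : 'rV[R]_d -> R[i]) = F %[ae leb R d].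

End L2.

Section completion.
Variables (R : realType) (d : nat) (theta : 'rV[int]_d -> 'rV[R]_d).
Variables (X : completeNormedModType R[i]) (j : Cc R d -> X).

(* A completion of (C_c(R^d), normX theta) is a complete normed space over the
   complex numbers together with an isometric linear map j of dense range. *)
Definition is_completion : Prop :=
  (forall f : Cc R d, `|j f| = (fine (normX theta f))%:C%C) /\ dense (range j).

(* T is continuous for the L^2 metric and restricts to the inclusion of
   C_c(R^d) into L^2(R^d). *)
Definition is_L2_extension (T : X -> L2 R d) : Prop :=
  (forall f : Cc R d, L2class_of f (T (j f))) /\
  (forall x, L2dist (T y) (T x) @[y --> x] --> 0%E).

End completion.

(* Main.v *)
(* Put g(y) = f(A y) with A = A_theta. Then [f,f]_theta is |det A| times the
   autocorrelation of g on Z^d, whose Fourier transform is |g^|^2, and the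
   equality of the two transforms is Poisson summation. Nothing has to be known
   about the decay of g^: since |g^|^2 >= 0, integrating the periodization of the
   autocorrelation against the Fejer kernels bounds the finite partial sums of
   |g^(k)|^2, k in Z^d, and then identifies their supremum.
   Averaging the common value S_f over a period gives [f,f]_theta(0) = |f|_2^2,
   hence |f|_2 <= |f|_X.
   For injectivity, let z be in the kernel of the extension and r = |z| > 0. Fix
   h0 in C_c near z; then S_h0 > r^2/2 on some cube, by continuity. Any h in C_c
   close enough to z satisfies S_(h0-h) <= r^2/64 everywhere, hence
   S_h >= r^2/4 on that cube, so |h|_2 is bounded below, although |h|_2 -> 0 as
   h -> z. *)

Require Import Defs.
From HB Require Import structures.
From mathcomp Require Import all_boot all_order all_algebra.
From mathcomp Require Import ring_quotient generic_quotient.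
From mathcomp Require Import all_classical all_reals all_analysis.
From mathcomp Require Import measurable_realfun complex.
From mathcomp Require Import ring lra zify.
Set Implicit Arguments.
Unset Strict Implicit.
Unset Printing Implicit Defensive.
Import Order.TTheory GRing.Theory Num.Theory.
Import numFieldNormedType.Exports.
Local Open Scope classical_set_scope.
Local Open Scope ring_scope.
Local Open Scope quotient_scope.

(** * Change of variables for Lebesgue measure on R^d *)

(** The two sides enter a supremum, so their equality is needed at every point of the torus;
    identities valid almost everywhere would not suffice. The Fejer kernel is kept as an average of
    characters over pairs of points of a box. Pairing it with the autocorrelation gives averages of
    [|g^|^2] over differences of box points, and both inequalities become counting of pairs. Its
    concentration at 0 is also read off Fourier coefficients: [2 - 2 cos] replaces the squared
    distance in a Chebyshev estimate, and no closed formula for the kernel enters. The bound of the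
    L^2 norm by [normX] does not give injectivity: the first sees the mean of [S_f], the second its
    supremum, and a mean does not notice a narrow peak. The way out is that closeness in the
    completion controls [S] uniformly, so a peak of one fixed [h0] keeps its height and width in
    every nearby [h]. The extension is given only as a continuous map, so its kernel is replaced by
    differences of two points with the same image. *)

Section integral_leb.
Local Open Scope ereal_scope.
Context {R : realType}.
Local Notation mu := (@lebesgue_measure R).

Lemma integral_leb_step n (F : 'rV[R]_n.+1 -> \bar R) :
  measurable_fun setT F -> (forall x, 0 <= F x) ->
  \int[leb R n.+1]_x F x = \int[mu]_t \int[leb R n]_v F (cons_rV (t, v)).
Proof.
move=> mF F0.
transitivity (\int[mu \x leb R n]_z F (cons_rV z)).
  rewrite [LHS](_ : _ = \int[pushforward (mu \x leb R n)%E (@cons_rV R n)]_x F x)//.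
  rewrite ge0_integral_pushforward//; exact: measurable_cons_rV.
rewrite (fubini_tonelli1 (fun z => F (cons_rV z)))//.
by apply: measurableT_comp => //; exact: measurable_cons_rV.
Qed.

Lemma integral_leb_step2 n (F : 'rV[R]_n.+1 -> \bar R) :
  measurable_fun setT F -> (forall x, 0 <= F x) ->
  \int[leb R n.+1]_x F x = \int[leb R n]_v \int[mu]_t F (cons_rV (t, v)).
Proof.
move=> mF F0; rewrite integral_leb_step//.
rewrite (fubini_tonelli (fun z => F (cons_rV z)))//.
by apply: measurableT_comp => //; exact: measurable_cons_rV.
Qed.

(** The image of Lebesgue measure under the affine map, scaled by [|s|], agrees with Lebesgue
    measure on half-open intervals, and uniqueness extends this to all Borel sets. *)
Lemma integral_lebesgue_affine (s r : R) (F : R -> \bar R) : s != 0%R ->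
  measurable_fun setT F -> (forall t, 0 <= F t) ->
  \int[mu]_t F (s * t + r)%R = (`|s|^-1)%:E * \int[mu]_t F t.
Proof.
move=> s0 mF F0.
pose phi t : measurableTypeR R := (s * t + r)%R.
have mphi : measurable_fun setT phi.
  by apply: measurable_funD => //; exact: measurable_funM.
have s0' : (0 <= `|s|)%R by [].
pose m : {measure set (measurableTypeR R) -> \bar R} :=
  (fun mf => mscale (NngNum s0') (measure_function_pushforward__canonical__measure_function_Measure mu mf)) mphi.
have mE A : measurable A -> mu A = m A.
  apply: lebesgue_measure_unique => _ [[a b]] _ <-.
  rewrite /m /= /mscale /= /pushforward.
  have [sgt|slt] : ((0 < s) \/ (s < 0))%R by move: s0; rewrite neq_lt => /orP[]; tauto.
    have -> : (phi @^-1` `]a, b]%classic = `](a - r) / s, (b - r) / s]%classic)%R.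
      apply/seteqP; split => t; rewrite /= !in_itv /= /phi ltr_pdivrMr // ler_pdivlMr //.
        by move=> /andP[ha hb]; apply/andP; split; lra.
      by move=> /andP[ha hb]; apply/andP; split; lra.
    rewrite !lebesgue_measure_itv /= !lte_fin ltr_pM2r ?invr_gt0// ltrD2r.
    case: ifPn => _; last by rewrite mule0.
    rewrite !EFinN -!EFinB -EFinM gtr0_norm//; congr EFin; field.
    by rewrite s0.
  (* A negative slope reverses the interval, so its closed end is now the left one. *)
  have -> : (phi @^-1` `]a, b]%classic = `[(b - r) / s, (a - r) / s[%classic)%R.
    apply/seteqP; split => t; rewrite /= !in_itv /= /phi ltr_ndivlMr // ler_ndivrMr //.
      by move=> /andP[ha hb]; apply/andP; split; lra.
    by move=> /andP[ha hb]; apply/andP; split; lra.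
  rewrite !lebesgue_measure_itv /= !lte_fin ltr_nM2r ?invr_lt0// ltrD2r.
  case: ifPn => _; last by rewrite mule0.
  rewrite -!EFinB -EFinM ltr0_norm//; congr EFin; field.
  by rewrite s0.
have -> : \int[mu]_t F t = \int[m]_t F t.
  by apply: eq_measure_integral => A mA _; exact: mE.
rewrite /m ge0_integral_mscale//= ge0_integral_pushforward//= muleA -EFinM.
by rewrite mulVf ?normr_eq0// mul1e.
Qed.

End integral_leb.

Section change_of_variables.
Context {R : realType}.
Local Notation mu := (@lebesgue_measure R).

Lemma measurable_rV_linear m n (A : 'M[R]_(m, n)) :
  measurable_fun [set: 'rV[R]_m] (fun x : 'rV[R]_m => x *m A).
Proof.
apply: measurable_fun_rV => j.
under eq_fun do rewrite mxE.
apply: measurable_sum => i.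
by apply: measurable_funM => //; exact: measurable_coord.
Qed.

Lemma measurable_rV_add d (T : measurableType d) n (f g : T -> 'rV[R]_n) :
  measurable_fun setT f -> measurable_fun setT g ->
  measurable_fun setT (fun x => f x + g x).
Proof.
move=> mf mg; apply: measurable_fun_rV => j.
under eq_fun do rewrite mxE.
by apply: measurable_funD; apply: (measurableT_comp (measurable_coord j)).
Qed.

Lemma measurable_rV_opp d (T : measurableType d) n (f : T -> 'rV[R]_n) :
  measurable_fun setT f -> measurable_fun setT (fun x => - f x).
Proof.
move=> mf; apply: measurable_fun_rV => j.
under eq_fun do rewrite mxE.
by apply: measurableT_comp => //; apply: (measurableT_comp (measurable_coord j)).
Qed.

Lemma cons_rV_add n (t s : R) (v w : 'rV[R]_n) :
  cons_rV (t, v) + cons_rV (s, w) = cons_rV (t + s, v + w).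
Proof.
apply/rowP => i; rewrite !mxE; case: unlift => [j|] //=.
by rewrite mxE.
Qed.

Lemma cons_rV_block n (t : R) (v : 'rV[R]_n) :
  cons_rV (t, v) = row_mx (t%:M : 'M[R]_1) v :> 'rV[R]_(1 + n).
Proof.
apply/rowP => i; rewrite !mxE.
case: (splitP i) => [j|k] ij.
  have -> : unlift ord0 i = None.
    by apply/eqP; rewrite -[_ == _]negbK; apply/negP => /eqP; case: unliftP => // k ik; move: ij; rewrite ik /= /bump /= (ord1 j).
  by rewrite !mxE (ord1 j) eqxx mulr1n.
have -> : i = lift ord0 k by apply: val_inj.
by rewrite liftK.
Qed.

Lemma cons_rV_surj n (x : 'rV[R]_n.+1) :
  x = cons_rV (x ord0 ord0, \row_j x ord0 (lift ord0 j)).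
Proof.
by apply/rowP => i; rewrite mxE; case: unliftP => [j|] -> //=; rewrite mxE.
Qed.

Local Open Scope ereal_scope.

Lemma integral_leb_translate n (a : 'rV[R]_n) (F : 'rV[R]_n -> \bar R) :
  measurable_fun setT F -> (forall x, 0 <= F x) ->
  \int[leb R n]_x F (x + a)%R = \int[leb R n]_x F x.
Proof.
elim: n a F => [|n IH] a F mF F0.
  by apply: eq_integral => x _; congr F; apply/rowP => -[].
have mFa : measurable_fun setT (fun x : 'rV[R]_n.+1 => F (x + a)%R).
  by apply: measurableT_comp => //; apply: measurable_rV_add => //; exact: measurable_cst.
rewrite !integral_leb_step //.
pose a' : 'rV[R]_n := (\row_j a ord0 (lift ord0 j))%R.
transitivity (\int[mu]_t \int[leb R n]_v F (cons_rV (1 * t + a ord0 ord0, v))%R).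
  apply: eq_integral => t _.
  rewrite -(IH a' (fun v => F (cons_rV ((1 * t + a ord0 ord0)%R, v)))).
    by apply: eq_integral => v _; rewrite {1}(cons_rV_surj a) cons_rV_add mul1r.
  - apply: measurableT_comp => //; apply: (measurableT_comp (@measurable_cons_rV R n)).
    exact: measurable_pair1.
  - by move=> x; exact: F0.
rewrite (@integral_lebesgue_affine R 1 (a ord0 ord0) (fun t => \int[leb R n]_v F (cons_rV (t, v)))) //.
- by rewrite normr1 invr1 mul1e.
- apply: (measurable_fun_fubini_tonelli_F (fun z => F (cons_rV z))) => //.
  by apply: measurableT_comp => //; exact: measurable_cons_rV.
- by move=> t; apply: integral_ge0.
Qed.

Let linear_change n (A : 'M[R]_n) := forall F : 'rV[R]_n -> \bar R,
  measurable_fun setT F -> (forall x, 0 <= F x) ->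
  \int[leb R n]_x F (x *m A)%R = (`|\det A|^-1)%:E * \int[leb R n]_x F x.

Lemma det_block_schur n (a : 'M[R]_1) (b : 'rV[R]_n) (c : 'cV[R]_n) (D : 'M[R]_n) :
  D \in unitmx ->
  (\det (block_mx a b c D) = (a - b *m invmx D *m c) ord0 ord0 * \det D)%R.
Proof.
move=> uD.
have -> : block_mx a b c D = (block_mx 1%:M (b *m invmx D) 0 1%:M *m
    block_mx (a - b *m invmx D *m c) 0 c D)%R.
  rewrite mulmx_block !mul1mx !mul0mx subrK !add0r.
  by rewrite -mulmxA mulVmx // mulmx1.
by rewrite det_mulmx det_ublock det_lblock !det1 !mul1r det_mx11.
Qed.

(** On rows [(t, v)], put [w = v D + t b]: for fixed [t] the passage from [v] to [w] is covered by
    the hypothesis on [D] and a translation. After exchanging the integrals, the first coordinate is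
    affine in [t] for fixed [w], with slope the Schur complement [s], and the two Jacobians multiply
    to the determinant. *)
Let linear_change_block n (a : 'M[R]_1) (b : 'rV[R]_n) (c : 'cV[R]_n) (D : 'M[R]_n) :
  D \in unitmx -> block_mx a b c D \in unitmx -> linear_change D ->
  linear_change (block_mx a b c D : 'M[R]_n.+1).
Proof.
rewrite /linear_change => uD uM IH F mF F0.
pose s := ((a - b *m invmx D *m c) ord0 ord0)%R.
have detE : (\det (block_mx a b c D) = s * \det D)%R by exact: det_block_schur.
have s0 : s != 0%R.
  by apply: contraTneq uM => s0; rewrite unitmxE detE s0 mul0r unitr0.
pose r (w : 'rV[R]_n) := ((w *m invmx D *m c) ord0 ord0)%R.
have mr : measurable_fun setT r.
  rewrite /r; apply: (measurableT_comp (measurable_coord ord0)).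
  apply: (measurableT_comp (measurable_rV_linear c)).
  exact: measurable_rV_linear.
pose G t w := F (cons_rV ((s * t + r w)%R, w)).
have mG : measurable_fun setT (fun p : measurableTypeR R * 'rV[R]_n => G p.1 p.2).
  rewrite /G; apply: measurableT_comp => //.
  apply: (measurableT_comp (@measurable_cons_rV R n)).
  apply/measurable_fun_pairP; split.
    apply: measurable_funD; last exact: (measurableT_comp mr measurable_snd).
    by apply: measurable_funM.
  exact: measurable_snd.
have mFM : measurable_fun setT (fun x : 'rV[R]_n.+1 => F (x *m block_mx a b c D)%R).
  by apply: measurableT_comp => //; exact: (@measurable_rV_linear n.+1 n.+1).
rewrite integral_leb_step //.
transitivity (\int[mu]_t ((`|\det D|^-1)%:E * \int[leb R n]_w G t w)).
  apply: eq_integral => t _.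
  have mGt : measurable_fun setT (G t) by exact: (measurableT_comp mG (measurable_pair1 t)).
  rewrite -(@integral_leb_translate n (t *: b)%R (G t)) //; last by move=> x; exact: F0.
  rewrite -(IH (fun w => G t (w + t *: b)%R)); last 2 first.
  - by apply: (measurableT_comp mGt); apply: measurable_rV_add => //.
  - by move=> x; exact: F0.
  apply: eq_integral => v _; rewrite /G; congr F.
  have -> : (cons_rV (t, v) *m block_mx a b c D)%R = cons_rV
      (((t *: a + v *m c) ord0 ord0)%R, (t *: b + v *m D)%R) :> 'rV[R]_(1 + n).
    rewrite (cons_rV_block t v).
    have mrb := mul_row_block (t%:M) v a b c D.
    rewrite (_ : mulmx _ _ = row_mx (t%:M *m a + v *m c) (t%:M *m b + v *m D))%R;
      last exact: mrb.
    by rewrite !mul_scalar_mx cons_rV_block -mx11_scalar.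
  congr (cons_rV (_, _)); last by rewrite addrC.
  rewrite /s /r mulmxDl mulmxDl mulmxK // -!scalemxAl !mxE.
  set X := (\sum_(_ < _) _)%R; set Y := (\sum_(_ < _) _)%R.
  by ring.
have mFG : measurable_fun setT (fun t : measurableTypeR R => \int[leb R n]_w G t w).
  by apply: (measurable_fun_fubini_tonelli_F (fun p => G p.1 p.2)) => // p; exact: F0.
have FG0 t : 0 <= \int[leb R n]_w G t w by apply: integral_ge0 => w _; exact: F0.
rewrite ge0_integralZl //.
have -> : \int[mu]_t \int[leb R n]_w G t w = \int[leb R n]_w \int[mu]_t G t w.
  exact: (fubini_tonelli _ mG (fun p => F0 _)).
rewrite integral_leb_step2 // detE normrM invfM.
rewrite EFinM [X in _ = X * _]muleC -muleA; congr (_ * _).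
rewrite -ge0_integralZl //.
- apply: eq_integral => w _; rewrite /G.
  rewrite (@integral_lebesgue_affine R s (r w) (fun t => F (cons_rV (t, w)))) //.
  apply: measurableT_comp => //; apply: (measurableT_comp (@measurable_cons_rV R n)).
  exact: measurable_pair2.
- apply: (measurable_fun_fubini_tonelli_G (fun p => F (cons_rV p))) => //.
  by apply: measurableT_comp => //; exact: measurable_cons_rV.
- by move=> w _; apply: integral_ge0.
Qed.

(* If the lower right block [D] of [A] is singular, a shear [E] adds [c *m w] to
   it, with [w] in the kernel of [D]; the new block is invertible because [A] is,
   and [A = (A *m E) *m E^-1] reduces the claim to [linear_change_block]. *)
Lemma integral_leb_linear n (A : 'M[R]_n) (F : 'rV[R]_n -> \bar R) :
  A \in unitmx -> measurable_fun setT F -> (forall x, 0 <= F x) ->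
  \int[leb R n]_x F (x *m A)%R = (`|\det A|^-1)%:E * \int[leb R n]_x F x.
Proof.
elim: n A F => [|n IH] A F uA mF F0.
  rewrite det_mx00 normr1 invr1 mul1e.
  by apply: eq_integral => x _; congr F; apply/rowP => -[].
have IHl (D : 'M[R]_n) : D \in unitmx -> linear_change D.
  by move=> uD G mG G0; exact: IH.
pose a := @ulsubmx _ 1 n 1 n A; pose b := @ursubmx _ 1 n 1 n A.
pose c := @dlsubmx _ 1 n 1 n A; pose D := @drsubmx _ 1 n 1 n A.
have AE : A = block_mx a b c D by rewrite submxK.
have [uD|nuD] := boolP (D \in unitmx).
  rewrite AE; apply: linear_change_block => //; last exact: IHl.
  by rewrite -AE.
have /det0P[w w0 wD] : \det D^T == 0%R.
  by rewrite det_tr; move: nuD; rewrite unitmxE unitfE negbK.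
have Dw : D *m w^T = 0%R by apply: trmx_inj; rewrite trmx_mul trmxK wD trmx0.
have ww : (0 < (w *m w^T) ord0 ord0)%R.
  rewrite mxE lt0r; apply/andP; split.
    apply: contra w0; rewrite psumr_eq0 => [/allP h|i _]; last by rewrite mxE -expr2 sqr_ge0.
    apply/eqP/rowP => i; have := h i (mem_index_enum _); rewrite !mxE /= -expr2 sqrf_eq0.
    by move/eqP.
  by apply: sumr_ge0 => i _; rewrite mxE -expr2 sqr_ge0.
pose E : 'M[R]_(1 + n) := block_mx 1%:M w 0 1%:M.
pose E' : 'M[R]_(1 + n) := block_mx 1%:M (- w)%R 0 1%:M.
have EE' : E *m E' = 1%:M.
  rewrite /E /E' mulmx_block !mul1mx !mul0mx !mulmx0 !mulmx1 !addr0 add0r addNr.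
  by rewrite -scalar_mx_block.
have AEE : A *m E = block_mx a (a *m w + b)%R c (c *m w + D)%R.
  have := mulmx_block a b c D (1%:M : 'M[R]_1) w 0%R (1%:M : 'M[R]_n).
  by rewrite !mulmx1 !mulmx0 !addr0 {1}AE => <-.
have uD' : (c *m w + D)%R \in unitmx.
  rewrite unitmxE unitfE; apply/det0P => -[x x0 xD].
  (* Multiplying by [w^T] kills [D] and leaves [x c] times the positive number [w w^T]. *)
  have xc : (x *m c)%R = 0%R.
    have : (x *m (c *m w + D) *m w^T = 0)%R by rewrite xD mul0mx.
    rewrite -mulmxA mulmxDl Dw addr0 -mulmxA mulmxA (mx11_scalar (w *m w^T)).
    move/eqP; rewrite mul_mx_scalar scaler_eq0 => /orP[/eqP h|/eqP //].
    by rewrite h ltxx in ww.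
  have xD0 : (x *m D)%R = 0%R by move: xD; rewrite mulmxDr mulmxA xc mul0mx add0r.
  have : (row_mx (0 : 'M[R]_1) x *m A = 0)%R.
    have := mul_row_block (0%R : 'M[R]_1) x a b c D.
    by rewrite xc xD0 !mul0mx !addr0 row_mx0 -AE.
  move=> h; have : row_mx (0%R : 'M[R]_1) x == 0%R.
    by apply/eqP; rewrite -[LHS](mulmxK uA) h mul0mx.
  by rewrite row_mx_eq0 eqxx (negbTE x0).
have uE : E \in unitmx by case: (mulmx1_unit EE').
have uE' : E' \in unitmx by case: (mulmx1_unit EE').
have dE : \det E = 1%R by rewrite det_ublock !det1 mulr1.
have dE' : \det E' = 1%R by rewrite det_ublock !det1 mulr1.
transitivity (\int[leb R n.+1]_x F (x *m (A *m E) *m E')%R).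
  by apply: eq_integral => x _; rewrite -!mulmxA EE' mulmx1.
have H : linear_change (A *m E : 'M[R]_n.+1).
  rewrite AEE; apply: linear_change_block => //; last exact: IHl.
  by rewrite -AEE unitmx_mul uA.
rewrite (H (fun x => F (x *m E'))) //; last first.
  by apply: measurableT_comp => //; exact: (@measurable_rV_linear n.+1 n.+1).
have H' : linear_change (E' : 'M[R]_n.+1).
  by apply: linear_change_block => //; [exact: unitmx1|apply: IHl; exact: unitmx1].
by rewrite H' // det_mulmx dE dE' mulr1 normr1 invr1 mul1e.
Qed.

End change_of_variables.

(** * Complex-valued integrals *)

Section complex_arith.
Context {R : realType}.
Local Notation C := R[i].
Implicit Types z w : C.

Lemma ReD z w : complex.Re (z + w) = complex.Re z + complex.Re w.
Proof. by case: z w => a b [c d]. Qed.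

Lemma ImD z w : complex.Im (z + w) = complex.Im z + complex.Im w.
Proof. by case: z w => a b [c d]. Qed.

Lemma ReM z w : complex.Re (z * w) =
  complex.Re z * complex.Re w - complex.Im z * complex.Im w.
Proof. by case: z w => a b [c d]. Qed.

Lemma ImM z w : complex.Im (z * w) =
  complex.Re z * complex.Im w + complex.Im z * complex.Re w.
Proof. by case: z w => a b [c d]. Qed.

Lemma ReN z : complex.Re (- z) = - complex.Re z.
Proof. by case: z. Qed.

Lemma ImN z : complex.Im (- z) = - complex.Im z.
Proof. by case: z. Qed.

Lemma Re_conj z : complex.Re z^* = complex.Re z.
Proof. by case: z. Qed.

Lemma Im_conj z : complex.Im z^* = - complex.Im z.
Proof. by case: z. Qed.

Lemma Re_sum I (r : seq I) (P : pred I) (F : I -> C) :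
  complex.Re (\sum_(i <- r | P i) F i) = \sum_(i <- r | P i) complex.Re (F i).
Proof. by apply: (big_morph (@complex.Re R)) => //; exact: ReD. Qed.

Lemma Im_sum I (r : seq I) (P : pred I) (F : I -> C) :
  complex.Im (\sum_(i <- r | P i) F i) = \sum_(i <- r | P i) complex.Im (F i).
Proof. by apply: (big_morph (@complex.Im R)) => //; exact: ImD. Qed.

Lemma complexP z w : complex.Re z = complex.Re w -> complex.Im z = complex.Im w ->
  z = w.
Proof. by case: z w => a b [c d] /= -> ->. Qed.

Lemma norm_cabs z : `|z| = (cabs z)%:C%C.
Proof. by case: z. Qed.

Lemma cabsE z : cabs z = Num.sqrt (complex.Re z ^+ 2 + complex.Im z ^+ 2).
Proof. by case: z. Qed.

Lemma cabs_ge0 z : 0 <= cabs z.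
Proof. by rewrite cabsE sqrtr_ge0. Qed.

Lemma cabs_sqr z : cabs z ^+ 2 = complex.Re z ^+ 2 + complex.Im z ^+ 2.
Proof. by rewrite cabsE sqr_sqrtr // addr_ge0 // sqr_ge0. Qed.

Lemma cabsM z w : cabs (z * w) = cabs z * cabs w.
Proof.
have : (cabs (z * w))%:C%C = (cabs z * cabs w)%:C%C :> C.
  by rewrite rmorphM /= -!norm_cabs normrM.
by move/complexI.
Qed.

Lemma cabsD z w : cabs (z + w) <= cabs z + cabs w.
Proof.
have := ler_normD z w.
by rewrite !norm_cabs -rmorphD /= lecR.
Qed.

Lemma cabsN z : cabs (- z) = cabs z.
Proof. by rewrite !cabsE ReN ImN !sqrrN. Qed.

Lemma cabs_conj z : cabs z^* = cabs z.
Proof. by rewrite !cabsE Re_conj Im_conj !sqrrN. Qed.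

Lemma cabs0 : cabs (0 : C) = 0.
Proof. by rewrite cabsE /= expr0n addr0 sqrtr0. Qed.

Lemma cabs_eq0 z : cabs z = 0 -> z = 0.
Proof. by move=> z0; apply/eqP; rewrite -normr_eq0 norm_cabs z0. Qed.

Lemma cabs_real (r : R) : cabs r%:C%C = `|r|.
Proof. by rewrite cabsE /= expr0n addr0 sqrtr_sqr. Qed.

Lemma cabs_sum I (r : seq I) (P : pred I) (F : I -> C) :
  cabs (\sum_(i <- r | P i) F i) <= \sum_(i <- r | P i) cabs (F i).
Proof.
elim/big_ind2 : _ => //; first by rewrite cabs0.
by move=> a b c d ab cd; rewrite (le_trans (cabsD _ _)) // lerD.
Qed.

Lemma Re_le_cabs z : `|complex.Re z| <= cabs z.
Proof.
rewrite -(@ler_pXn2r _ 2) ?nnegrE ?normr_ge0 ?cabs_ge0 // cabs_sqr.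
by rewrite real_normK ?num_real // lerDl sqr_ge0.
Qed.

Lemma Im_le_cabs z : `|complex.Im z| <= cabs z.
Proof.
rewrite -(@ler_pXn2r _ 2) ?nnegrE ?normr_ge0 ?cabs_ge0 // cabs_sqr.
by rewrite real_normK ?num_real // lerDr sqr_ge0.
Qed.

Lemma cabs_le_ReIm z : cabs z <= `|complex.Re z| + `|complex.Im z|.
Proof.
rewrite -(@ler_pXn2r _ 2) ?nnegrE ?addr_ge0 ?cabs_ge0 // cabs_sqr.
rewrite -(real_normK (num_real (complex.Re z))) -(real_normK (num_real (complex.Im z))).
by rewrite sqrrD -addrA lerD2l lerDr mulrn_wge0 // mulr_ge0.
Qed.

Lemma conj_mul_cabs z : z^* * z = (cabs z ^+ 2)%:C%C.
Proof.
rewrite cabs_sqr; apply: complexP; rewrite ?ReM ?ImM Re_conj Im_conj /=; ring.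
Qed.

Lemma cabs_sqrD z w : cabs (z + w) ^+ 2 <= 2 * cabs z ^+ 2 + 2 * cabs w ^+ 2.
Proof.
rewrite !cabs_sqr ReD ImD.
have := sqr_ge0 (complex.Re z - complex.Re w).
have := sqr_ge0 (complex.Im z - complex.Im w).
nra.
Qed.

Lemma expiD (s t : R) : expi (s + t) = expi s * expi t.
Proof.
apply: complexP; rewrite ?ReM ?ImM /expi /= mulrDr ?cosD ?sinD //.
by rewrite addrC; congr (_ + _); rewrite mulrC.
Qed.

Lemma expi0 : expi (0 : R) = 1.
Proof. by rewrite /expi mulr0 cos0 sin0. Qed.

Lemma expiN (t : R) : expi (- t) = (expi t)^*.
Proof.
by apply: complexP; rewrite ?Re_conj ?Im_conj /expi /= mulrN ?cosN ?sinN.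
Qed.

Lemma cabs_expi (t : R) : cabs (expi t) = 1.
Proof. by rewrite cabsE /= cos2Dsin2 sqrtr1. Qed.

Lemma expi_nat (k : nat) : expi (k%:R : R) = 1.
Proof.
elim: k => [|k IH]; first exact: expi0.
rewrite -addn1 natrD expiD IH mul1r /expi mulr1 mulr_natl cos2pi.
by rewrite mulr2n sinD sinpi mulr0 mul0r addr0.
Qed.

Lemma expi_int (t : R) : t \is a Num.int -> expi t = 1.
Proof.
move=> /intrP[[k|k] ->]; first exact: expi_nat.
rewrite NegzE mulrNz expiN.
have -> : expi (k.+1%:~R : R) = 1 by exact: expi_nat.
by apply: complexP; rewrite ?Re_conj ?Im_conj /= ?oppr0.
Qed.

End complex_arith.

Section dot.
Context {R : realType} {n : nat}.
Implicit Types x y z : 'rV[R]_n.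

Lemma dotDl x y z : dot (x + y) z = dot x z + dot y z.
Proof. by rewrite /dot -big_split /=; apply: eq_bigr => i _; rewrite mxE mulrDl. Qed.

Lemma dotC x y : dot x y = dot y x.
Proof. by apply: eq_bigr => i _; rewrite mulrC. Qed.

Lemma dotDr x y z : dot x (y + z) = dot x y + dot x z.
Proof. by rewrite dotC dotDl !(dotC x). Qed.

Lemma dotNl x y : dot (- x) y = - dot x y.
Proof. by rewrite /dot -sumrN; apply: eq_bigr => i _; rewrite mxE mulNr. Qed.

Lemma dotE x y : dot x y = (x *m y^T) ord0 ord0.
Proof. by rewrite mxE; apply: eq_bigr => i _; rewrite mxE. Qed.

Lemma dot_mul x y (A : 'M[R]_n) : dot (x *m A) y = dot x (y *m A^T).
Proof. by rewrite !dotE trmx_mul trmxK mulmxA. Qed.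

Lemma dot0l x : dot 0 x = 0.
Proof. by rewrite /dot big1 // => i _; rewrite mxE mul0r. Qed.

Lemma iotaD (g h : 'rV[int]_n) : Defs.iota R (g + h) = Defs.iota R g + Defs.iota R h.
Proof. exact: map_mxD. Qed.

Lemma iotaN (g : 'rV[int]_n) : Defs.iota R (- g) = - Defs.iota R g.
Proof. exact: map_mxN. Qed.

Lemma iota_inj : injective (@Defs.iota R n).
Proof.
move=> g h /rowP gh; apply/rowP => i; have := gh i; rewrite !mxE.
by move/eqP; rewrite eqr_int => /eqP.
Qed.

Lemma dot_int (g h : 'rV[int]_n) : dot (Defs.iota R g) (Defs.iota R h) \is a Num.int.
Proof. by apply: rpred_sum => i _; rewrite !mxE -intrM intr_int. Qed.

End dot.

Section complex_measurable.
Context {R : realType} {d : measure_display} {T : measurableType d}.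
Local Notation C := R[i].
Implicit Types f g : T -> C.

Definition cmeasurable f := measurable_fun setT (fun x => complex.Re (f x)) /\
  measurable_fun setT (fun x => complex.Im (f x)).

Lemma cmeasurable_cst (c : C) : cmeasurable (fun=> c).
Proof. by split; exact: measurable_cst. Qed.

Lemma cmeasurableD f g : cmeasurable f -> cmeasurable g ->
  cmeasurable (fun x => f x + g x).
Proof.
move=> [rf mf] [rg mg]; split.
- by under eq_fun do rewrite ReD; exact: measurable_funD.
- by under eq_fun do rewrite ImD; exact: measurable_funD.
Qed.

Lemma cmeasurableN f : cmeasurable f -> cmeasurable (fun x => - f x).
Proof.
move=> [rf mf]; split.
- by under eq_fun do rewrite ReN; exact: measurableT_comp.
- by under eq_fun do rewrite ImN; exact: measurableT_comp.
Qed.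

Lemma cmeasurableB f g : cmeasurable f -> cmeasurable g ->
  cmeasurable (fun x => f x - g x).
Proof. by move=> mf mg; apply: cmeasurableD => //; exact: cmeasurableN. Qed.

Lemma cmeasurableM f g : cmeasurable f -> cmeasurable g ->
  cmeasurable (fun x => f x * g x).
Proof.
move=> [rf mf] [rg mg]; split.
- by under eq_fun do rewrite ReM; apply: measurable_funB; exact: measurable_funM.
- by under eq_fun do rewrite ImM; apply: measurable_funD; exact: measurable_funM.
Qed.

Lemma cmeasurable_conj f : cmeasurable f -> cmeasurable (fun x => (f x)^*).
Proof.
move=> [rf mf]; split.
- by under eq_fun do rewrite Re_conj.
- by under eq_fun do rewrite Im_conj; exact: measurableT_comp.
Qed.

Lemma cmeasurable_sum I (s : seq I) (h : I -> T -> C) :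
  (forall i, cmeasurable (h i)) -> cmeasurable (fun x => \sum_(i <- s) h i x).
Proof.
move=> mh; elim: s => [|i s IH].
  by under eq_fun do rewrite big_nil; exact: cmeasurable_cst.
by under eq_fun do rewrite big_cons; exact: cmeasurableD.
Qed.

Lemma cmeasurable_real (r : T -> R) : measurable_fun setT r ->
  cmeasurable (fun x => (r x)%:C%C).
Proof. by move=> mr; split => //=; exact: measurable_cst. Qed.

Lemma cmeasurable_expi (r : T -> R) : measurable_fun setT r ->
  cmeasurable (fun x => expi (r x)).
Proof.
move=> mr; have m2 : measurable_fun setT (fun x => 2 * pi * r x) by exact: measurable_funM.
split => /=; apply: (measurableT_comp _ m2).
- by apply: continuous_measurable_fun => x; exact: continuous_cos.
- by apply: continuous_measurable_fun => x; exact: continuous_sin.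
Qed.

Lemma cmeasurable_cabs f : cmeasurable f -> measurable_fun setT (fun x => cabs (f x)).
Proof.
move=> [rf mf]; under eq_fun do rewrite cabsE.
apply: measurableT_comp.
  by apply: continuous_measurable_fun => x; exact: sqrt_continuous.
by apply: measurable_funD; exact: measurable_funX.
Qed.

End complex_measurable.

Lemma cmeasurable_comp {R : realType} d d' (T : measurableType d)
    (U : measurableType d') (f : U -> R[i]) (h : T -> U) :
  cmeasurable f -> measurable_fun setT h -> cmeasurable (fun x => f (h x)).
Proof. by move=> [rf mf] mh; split; [exact: (measurableT_comp rf mh)|exact: (measurableT_comp mf mh)]. Qed.

Section open_measurable_rV.
Context {R : realType} {n : nat}.

Lemma measurable_dot d (T : measurableType d) (f g : T -> 'rV[R]_n) :
  measurable_fun setT f -> measurable_fun setT g ->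
  measurable_fun setT (fun x => dot (f x) (g x)).
Proof.
move=> mf mg; apply: measurable_sum => i.
by apply: measurable_funM; apply: (measurableT_comp (measurable_coord i)).
Qed.

Lemma measurable_rV_rect (a b : 'rV[R]_n) :
  measurable [set x : 'rV[R]_n | forall i, a ord0 i <= x ord0 i < b ord0 i].
Proof.
rewrite (_ : [set _ | _] = \bigcap_(i in [set: 'I_n])
    ((fun x : 'rV[R]_n => x ord0 i) @^-1` `[a ord0 i, b ord0 i[)).
  apply: fin_bigcap_measurable => // i _.
  by rewrite -[X in measurable X]setTI; exact: measurable_coord.
apply/seteqP; split => x /= h i; first by rewrite /= in_itv /= h.
by have := h i I; rewrite /= in_itv.
Qed.

(** The sigma-algebra is generated by coordinates, so openness has to be reduced to countably many
    boxes: [U] is the union of the grid boxes of mesh [1/(k+1)] that it contains. *)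
Lemma open_measurable_rV (U : set 'rV[R]_n) : open U -> measurable U.
Proof.
move=> oU.
pose Q (p : nat * 'rV[int]_n) := [set x : 'rV[R]_n | forall i,
  ((p.1.+1%:R^-1) *: Defs.iota R p.2) ord0 i <= x ord0 i <
  ((p.1.+1%:R^-1) *: Defs.iota R (p.2 + const_mx 1)) ord0 i].
have -> : U = \bigcup_p (if `[< Q p `<=` U >] then Q p else set0).
  apply/seteqP; split => x; last first.
    by move=> [p _]; case: asboolP => // h /h.
  move=> Ux.
  have /nbhs_ballP[e /= e0 eU] : nbhs x U by exact: open_nbhs_nbhs.
  pose k := Num.truncn (e^-1).
  have k1 : 0 < k.+1%:R :> R by [].
  have kP : k.+1%:R^-1 < e.
    by rewrite invf_plt ?posrE // truncnS_gt.
  pose g : 'rV[int]_n := \row_i Num.floor (k.+1%:R * x ord0 i).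
  have bnd (y : 'rV[R]_n) i : (((k.+1%:R^-1) *: Defs.iota R g) ord0 i <= y ord0 i <
      ((k.+1%:R^-1) *: Defs.iota R (g + const_mx 1)) ord0 i) =
      (k.+1%:R^-1 * (Num.floor (k.+1%:R * x ord0 i))%:~R <= y ord0 i <
      k.+1%:R^-1 * ((Num.floor (k.+1%:R * x ord0 i))%:~R + 1)).
    by rewrite !mxE intrD.
  have Qx : Q (k, g) x.
    move=> i /=; rewrite bnd ler_pdivrMl // ltr_pdivlMl // ge_floor /=.
    by rewrite -[1]/(1%:~R) -intrD lt_succ_floor.
  exists (k, g) => //; case: asboolP => // -[] y Qy; apply: eU.
  split => // i j; rewrite (ord1 i) /ball /=.
  have := Qx j; have := Qy j; rewrite /= !bnd.
  rewrite mulrDr mulr1; move: kP; set c := _^-1; set t := c * _.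
  move=> kP /andP[y1 y2] /andP[x1 x2].
  by apply: le_lt_trans kP; rewrite ler_norml; apply/andP; split; lra.
apply: countable_bigcupT_measurable; first exact: countableP.
by move=> p; case: ifP => // _; exact: measurable_rV_rect.
Qed.

Lemma continuous_measurable_rV (f : 'rV[R]_n -> R) :
  continuous f -> measurable_fun setT f.
Proof.
move=> /continuousP cf; apply: (measurability _ (RGenOpens.measurableE R)).
move=> _ [_ [a [b ->] <-]]; rewrite setTI.
by apply: open_measurable_rV; apply: cf; exact: interval_open.
Qed.

(** The norm of [R[i]] is itself complex-valued; this moves convergence to the real number [cabs],
    where order arguments are available. *)
Lemma cvg_complexE (T : Type) (F : set_system T) {FF : Filter F} (f : T -> R[i]) (l : R[i]) :
  (f : T -> (R[i])^o) @ F --> (l : (R[i])^o) -> (fun x => cabs (l - f x)) @ F --> 0.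
Proof.
move=> h; apply/cvgrPdist_lt => e e0.
have e0' : 0 < e%:C%C by rewrite ltcR.
move/cvgrPdist_lt : h => /(_ _ e0'); apply: filterS => x.
move=> h'.
have nE : `|(l : (R[i])^o) - f x| = (cabs (l - f x))%:C%C by exact: norm_cabs.
have : (cabs (l - f x))%:C%C < e%:C%C :> R[i] by rewrite -nE.
by rewrite ltcR sub0r normrN ger0_norm ?cabs_ge0.
Qed.

Lemma continuous_cmeasurable (f : 'rV[R]_n -> R[i]) :
  continuous (f : 'rV[R]_n -> (R[i])^o) -> cmeasurable f.
Proof.
move=> cf; split; apply: continuous_measurable_rV => x.
- have h0 : (fun y => cabs (f x - f y)) @ x --> 0 by exact: cvg_complexE (cf x).
  have h := (@cvgrPdist_lt _ _ _ _ _ _ _).1 h0.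
  apply/(@cvgrPdist_lt _ _ _ (nbhs x)) => e /h; apply: filterS => y /=; apply: le_lt_trans.
  by rewrite sub0r normrN (ger0_norm (cabs_ge0 _)) -ReN -ReD Re_le_cabs.
- have h0 : (fun y => cabs (f x - f y)) @ x --> 0 by exact: cvg_complexE (cf x).
  have h := (@cvgrPdist_lt _ _ _ _ _ _ _).1 h0.
  apply/(@cvgrPdist_lt _ _ _ (nbhs x)) => e /h; apply: filterS => y /=; apply: le_lt_trans.
  by rewrite sub0r normrN (ger0_norm (cabs_ge0 _)) -ImN -ImD Im_le_cabs.
Qed.

End open_measurable_rV.

Section complex_integral.
Context {R : realType}.
Local Notation C := R[i].

Definition cintegrable n (f : 'rV[R]_n -> C) :=
  (leb R n).-integrable setT (fun x => (complex.Re (f x))%:E) /\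
  (leb R n).-integrable setT (fun x => (complex.Im (f x))%:E).

(** Bounded, measurable, of bounded support. Unlike continuity with compact support, this survives
    multiplication by the indicator of a cube, and it is stable under all operations below, so
    integrability reduces to membership in one class. *)
Definition bcs n (f : 'rV[R]_n -> C) := [/\ cmeasurable f,
  exists M, forall x, cabs (f x) <= M &
  exists M, forall x, f x != 0 -> forall i, `|x ord0 i| <= M].

Section theory.
Context {n : nat}.
Implicit Types f g : 'rV[R]_n -> C.

Lemma cintegrableD f g : cintegrable f -> cintegrable g ->
  cintegrable (fun x => f x + g x).
Proof.
move=> [rf mf] [rg mg]; split.
- by under eq_fun do rewrite ReD EFinD; exact: integrableD.
- by under eq_fun do rewrite ImD EFinD; exact: integrableD.
Qed.

Lemma cintegrableZ (c : C) f : cintegrable f -> cintegrable (fun x => c * f x).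
Proof.
move=> [rf mf]; split.
- under eq_fun do rewrite ReM EFinB !EFinM; apply: integrableB => //;
  exact: integrableZl.
- under eq_fun do rewrite ImM EFinD !EFinM; apply: integrableD => //;
  exact: integrableZl.
Qed.

Lemma CintegralD f g : cintegrable f -> cintegrable g ->
  Cintegral (fun x => f x + g x) = Cintegral f + Cintegral g.
Proof.
move=> [rf mf] [rg mg]; apply: complexP; rewrite ?ReD ?ImD /=.
- by under eq_Rintegral do rewrite ReD; exact: RintegralD.
- by under eq_Rintegral do rewrite ImD; exact: RintegralD.
Qed.

Lemma CintegralZ (c : C) f : cintegrable f ->
  Cintegral (fun x => c * f x) = c * Cintegral f.
Proof.
move=> [rf mf]; apply: complexP; rewrite ?ReM ?ImM /=.
- under eq_Rintegral do rewrite ReM.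
  rewrite RintegralB //; first by rewrite !RintegralZl.
  + exact: (integrableZl _ _ rf).
  + exact: (integrableZl _ _ mf).
- under eq_Rintegral do rewrite ImM.
  rewrite RintegralD //; first by rewrite !RintegralZl.
  + exact: (integrableZl _ _ mf).
  + exact: (integrableZl _ _ rf).
Qed.

Lemma cintegrable0 : cintegrable (fun=> 0 : C) (n := n).
Proof. by split; exact: integrable0. Qed.

Lemma Cintegral0 : Cintegral (fun=> 0 : C) (n := n) = 0.
Proof.
by apply: complexP; rewrite /= /Rintegral /= integral0_eq.
Qed.

Lemma cintegrable_sum I (s : seq I) (h : I -> 'rV[R]_n -> C) :
  (forall i, cintegrable (h i)) -> cintegrable (fun x => \sum_(i <- s) h i x).
Proof.
move=> ih; elim: s => [|i s IH].
  by under eq_fun do rewrite big_nil; exact: cintegrable0.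
by under eq_fun do rewrite big_cons; exact: cintegrableD.
Qed.

Lemma Cintegral_sum I (s : seq I) (h : I -> 'rV[R]_n -> C) :
  (forall i, cintegrable (h i)) ->
  Cintegral (fun x => \sum_(i <- s) h i x) = \sum_(i <- s) Cintegral (h i).
Proof.
move=> ih; elim: s => [|i s IH].
  by under eq_fun do rewrite big_nil; rewrite big_nil Cintegral0.
under eq_fun do rewrite big_cons.
by rewrite CintegralD ?IH ?big_cons //; exact: cintegrable_sum.
Qed.

Lemma Cintegral_conj f : cintegrable f ->
  Cintegral (fun x => (f x)^*) = (Cintegral f)^*.
Proof.
move=> [rf mf]; apply: complexP; rewrite ?Re_conj ?Im_conj /=.
- by under eq_Rintegral do rewrite Re_conj.
- under eq_Rintegral do rewrite Im_conj -mulN1r.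
  by rewrite RintegralZl // mulN1r.
Qed.

(** The factor 2 comes from bounding the real and imaginary parts separately; every use absorbs
    it. *)
Lemma cabs_Cintegral_le f g : cintegrable f -> cintegrable g ->
  (forall x, cabs (f x) <= complex.Re (g x)) ->
  cabs (Cintegral f) <= 2 * complex.Re (Cintegral g).
Proof.
move=> [rf mf] [rg _] fg; apply: le_trans (cabs_le_ReIm _) _.
rewrite mulr_natl mulr2n lerD //=.
- apply: le_trans (le_normr_Rintegral _ _) _ => //.
  apply: le_Rintegral => // [|x _]; last exact: le_trans (Re_le_cabs _) (fg x).
  by have := integrable_abse rf.
- apply: le_trans (le_normr_Rintegral _ _) _ => //.
  apply: le_Rintegral => // [|x _]; last exact: le_trans (Im_le_cabs _) (fg x).
  by have := integrable_abse mf.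
Qed.

Lemma bcs_cintegrable f : bcs f -> cintegrable f.
Proof.
move=> [[rf mf] [M hM] [N hN]].
(* The bound [N] may be negative when [f] vanishes identically; [|N|] keeps the box in the form that
   [leb_box] measures. *)
pose B := [set x : 'rV[R]_n | forall i, - `|N| <= x ord0 i <= `|N|].
have mB : measurable B.
  rewrite (_ : B = \bigcap_(i in [set: 'I_n])
      ((fun x : 'rV[R]_n => x ord0 i) @^-1` `[- `|N|, `|N|])).
    apply: fin_bigcap_measurable => // i _.
    by rewrite -[X in measurable X]setTI; exact: measurable_coord.
  apply/seteqP; split => x /= h i; first by rewrite /= in_itv /= h.
  by have := h i I; rewrite /= in_itv.
have Bfin : (leb R n B < +oo)%E.
  have -> : B = [set x : 'rV[R]_n | forall i, (const_mx (- `|N|) : 'rV[R]_n) ord0 i <= x ord0 i <= (const_mx `|N| : 'rV[R]_n) ord0 i].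
    by apply/seteqP; split => x h i; have := h i; rewrite ?mxE.
  by rewrite leb_box ?ltry // => i; rewrite !mxE ge0_cp.
have iB : (leb R n).-integrable setT (fun x => (M * \1_B x)%:E).
  under eq_fun do rewrite EFinM.
  apply: integrableZl => //; apply/integrableP; split.
    exact/measurable_EFinP/measurable_indic.
  under eq_integral do rewrite gee0_abs ?lee_fin //.
  by rewrite integral_indic // setIT.
have bnd x : cabs (f x) <= M * \1_B x.
  rewrite indicE; have [xB|xB] := boolP (x \in B); first by rewrite mulr1.
  suff -> : f x = 0 by rewrite cabs0 mulr0.
  apply/eqP; apply: contraNT xB => fx; rewrite inE => i /=.
  by rewrite -ler_norml (le_trans (hN _ fx i)) // ler_norm.
split.
- apply: le_integrable iB => //; first exact/measurable_EFinP.
  move=> x _; rewrite /= lee_fin; apply: le_trans (Re_le_cabs _) _.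
  exact: le_trans (bnd x) (ler_norm _).
- apply: le_integrable iB => //; first exact/measurable_EFinP.
  move=> x _; rewrite /= lee_fin; apply: le_trans (Im_le_cabs _) _.
  exact: le_trans (bnd x) (ler_norm _).
Qed.

Lemma bcsM f g : bcs f -> cmeasurable g -> (exists M, forall x, cabs (g x) <= M) ->
  bcs (fun x => f x * g x).
Proof.
move=> [mf [M hM] [N hN]] mg [K hK]; split.
- exact: cmeasurableM.
- exists (M * K) => x; rewrite cabsM ler_pM ?cabs_ge0 //.
- by exists N => x fg i; apply: hN; apply: contra_neq fg => ->; rewrite mul0r.
Qed.

Lemma bcs_le f g : cmeasurable f -> bcs g -> (forall x, cabs (f x) <= cabs (g x)) ->
  bcs f.
Proof.
move=> mf [mg [M hM] [N hN]] fg; split => //.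
- by exists M => x; rewrite (le_trans (fg x)).
- exists N => x fx; apply: hN; apply: contra_neq fx => gx.
  by apply: cabs_eq0; apply/eqP; rewrite eq_le cabs_ge0 andbT -cabs0 -gx fg.
Qed.

Lemma bcs_conj f : bcs f -> bcs (fun x => (f x)^*).
Proof.
move=> bf; apply: (bcs_le _ bf); first by case: bf => mf _ _; exact: cmeasurable_conj.
by move=> x; rewrite cabs_conj.
Qed.

Lemma bcs_abs f : bcs f -> bcs (fun x => (cabs (f x))%:C%C).
Proof.
move=> bf; apply: (bcs_le _ bf).
  by case: bf => mf _ _; apply: cmeasurable_real; exact: cmeasurable_cabs.
by move=> x; rewrite cabs_real ger0_norm ?cabs_ge0.
Qed.

Lemma bcsZ c f : bcs f -> bcs (fun x => c * f x).
Proof.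
move=> bf; under eq_fun do rewrite mulrC; apply: (bcsM bf (cmeasurable_cst c)).
by exists (cabs c).
Qed.

Lemma bcs0 : bcs (fun=> 0 : C) (n := n).
Proof.
split; first exact: cmeasurable_cst.
- by exists 0 => x; rewrite cabs0.
- by exists 0 => x; rewrite eqxx.
Qed.

Lemma bcsD f g : bcs f -> bcs g -> bcs (fun x => f x + g x).
Proof.
move=> [mf [M hM] [N hN]] [mg [M' hM'] [N' hN']]; split.
- exact: cmeasurableD.
- by exists (M + M') => x; rewrite (le_trans (cabsD _ _)) // lerD.
- exists (Num.max N N') => x fg i; rewrite le_max.
  have [fx|/hN ->//] := eqVneq (f x) 0; rewrite fx add0r in fg.
  by rewrite (hN' _ fg) orbT.
Qed.

Lemma bcs_translate f a : bcs f -> bcs (fun x => f (x + a)).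
Proof.
move=> [mf [M hM] [N hN]]; split.
- by apply: (cmeasurable_comp mf); apply: measurable_rV_add => //; exact: measurable_cst.
- by exists M.
- exists (N + \sum_i `|a ord0 i|) => x fx i.
  have := hN _ fx i; rewrite mxE => h.
  rewrite -[x ord0 i](addrK (a ord0 i)) (le_trans (ler_normB _ _)) // lerD //.
  by rewrite (bigD1 i) //= lerDl sumr_ge0.
Qed.

Lemma bcs_linear f (A : 'M[R]_n) : A \in unitmx -> bcs f -> bcs (fun x => f (x *m A)).
Proof.
move=> uA [mf [M hM] [N hN]]; split.
- by apply: (cmeasurable_comp mf); exact: measurable_rV_linear.
- by exists M.
- exists (\sum_i \sum_j `|N| * `|invmx A j i|) => x fx i.
  rewrite -[x](mulmxK uA) mxE [X in _ <= X](bigD1 i) //= ler_wpDr //.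
    by apply: sumr_ge0 => k _; apply: sumr_ge0 => j _; rewrite mulr_ge0.
  apply: le_trans (ler_norm_sum _ _ _) _; apply: ler_sum => j _.
  by rewrite normrM ler_wpM2r // (le_trans (hN _ fx j)) // ler_norm.
Qed.

(** Common to translations and linear maps: a substitution rule for nonnegative functions passes to
    integrable ones through their positive and negative parts. *)
Let push_Rintegral (phi : 'rV[R]_n -> 'rV[R]_n) (c : R) (r : 'rV[R]_n -> R) :
  (forall F : 'rV[R]_n -> \bar R, measurable_fun setT F -> (forall x, 0 <= F x)%E ->
    \int[leb R n]_x F (phi x) = c%:E * \int[leb R n]_x F x)%E ->
  (leb R n).-integrable setT (EFin \o r) ->
  \int[leb R n]_x r (phi x) = c * \int[leb R n]_x r x.
Proof.
move=> h ir.
have mr : measurable_fun setT (EFin \o r) by case/integrableP : ir.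
rewrite /Rintegral integralE [in RHS]integralE.
have := h (EFin \o r)^\+%E (measurable_funepos mr) (fun x => funepos_ge0 _ x).
have := h (EFin \o r)^\-%E (measurable_funeneg mr) (fun x => funeneg_ge0 _ x).
move=> hn hp.
have -> : (fun x => (r (phi x))%:E)^\+%E = (fun x => (EFin \o r)^\+%E (phi x)).
  by apply/funext => x; rewrite !funeposE.
have -> : (fun x => (r (phi x))%:E)^\-%E = (fun x => (EFin \o r)^\-%E (phi x)).
  by apply/funext => x; rewrite !funenegE.
rewrite hn hp.
have fp := integrable_pos_fin_num measurableT ir.
have fn := integrable_neg_fin_num measurableT ir.
rewrite -muleBr // ?fin_num_adde_defl //; last by rewrite fin_numN.
by rewrite fineM // fin_numB fp fn.
Qed.

Let push_Cintegral (phi : 'rV[R]_n -> 'rV[R]_n) (c : R) f :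
  (forall F : 'rV[R]_n -> \bar R, measurable_fun setT F -> (forall x, 0 <= F x)%E ->
    \int[leb R n]_x F (phi x) = c%:E * \int[leb R n]_x F x)%E ->
  cintegrable f -> Cintegral (fun x => f (phi x)) = c%:C%C * Cintegral f.
Proof.
move=> h [rf mf]; apply: complexP; rewrite ?ReM ?ImM /= mul0r ?subr0 ?addr0.
- exact: (push_Rintegral (r := fun x => complex.Re (f x))).
- exact: (push_Rintegral (r := fun x => complex.Im (f x))).
Qed.

Lemma Cintegral_translate f a : cintegrable f ->
  Cintegral (fun x => f (x + a)) = Cintegral f.
Proof.
move=> fi; rewrite (@push_Cintegral (fun x => x + a) 1) ?mul1r // => F mF F0.
by rewrite mul1e integral_leb_translate.
Qed.

Lemma Cintegral_linear f (A : 'M[R]_n) : A \in unitmx -> cintegrable f ->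
  Cintegral (fun x => f (x *m A)) = (`|\det A|^-1)%:C%C * Cintegral f.
Proof.
move=> uA fi; rewrite (@push_Cintegral (fun x => x *m A) (`|\det A|^-1)) // => F mF F0.
by rewrite integral_leb_linear.
Qed.

Lemma Cintegral_opp f : cintegrable f ->
  Cintegral (fun x => f (- x)) = Cintegral f.
Proof.
move=> fi.
have uN : (- 1%:M : 'M[R]_n) \in unitmx.
  by rewrite -scaleN1r unitmxZ ?unitmx1 // unitrN unitr1.
have := Cintegral_linear uN fi.
have -> : (fun x => f (x *m (- 1%:M))) = (fun x => f (- x)).
  by apply/funext => x; rewrite mulmxN mulmx1.
move=> ->; rewrite -scaleN1r detZ det1 mulr1 normrX normrN1 expr1n invr1.
by rewrite mul1r.
Qed.

End theory.

(** Domination by a product of two integrable functions yields integrability of all sections and, by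
    Tonelli, on the product space. *)
Let Rintegral_Fubini m n (r : 'rV[R]_m -> 'rV[R]_n -> R) (f : 'rV[R]_m -> C) (g : 'rV[R]_n -> C) :
  measurable_fun setT (fun p : 'rV[R]_m * 'rV[R]_n => r p.1 p.2) ->
  bcs f -> bcs g -> (forall x y, `|r x y| <= cabs (f x) * cabs (g y)) ->
  \int[leb R m]_x \int[leb R n]_y r x y = \int[leb R n]_y \int[leb R m]_x r x y.
Proof.
move=> mr bf bg rfg.
have [intf _] := bcs_cintegrable (bcs_abs bf).
have [intg _] := bcs_cintegrable (bcs_abs bg).
rewrite /= in intf intg.
have mr1 x : measurable_fun setT (r x) by exact: (measurableT_comp mr (measurable_pair1 x)).
have mr2 y : measurable_fun setT (r ^~ y) by exact: (measurableT_comp mr (measurable_pair2 y)).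
have i1 x : (leb R n).-integrable setT (EFin \o r x).
  apply: (le_integrable _ _ _ (integrableZl measurableT (cabs (f x)) intg)) => //.
    exact/measurable_EFinP.
  by move=> y _; rewrite /= lee_fin (le_trans (rfg x y)) // ler_norm.
have i2 y : (leb R m).-integrable setT (EFin \o r ^~ y).
  apply: (le_integrable _ _ _ (integrableZl measurableT (cabs (g y)) intf)) => //.
    exact/measurable_EFinP.
  by move=> x _; rewrite /= lee_fin mulrC (le_trans (rfg x y)) // mulrC ler_norm.
have ip : (leb R m \x leb R n)%E.-integrable setT (fun p => (r p.1 p.2)%:E).
  apply/integrable12ltyP; first exact/measurable_EFinP.
  apply: (@le_lt_trans _ _ (\int[leb R m]_x ((cabs (f x))%:E * \int[leb R n]_y (cabs (g y))%:E))%E).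
    apply: ge0_le_integral => //.
    - by move=> x _; apply: integral_ge0.
    - apply: (measurable_fun_fubini_tonelli_F (fun p => `|(r p.1 p.2)%:E|%E)) => //.
      by apply: measurableT_comp => //; exact/measurable_EFinP.
    - apply: emeasurable_funM; last exact: measurable_cst.
      by apply/measurable_EFinP; case: bf => mf _ _; exact: cmeasurable_cabs.
    - move=> x _; rewrite -ge0_integralZl ?lee_fin ?cabs_ge0 //.
      + apply: ge0_le_integral => //.
        * by apply: measurableT_comp => //; apply/measurable_EFinP; exact: mr1.
        * apply: measurable_funeM; apply/measurable_EFinP.
          by case: bg => mg _ _; exact: cmeasurable_cabs.
        * by move=> y _; rewrite /= lee_fin.
      + by apply/measurable_EFinP; case: bg => mg _ _; exact: cmeasurable_cabs.
      + by move=> y _; rewrite lee_fin cabs_ge0.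
  have -> : (\int[leb R n]_y (cabs (g y))%:E)%E = (\int[leb R n]_y cabs (g y))%:E.
    by rewrite /Rintegral fineK //; exact: (integrable_fin_num measurableT intg).
  rewrite integralZr // lte_mul_pinfty //.
  - by apply: integral_ge0 => x _; rewrite lee_fin cabs_ge0.
  - exact: (integrable_fin_num measurableT intf).
  - by rewrite ltry.
rewrite /Rintegral.
under eq_integral do rewrite fineK ?(integrable_fin_num measurableT (i1 _)) //.
under [in RHS]eq_integral do rewrite fineK ?(integrable_fin_num measurableT (i2 _)) //.
by congr fine; exact: (Fubini ip).
Qed.

Lemma Cintegral_Fubini m n (F : 'rV[R]_m -> 'rV[R]_n -> C) (f : 'rV[R]_m -> C) (g : 'rV[R]_n -> C) :
  cmeasurable (fun p : 'rV[R]_m * 'rV[R]_n => F p.1 p.2) ->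
  bcs f -> bcs g -> (forall x y, cabs (F x y) <= cabs (f x) * cabs (g y)) ->
  Cintegral (fun x => Cintegral (F x)) = Cintegral (fun y => Cintegral (F ^~ y)).
Proof.
move=> [rF mF] bf bg Ffg; apply: complexP => /=.
- apply: (Rintegral_Fubini (r := fun x y => complex.Re (F x y)) rF bf bg) => x y.
  exact: le_trans (Re_le_cabs _) (Ffg x y).
- apply: (Rintegral_Fubini (r := fun x y => complex.Im (F x y)) mF bf bg) => x y.
  exact: le_trans (Im_le_cabs _) (Ffg x y).
Qed.

Lemma cmeasurable_Cintegral d (T : measurableType d) n (F : T -> 'rV[R]_n -> C) :
  cmeasurable (fun p : T * 'rV[R]_n => F p.1 p.2) ->
  cmeasurable (fun x => Cintegral (F x)).
Proof.
have H (r : T -> 'rV[R]_n -> R) : measurable_fun setT (fun p : T * 'rV[R]_n => r p.1 p.2) ->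
    measurable_fun setT (fun x => \int[leb R n]_y r x y).
  move=> mr; rewrite /Rintegral.
  apply: (measurableT_comp (@fine_measurable R setT measurableT)).
  have mr' : measurable_fun setT (fun p : T * 'rV[R]_n => (r p.1 p.2)%:E).
    exact/measurable_EFinP.
  under eq_fun do rewrite integralE.
  apply: emeasurable_funB.
  - apply: (eq_measurable_fun (fun x => \int[leb R n]_y (fun p : T * 'rV[R]_n => (r p.1 p.2)%:E)^\+ (x, y))%E).
      by move=> x _; apply: eq_integral => y _; rewrite !funeposE.
    apply: measurable_fun_fubini_tonelli_F => //; exact: measurable_funepos.
  - apply: (eq_measurable_fun (fun x => \int[leb R n]_y (fun p : T * 'rV[R]_n => (r p.1 p.2)%:E)^\- (x, y))%E).
      by move=> x _; apply: eq_integral => y _; rewrite !funenegE.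
    apply: measurable_fun_fubini_tonelli_F => //; exact: measurable_funeneg.
move=> [rF mF]; split => /=.
- exact: (H (fun x y => complex.Re (F x y)) rF).
- exact: (H (fun x y => complex.Im (F x y)) mF).
Qed.

End complex_integral.

(** * Poisson summation through the Fejer kernel *)

Section cube.
Context {R : realType} {n : nat}.
Local Notation C := R[i].
Local Notation iota := (@Defs.iota R n).
Implicit Types (y a : 'rV[R]_n) (g : 'rV[int]_n).

(** Half-open, so that the integer translates tile the space exactly: [round_rV y] is the only
    lattice point whose cube contains [y]. *)
Definition cube : set 'rV[R]_n := [set y | forall i, - 2^-1 <= y ord0 i < 2^-1].

Definition cubeI y : C := (\1_cube y)%:C%C.

Definition round_rV y : 'rV[int]_n := \row_i Num.floor (y ord0 i + 2^-1).

Lemma cubeI_sub y g : cubeI (y - iota g) = (g == round_rV y)%:R.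
Proof.
rewrite /cubeI indicE.
have -> : (y - iota g \in cube) = (g == round_rV y).
  apply/idP/eqP => [|->].
    rewrite inE => h; apply/rowP => i; have := h i; rewrite !mxE => /andP[h1 h2].
    by apply/esym/floor_def; rewrite intrD; apply/andP; split; lra.
  rewrite inE => i; rewrite !mxE.
  have := ge_floor (y ord0 i + 2^-1); have := lt_succ_floor (y ord0 i + 2^-1).
  by rewrite intrD => h1 h2; apply/andP; split; lra.
by case: eqP.
Qed.

Lemma cubeI_add y g : cubeI (y + iota g) = (g == - round_rV y)%:R.
Proof. by rewrite -[g]opprK iotaN cubeI_sub eqr_opp. Qed.

(** Each entry runs from [-M] to [M]. Listing the box through finite functions gives a
    duplicate-free sequence, so that lattice sums of finite support become plain big sums. *)
Definition int_box (M : nat) : seq 'rV[int]_n :=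
  [seq \row_i ((f i)%:Z - M%:Z) | f : {ffun 'I_n -> 'I_(M + M).+1}].

Lemma int_box_uniq M : uniq (int_box M).
Proof.
rewrite map_inj_uniq ?enum_uniq // => f g /rowP fg; apply/ffunP => i.
by have := fg i; rewrite !mxE => /addIr [] /val_inj.
Qed.

Lemma mem_int_box M g : (forall i, (`|g ord0 i| <= M)%N) -> g \in int_box M.
Proof.
move=> gM; apply/mapP.
exists [ffun i => inord (absz (g ord0 i + M%:Z))]; first by rewrite mem_enum.
apply/rowP => i; rewrite mxE ffunE inordK; last by have := gM i; lia.
by have -> : g 0 i = g ord0 i by []; have := gM i; lia.
Qed.

Lemma round_rV_bound (M : nat) y : (forall i, `|y ord0 i| <= M%:R) ->
  forall i, (`|round_rV y ord0 i| <= M.+1)%N.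
Proof.
move=> yM i; rewrite mxE.
have := yM i; rewrite ler_norml => /andP[h1 h2].
set f := Num.floor _.
have f1 : f%:~R <= y ord0 i + 2^-1 :> R by exact: ge_floor.
have f2 : y ord0 i + 2^-1 < f%:~R + 1 :> R by rewrite -[1]/(1%:~R) -intrD lt_succ_floor.
have E : ((M.+1)%:Z)%:~R = M%:R + 1 :> R by rewrite -[LHS]/(M.+1%:R) -natr1.
have : - (M.+1)%:Z <= f.
  by rewrite -(ler_int R) intrN E; lra.
have : f <= (M.+1)%:Z.
  by rewrite -(ler_int R) E; lra.
by lia.
Qed.

Lemma sum_cubeI_sub (M : nat) y : (forall i, `|y ord0 i| <= M%:R) ->
  \sum_(g <- int_box M.+1) cubeI (y - iota g) = 1.
Proof.
move=> yM; have rM : round_rV y \in int_box M.+1.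
  by apply: mem_int_box; exact: round_rV_bound.
rewrite (bigD1_seq _ rM (int_box_uniq _)) /= cubeI_sub eqxx big1 ?addr0 // => g.
by rewrite cubeI_sub => /negbTE ->.
Qed.

Lemma sum_cubeI_add (M : nat) y : (forall i, `|y ord0 i| <= M%:R) ->
  \sum_(g <- int_box M.+1) cubeI (y + iota g) = 1.
Proof.
move=> yM; have rM : - round_rV y \in int_box M.+1.
  by apply: mem_int_box => i; rewrite mxE abszN; exact: round_rV_bound.
rewrite (bigD1_seq _ rM (int_box_uniq _)) /= cubeI_add eqxx big1 ?addr0 // => g.
by rewrite cubeI_add => /negbTE ->.
Qed.

Lemma cmeasurable_cubeI : cmeasurable cubeI.
Proof.
apply: cmeasurable_real; apply: measurable_indic.
rewrite (_ : cube = [set x : 'rV[R]_n | forall i,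
  (const_mx (- 2^-1) : 'rV[R]_n) ord0 i <= x ord0 i < (const_mx 2^-1 : 'rV[R]_n) ord0 i]).
  exact: measurable_rV_rect.
by apply/seteqP; split => x h i; have := h i; rewrite ?mxE.
Qed.

Lemma cabs_cubeI y : cabs (cubeI y) <= 1.
Proof. by rewrite cabs_real indicE; case: (_ \in _); rewrite ?normr1 ?normr0. Qed.

Lemma cubeI_neq0 y : cubeI y != 0 -> forall i, `|y ord0 i| <= 2^-1.
Proof.
rewrite /cubeI indicE; case: (boolP (y \in cube)) => [|_]; last by rewrite eqxx.
by rewrite inE => h _ i; have /andP[h1 /ltW h2] := h i; rewrite ler_norml h1.
Qed.

Lemma bcs_cubeI : bcs cubeI.
Proof.
split; [exact: cmeasurable_cubeI|by exists 1 => y; exact: cabs_cubeI|].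
by exists 2^-1 => y; exact: cubeI_neq0.
Qed.

(** The unfolding step of Poisson summation: cut the support along the tiling and translate every
    piece back to the central cube. *)
Lemma Cintegral_unfold (G : 'rV[R]_n -> C) (M : nat) : bcs G ->
  (forall y, G y != 0 -> forall i, `|y ord0 i| <= M%:R) ->
  Cintegral G = \sum_(g <- int_box M.+1) Cintegral (fun y => cubeI y * G (y + iota g)).
Proof.
move=> bG GM.
transitivity (Cintegral (fun y => \sum_(g <- int_box M.+1) cubeI (y - iota g) * G y)).
  congr Cintegral; apply/funext => y; rewrite -mulr_suml.
  have [->|Gy] := eqVneq (G y) 0; first by rewrite mulr0.
  by rewrite (sum_cubeI_sub (GM _ Gy)) mul1r.
have bg g : bcs (fun y => cubeI (y - iota g) * G y).
  apply: (bcsM (bcs_translate _ bcs_cubeI)); first by case: bG.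
  by case: bG.
rewrite Cintegral_sum; last by move=> g; exact/bcs_cintegrable.
apply: eq_bigr => g _.
rewrite -(Cintegral_translate (iota g)); last exact/bcs_cintegrable.
by congr Cintegral; apply/funext => y; rewrite addrK.
Qed.

(** A periodic function has the same integral over every period. Unfolding moves the pieces of the
    shifted cube into [cube], where their indicators add up to 1 because the shifted cube tiles as
    well. *)
Lemma Cintegral_cube_translate (F : 'rV[R]_n -> C) a : cmeasurable F ->
  (exists M, forall y, cabs (F y) <= M) -> (forall y g, F (y + iota g) = F y) ->
  Cintegral (fun y => cubeI (y - a) * F y) = Cintegral (fun y => cubeI y * F y).
Proof.
move=> mF bF pF.
have bG b : bcs (fun y => cubeI (y - b) * F y).
  exact: (bcsM (bcs_translate _ bcs_cubeI)).
(* The spare 1 covers the half-width of the cube, both in the support bound and in the final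
   tiling. *)
pose M := (Num.truncn (\sum_i `|a ord0 i| + 1)).+1.
have aM i : `|a ord0 i| + 1 <= M%:R.
  apply/ltW/(le_lt_trans _ (truncnS_gt _)).
  by rewrite lerD2r (bigD1 i) //= lerDl sumr_ge0.
rewrite (@Cintegral_unfold _ M) //; last first.
  move=> y; rewrite mulf_eq0 negb_or => /andP[/cubeI_neq0 h _] i.
  apply: le_trans (aM i); have := h i; rewrite !mxE => h'.
  rewrite -[y ord0 i](subrK (a ord0 i)) addrC (le_trans (ler_normD _ _)) // lerD2l.
  by apply: le_trans h' _; lra.
rewrite -Cintegral_sum; last first.
  move=> g; apply: bcs_cintegrable; apply: (bcsM bcs_cubeI).
    have := cmeasurable_comp (cmeasurableM (cmeasurable_comp cmeasurable_cubeI
      (measurable_rV_add (@measurable_id _ _ setT) (@measurable_cst _ _ _ _ setT (- a)))) mF)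
      (measurable_rV_add (@measurable_id _ _ setT) (@measurable_cst _ _ _ _ setT (iota g))).
    by [].
  have [K hK] := bF; exists K => y; rewrite cabsM (le_trans _ (hK (y + iota g))) //.
  by rewrite -[leRHS]mul1r ler_wpM2r ?cabs_ge0 // cabs_cubeI.
congr Cintegral; apply/funext => y.
under eq_bigr do rewrite pF mulrA.
rewrite -mulr_suml -mulr_sumr.
have [->|/cubeI_neq0 yc] := eqVneq (cubeI y) 0; first by rewrite !mul0r.
under eq_bigr do rewrite addrAC.
rewrite (@sum_cubeI_add M) ?mulr1 // => i; rewrite !mxE.
apply: le_trans (aM i); rewrite (le_trans (ler_normB _ _)) // addrC lerD2l.
by apply: le_trans (yc i) _; lra.
Qed.

Definition char g y : C := expi (dot (iota g) y).

Lemma cmeasurable_char g : cmeasurable (char g).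
Proof.
apply: cmeasurable_expi; apply: measurable_dot => //; exact: measurable_cst.
Qed.

Lemma cabs_char g y : cabs (char g y) = 1. Proof. exact: cabs_expi. Qed.

Lemma char_periodic g y h : char g (y + iota h) = char g y.
Proof. by rewrite /char dotDr expiD (expi_int (dot_int _ _)) mulr1. Qed.

Lemma charD g h y : char (g + h) y = char g y * char h y.
Proof. by rewrite /char iotaD dotDl expiD. Qed.

Lemma charN g y : char (- g) y = (char g y)^*.
Proof. by rewrite /char iotaN dotNl expiN. Qed.

Lemma char0 y : char 0 y = 1.
Proof. by rewrite /char /dot big1 ?expi0 // => i _; rewrite !mxE mul0r. Qed.

End cube.

Section cube_volume.
Context {R : realType}.

Lemma integral_cube n : (\int[leb R n]_y (\1_(@cube R n) y)%:E = 1)%E.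
Proof.
have mc k : measurable_fun setT (fun y : ('rV[R]_k) => (\1_(@cube R k) y : R)%:E).
  by have [h1 _] := @cmeasurable_cubeI R k; exact/measurable_EFinP.
elim: n => [|n IH].
  have c0 : (0 : 'rV[R]_0) \in @cube R 0 by rewrite inE => -[].
  by rewrite integral_dirac //; [rewrite indicE c0 mule1; exact: diracT|exact: mc].
rewrite (integral_leb_step (mc n.+1)) //.
pose I : set R := `[- 2^-1, 2^-1[%classic.
have E t v : (\1_(@cube R n.+1) (cons_rV (t, v)) = \1_I t * \1_(@cube R n) v :> R).
  rewrite !indicE -natrM mulnb; congr (_%:R); congr nat_of_bool.
  apply/idP/andP.
    rewrite inE => h; rewrite !inE; split.
      by rewrite /I /= in_itv /=; have := h ord0; rewrite cons_rV0.
    by move=> i; have := h (lift ord0 i); rewrite cons_rVS.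
  rewrite !inE /I /= in_itv /= => -[h1 h2] i.
  case: (unliftP ord0 i) => [j|] ->; first by rewrite cons_rVS; exact: h2.
  by rewrite cons_rV0.
have S t : (\int[leb R n]_v (\1_(@cube R n.+1) (cons_rV (t, v)))%:E = (\1_I t)%:E :> \bar R)%E.
  transitivity ((\1_I t)%:E * \int[leb R n]_v (\1_(@cube R n) v)%:E)%E; last by rewrite IH mule1.
  rewrite -(ge0_integralZl _ measurableT (mc n)) //.
  by apply: eq_integral => v _; rewrite E EFinM.
under eq_integral do rewrite S.
rewrite integral_indic //; last exact: measurable_itv.
transitivity (lebesgue_measure I); first by congr (lebesgue_measure _); exact: setIT.
rewrite /I lebesgue_measure_itv /= lte_fin ifT; last by lra.
by rewrite -EFinD; congr EFin; lra.
Qed.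

(** Orthogonality without evaluating an oscillating integral: for nonzero [g], a shift by half a
    wavelength along a coordinate where [g] does not vanish changes the sign of the character, while
    translation invariance keeps the integral, so it equals its own opposite. *)
Lemma Cintegral_cube_char n (g : 'rV[int]_n) :
  Cintegral (fun y : 'rV[R]_n => cubeI y * char g y) = (g == 0)%:R.
Proof.
have [->|g0] := eqVneq g 0.
  have -> : (fun y : 'rV[R]_n => cubeI y * char 0 y) = cubeI.
    by apply/funext => y; rewrite char0 mulr1.
  by apply: complexP; rewrite /= /Rintegral ?integral_cube ?integral0.
have [i gi] : exists i, g ord0 i != 0.
  apply/existsP; rewrite -negb_forall; apply: contra g0 => /forallP h.
  by apply/eqP/rowP => i; rewrite mxE; apply/eqP; exact: h.
pose a : 'rV[R]_n := (2 * (g ord0 i)%:~R)^-1 *: delta_mx 0 i.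
have ga : char g a = -1.
  rewrite /char /dot (bigD1 i) //= big1 ?addr0 => [|j ji]; last first.
    by rewrite !mxE (negbTE ji) andbF !mulr0.
  rewrite !mxE !eqxx mulr1 /expi.
  have gi' : (g ord0 i)%:~R != 0 :> R by rewrite intr_eq0.
  have -> : 2 * pi * ((g ord0 i)%:~R * (2 * (g ord0 i)%:~R)^-1) = pi :> R.
    by field.
  by rewrite cospi sinpi; apply: complexP; rewrite /= ?oppr0.
have cg := @cmeasurable_char R n g.
have bg : exists M, forall y : 'rV[R]_n, cabs (char g y) <= M.
  by exists 1 => y; rewrite cabs_char.
have := Cintegral_cube_translate a cg bg (fun y h => char_periodic g y h).
rewrite -(Cintegral_translate a); last first.
  by apply/bcs_cintegrable/(bcsM (bcs_translate _ bcs_cubeI)).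
under eq_fun => y.
  rewrite addrK (_ : char g (y + a) = char g a * char g y); last first.
    by rewrite /char dotDr expiD mulrC.
  rewrite mulrCA ga; over.
rewrite CintegralZ; last by apply/bcs_cintegrable/(bcsM bcs_cubeI).
set J := Cintegral _ => JJ.
have : 2%:R * J = 0 by rewrite mulr_natl mulr2n -{1}JJ mulN1r addNr.
by move/eqP; rewrite mulf_eq0 pnatr_eq0 /= => /eqP.
Qed.

End cube_volume.

(** * The Fejer kernel and its Fourier coefficients *)

Section fejer.
Context {R : realType} {n : nat}.
Local Notation C := R[i].
Local Notation iota := (@Defs.iota R n).
Implicit Types (y a : 'rV[R]_n) (g m : 'rV[int]_n).

Definition fvec N (f : {ffun 'I_n -> 'I_N}) : 'rV[int]_n := \row_i (f i)%:Z.

Lemma fvec_inj N : injective (@fvec N).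
Proof.
move=> f g /rowP fg; apply/ffunP => i.
by have := fg i; rewrite !mxE => -[] /val_inj.
Qed.

(** The product of the one-dimensional Fejer kernels. As a double sum it integrates termwise against
    [H] to values of the transform; as the squared modulus [fejerR] it is visibly nonnegative. *)
Definition fejer N y : C := ((N ^ n)%:R^-1 : R)%:C%C *
  \sum_(f : {ffun 'I_n -> 'I_N}) \sum_(g : {ffun 'I_n -> 'I_N})
    char (fvec f - fvec g) y.

Definition fejerR N y : R :=
  cabs (\sum_(f : {ffun 'I_n -> 'I_N}) char (fvec f) y) ^+ 2 / (N ^ n)%:R.

Lemma fejerE N y : fejer N y = (fejerR N y)%:C%C.
Proof.
rewrite /fejer /fejerR mulrC rmorphM /=; congr (_ * _).
rewrite -conj_mul_cabs mulrC mulr_suml; apply: eq_bigr => f _.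
rewrite rmorph_sum mulr_sumr; apply: eq_bigr => g _.
by rewrite charD charN.
Qed.

Lemma fejerR_ge0 N y : 0 <= fejerR N y.
Proof. by rewrite divr_ge0 // sqr_ge0. Qed.

Lemma cmeasurable_fejer N : cmeasurable (fejer N).
Proof.
apply: cmeasurableM; first exact: cmeasurable_cst.
by do 2 (apply: cmeasurable_sum => ?); exact: cmeasurable_char.
Qed.

Lemma fejer_bounded N : exists M, forall y, cabs (fejer N y) <= M.
Proof.
exists (cabs ((N ^ n)%:R^-1 : R)%:C%C * \sum_(f : {ffun 'I_n -> 'I_N}) \sum_(g : {ffun 'I_n -> 'I_N}) 1).
move=> y; rewrite cabsM ler_wpM2l ?cabs_ge0 //.
apply: le_trans (cabs_sum _ _ _) _; apply: ler_sum => f _.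
apply: le_trans (cabs_sum _ _ _) _; apply: ler_sum => g _.
by rewrite cabs_char.
Qed.

Lemma fejer_periodic N y g : fejer N (y + iota g) = fejer N y.
Proof.
by congr (_ * _); do 2 (apply: eq_bigr => ? _); rewrite char_periodic.
Qed.

(** For positive [N] this is the product of the factors [max (0, 1 - |m_i| / N)], left as a
    normalized count of pairs because it will be compared with other sums over pairs. *)
Definition fejer_coef N m : R := (N ^ n)%:R^-1 *
  \sum_(f : {ffun 'I_n -> 'I_N}) \sum_(g : {ffun 'I_n -> 'I_N})
    (m + (fvec f - fvec g) == 0)%:R.

Lemma Cintegral_fejer N (G : 'rV[R]_n -> C) : bcs G ->
  Cintegral (fun y => G y * fejer N y) = ((N ^ n)%:R^-1 : R)%:C%C *
  \sum_(f : {ffun 'I_n -> 'I_N}) \sum_(g : {ffun 'I_n -> 'I_N})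
    Cintegral (fun y => G y * char (fvec f - fvec g) y).
Proof.
move=> bG.
have bb g : bcs (fun y => G y * char g y).
  by apply: bcsM => //; [exact: cmeasurable_char|exists 1 => y; rewrite cabs_char].
under eq_fun do rewrite mulrCA mulr_sumr.
have ib (f : {ffun 'I_n -> 'I_N}) : cintegrable (fun y => G y *
    \sum_(g : {ffun 'I_n -> 'I_N}) char (fvec f - fvec g) y).
  by under eq_fun do rewrite mulr_sumr; apply: cintegrable_sum => g; exact/bcs_cintegrable.
rewrite CintegralZ; last exact: cintegrable_sum.
congr (_ * _); rewrite Cintegral_sum //; apply: eq_bigr => f _.
under eq_fun do rewrite mulr_sumr.
by rewrite Cintegral_sum // => g; exact/bcs_cintegrable.
Qed.

Lemma bcs_cube_char g : bcs (fun y => cubeI y * char g y).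
Proof.
apply: (bcsM bcs_cubeI (cmeasurable_char _)).
by exists 1 => y; rewrite cabs_char.
Qed.

Lemma Cintegral_cube_char_fejer N m :
  Cintegral (fun y => cubeI y * char m y * fejer N y) = (fejer_coef N m)%:C%C.
Proof.
rewrite (Cintegral_fejer _ (bcs_cube_char m)) rmorphM; congr (_ * _).
rewrite rmorph_sum; apply: eq_bigr => f _.
rewrite rmorph_sum; apply: eq_bigr => g _.
under eq_fun do rewrite -mulrA -charD.
by rewrite Cintegral_cube_char rmorph_nat.
Qed.

Lemma fejer_coef0 N : (0 < N)%N -> fejer_coef N 0 = 1.
Proof.
move=> N0; rewrite /fejer_coef.
under eq_bigr => f _.
  rewrite (bigD1 f) //= subrr addr0 eqxx big1 ?addr0; last first.
    move=> g gf; rewrite add0r subr_eq0.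
    by rewrite (inj_eq (@fvec_inj N)) eq_sym (negbTE gf).
  over.
rewrite sumr_const card_ffun !card_ord mulVf // pnatr_eq0 -lt0n.
by rewrite expn_gt0 N0.
Qed.

Lemma fejer_coefN N m : fejer_coef N (- m) = fejer_coef N m.
Proof.
rewrite /fejer_coef; congr (_ * _); rewrite exchange_big.
apply: eq_bigr => f _; apply: eq_bigr => g _.
by rewrite -oppr_eq0 opprD opprK opprB.
Qed.

(** Every [f] whose [i]-th entry is not maximal has a partner, obtained by adding 1 to that entry;
    such [f] form the proportion [1 - 1/(N+1)] of the box. *)
Lemma fejer_coef_delta N i : 1 - N.+1%:R^-1 <= fejer_coef N.+1 (delta_mx 0 i).
Proof.
(* The condition on [f i] is written as a product over all coordinates so that the sum over [f]
   factorizes. *)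
pose G (k : 'I_n) (j : 'I_N.+1) : R := if k == i then (j.+1 < N.+1)%:R else 1.
have N0 : N.+1%:R != 0 :> R by rewrite pnatr_eq0.
have cardE : (N.+1 ^ n)%:R^-1 * \sum_(f : {ffun 'I_n -> 'I_N.+1}) \prod_k G k (f k) =
    1 - N.+1%:R^-1.
  rewrite -bigA_distr_bigA (bigD1 i) //=.
  under eq_bigr do rewrite /G eqxx.
  have -> : \sum_(j < N.+1) (j.+1 < N.+1)%:R = N%:R :> R.
    rewrite big_ord_recr /= ltnn addr0.
    under eq_bigr => j _ do rewrite ltnS ltn_ord.
    by rewrite sumr_const card_ord.
  under [X in _ * (_ * X)]eq_bigr => k /negbTE ki.
    rewrite (eq_bigr (fun=> 1)); last by move=> j _; rewrite /G ki.
    rewrite sumr_const card_ord; over.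
  rewrite prodr_const cardC1 card_ord.
  have n0 : (0 < n)%N by exact: leq_ltn_trans (leq0n _) (ltn_ord i).
  rewrite -{1}(prednK n0) expnS natrM natrX.
  have X0 : N.+1%:R ^+ n.-1 != 0 :> R by rewrite expf_neq0.
  have -> : N%:R = N.+1%:R - 1 :> R by rewrite -natr1 addrK.
  by move: N0 X0; set a := N.+1%:R; set X := _ ^+ _ => a0 X0; field; apply/andP; split.
rewrite -cardE /fejer_coef ler_wpM2l ?invr_ge0 //.
apply: ler_sum => f _.
have fi : \prod_k G k (f k) = ((f i).+1 < N.+1)%:R.
  rewrite (bigD1 i) //= big1 ?mulr1 /G ?eqxx // => k /negbTE ki.
  by rewrite ki.
rewrite fi; have [lt|_] := ltnP (f i).+1 N.+1; last by apply: sumr_ge0 => g _; case: eqP.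
pose g : {ffun 'I_n -> 'I_N.+1} := [ffun k => if k == i then inord (f i).+1 else f k].
rewrite (bigD1 g) //= (_ : _ == 0); last first.
  apply/eqP/rowP => k; rewrite !mxE ffunE eqxx /=.
  by have [->|ki] := eqVneq k i; [rewrite inordK //; lia|rewrite add0r subrr].
by rewrite lerDl sumr_ge0 // => h _; case: eqP.
Qed.

(** The left side vanishes at 0 and is bounded below on the rest of the cube once [y ord0 i] stays
    away from 0, like a squared distance; the right side is a sum of characters, so its mean against
    the Fejer kernel is known. *)
Lemma one_sub_char_delta i y :
  (2 - 2 * cos (2 * pi * y ord0 i))%:C%C =
  2 - char (delta_mx 0 i) y - char (- delta_mx 0 i) y.
Proof.
have E : dot (iota (delta_mx 0 i)) y = y ord0 i.
  rewrite /dot (bigD1 i) //= big1 => [|j /negbTE ji].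
    by rewrite !mxE !eqxx mul1r addr0.
  by rewrite !mxE ji andbF mul0r.
rewrite charN /char E; apply: complexP.
  by rewrite !ReD !ReN /=; ring.
by rewrite !ImD !ImN /=; ring.
Qed.

End fejer.

Section fejer_approximation.
Context {R : realType} {n : nat}.
Local Notation C := R[i].
Local Notation iota := (@Defs.iota R n).

Lemma bcs_cubeM (P : 'rV[R]_n -> C) : cmeasurable P ->
  (exists M, forall y, cabs (P y) <= M) -> bcs (fun y => cubeI y * P y).
Proof. by move=> mP bP; exact: (bcsM bcs_cubeI). Qed.

Lemma cos_gap (delta t : R) : 0 < delta -> delta <= 2^-1 -> delta <= `|t| <= 2^-1 ->
  cos (2 * pi * t) <= cos (2 * pi * delta).
Proof.
move=> d0 d1 /andP[t1 t2]; have pi0 := pi_gt0 R.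
have -> : cos (2 * pi * t) = cos (2 * pi * `|t|).
  by case: (ger0P t) => // _; rewrite mulrN cosN.
have in01 u : 0 <= u -> u <= 2^-1 -> 2 * pi * u \in `[0, pi].
  move=> u0 u1; have h1 : 0 <= pi * u by rewrite mulr_ge0 ?pi_ge0.
  have h2 : 0 <= pi * (2^-1 - u) by rewrite mulr_ge0 ?subr_ge0 ?pi_ge0.
  by rewrite in_itv /=; apply/andP; split; lra.
have t0 : 0 <= `|t| by [].
have d0' := ltW d0.
rewrite leNgt ltr_cos ?in01 // -leNgt ler_pM2l // mulr_gt0 //.
Qed.

(** A Chebyshev argument: [|P y - P 0|] is at most [e / 4] near 0 and at most [K] times the sum of
    the [2 - 2 cos] elsewhere on the cube. The kernel has mass 1, and by [fejer_coef_delta] it gives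
    that sum a mean of order [1/N]. *)
Lemma fejer_approx (P : 'rV[R]_n -> C) : cmeasurable P ->
  (exists M, forall y, cabs (P y) <= M) ->
  (forall e : R, 0 < e -> exists2 delta : R, 0 < delta &
    forall y : 'rV[R]_n, (forall i, `|y ord0 i| < delta) -> cabs (P y - P 0) <= e) ->
  (fun N => cabs (Cintegral (fun y => cubeI y * P y * fejer N.+1 y) - P 0)) @ \oo --> (0 : R).
Proof.
move=> mP [M hM] cP; apply/cvgrPdist_le => e e0.
have e4 : 0 < e / 4 by rewrite divr_gt0.
have [delta0 d0 hdelta0] := cP _ e4.
(* The cap [1/4] keeps [2 pi delta] in the interval where the cosine decreases. *)
pose delta := Num.min delta0 4^-1.
have d1 : 0 < delta by rewrite lt_min d0 /= invr_gt0.
have d4 : delta <= 4^-1 by rewrite ge_min lexx orbT.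
have hdelta (y : 'rV[R]_n) : (forall i, `|y ord0 i| < delta) -> cabs (P y - P 0) <= e / 4.
  by move=> h; apply: hdelta0 => i; apply: lt_le_trans (h i) _; rewrite ge_min lexx.
pose c : R := 2 - 2 * cos (2 * pi * delta).
have c0 : 0 < c.
  have : cos (2 * pi * delta) < cos 0.
    have pi0 := pi_gt0 R.
    rewrite ltr_cos ?in_itv /= ?lexx ?pi_ge0 //; first by rewrite !mulr_gt0.
    have h1 : 0 <= pi * delta by rewrite mulr_ge0 ?pi_ge0 // ltW.
    have h2 : 0 <= pi * (4^-1 - delta) by rewrite mulr_ge0 ?subr_ge0 ?pi_ge0.
    by apply/andP; split; lra.
  by rewrite cos0 /c; lra.
have M0 : 0 <= M by rewrite (le_trans _ (hM 0)) ?cabs_ge0.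
(* [M + M] bounds [|P y - P 0|], and [c] bounds the cosine sum from below as soon as one coordinate
   is at least [delta] in absolute value. *)
pose K : R := (M + M) / c.
have K0 : 0 <= K by apply: divr_ge0; [exact: addr_ge0|exact: ltW].
pose s (y : 'rV[R]_n) : C := \sum_i (2 - char (delta_mx 0 i) y - char (- delta_mx 0 i) y).
have sE y : s y = (\sum_i (2 - 2 * cos (2 * pi * y ord0 i)))%:C%C.
  by rewrite rmorph_sum; apply: eq_bigr => i _; rewrite /= one_sub_char_delta.
have s_ge0 (y : 'rV[R]_n) i : 0 <= 2 - 2 * cos (2 * pi * y ord0 i).
  by have := cos_le1 (2 * pi * y ord0 i); lra.
pose g N (y : 'rV[R]_n) : C := cubeI y * ((e / 4)%:C%C + K%:C%C * s y) * fejer N.+1 y.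
have bound N y : cabs (cubeI y * (P y - P 0) * fejer N.+1 y) <= complex.Re (g N y).
  have -> : g N y = (\1_cube y * (e / 4 + K * (\sum_i (2 - 2 * cos (2 * pi * y ord0 i)))) * fejerR N.+1 y)%:C%C.
    by rewrite /g sE fejerE /cubeI -!(rmorphM, rmorphD).
  rewrite /= fejerE !cabsM !cabs_real (ger0_norm (fejerR_ge0 _ _)).
  rewrite ler_wpM2r ?fejerR_ge0 // indicE.
  have [yc|_] := boolP (y \in cube); last by rewrite normr0 !mul0r.
  rewrite normr1 !mul1r.
  have [/forallP near0|] := boolP [forall i, `|y ord0 i| < delta].
    apply: le_trans (hdelta _ near0) _; rewrite lerDl mulr_ge0 //.
    by apply: sumr_ge0 => i _.
  rewrite negb_forall => /existsP[k]; rewrite -leNgt => yi.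
  have yi2 : `|y ord0 k| <= 2^-1.
    by move: yc; rewrite inE => /(_ k) /andP[h1 /ltW h2]; rewrite ler_norml h1.
  apply: (@le_trans _ _ (M + M)).
    by apply: le_trans (cabsD _ _) _; rewrite cabsN lerD.
  apply: (@le_trans _ _ (K * c)); first by rewrite /K divfK ?gt_eqF.
  apply: ler_wpDl; first exact: ltW.
  rewrite ler_wpM2l // (bigD1 k) //= ler_wpDr ?sumr_ge0 //.
  rewrite /c lerD2l lerN2 ler_pM2l //.
  by apply: cos_gap => //; [apply: le_trans d4 _; lra|rewrite yi].
have bP : bcs (fun y => cubeI y * P y) by apply: bcs_cubeM => //; exists M.
have bc := @bcs_cubeI R n.
have bF N (G : 'rV[R]_n -> C) : bcs G -> bcs (fun y => G y * fejer N y).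
  by move=> bG; apply: (bcsM bG (cmeasurable_fejer _)); exact: fejer_bounded.
have mass N : Cintegral (fun y : 'rV[R]_n => cubeI y * fejer N.+1 y) = 1 :> C.
  have := Cintegral_cube_char_fejer N.+1 (0 : 'rV[int]_n) (R := R).
  rewrite fejer_coef0 // rmorph1 => h; rewrite -[RHS]h; congr Cintegral; apply/funext => y.
  by rewrite char0 mulr1.
have diffE N : Cintegral (fun y => cubeI y * P y * fejer N.+1 y) - P 0 =
    Cintegral (fun y => cubeI y * (P y - P 0) * fejer N.+1 y).
  have -> : (fun y => cubeI y * (P y - P 0) * fejer N.+1 y) =
      (fun y => cubeI y * P y * fejer N.+1 y + - P 0 * (cubeI y * fejer N.+1 y)).
    by apply/funext => y; ring.
  rewrite CintegralD; last 2 first.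
  - exact/bcs_cintegrable/bF.
  - exact/cintegrableZ/bcs_cintegrable/bF.
  by rewrite CintegralZ ?mass ?mulr1 //; exact/bcs_cintegrable/bF.
have ci N (m : 'rV[int]_n) : cintegrable (fun y : 'rV[R]_n => cubeI y * char m y * fejer N y).
  by apply: bcs_cintegrable; apply: bF; exact: bcs_cube_char.
have gE N : g N = fun y => (e / 4)%:C%C * (cubeI y * fejer N.+1 y) +
    K%:C%C * \sum_i (2 * (cubeI y * fejer N.+1 y) +
      (-1 * (cubeI y * char (delta_mx 0 i) y * fejer N.+1 y) +
       -1 * (cubeI y * char (- delta_mx 0 i) y * fejer N.+1 y))).
  apply/funext => y.
  have -> : g N y = (e / 4)%:C%C * (cubeI y * fejer N.+1 y) +
      K%:C%C * (s y * (cubeI y * fejer N.+1 y)) by rewrite /g; ring.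
  congr (_ + _ * _); rewrite /s mulr_suml; apply: eq_bigr => i _.
  by ring.
have icf N : cintegrable (fun y : 'rV[R]_n => cubeI y * fejer N y) by exact/bcs_cintegrable/bF.
have isum N i : cintegrable (fun y : 'rV[R]_n => 2 * (cubeI y * fejer N.+1 y) +
      (-1 * (cubeI y * char (delta_mx 0 i) y * fejer N.+1 y) +
       -1 * (cubeI y * char (- delta_mx 0 i) y * fejer N.+1 y))).
  by apply: cintegrableD; [exact: cintegrableZ|apply: cintegrableD; exact: cintegrableZ].
have ig N : cintegrable (g N).
  rewrite gE; apply: cintegrableD; first exact: cintegrableZ.
  by apply: cintegrableZ; apply: cintegrable_sum => i; exact: isum.
have Ig N : complex.Re (Cintegral (g N)) <= e / 4 + K * (n%:R * (2 * N.+1%:R^-1)).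
  rewrite gE CintegralD; last 2 first.
  - exact: cintegrableZ.
  - by apply: cintegrableZ; apply: cintegrable_sum => i; exact: isum.
  rewrite !CintegralZ //; last by apply: cintegrable_sum => i; exact: isum.
  rewrite mass Cintegral_sum; last by move=> i; exact: isum.
  have -> : \sum_(i < n) Cintegral (fun y : 'rV[R]_n => 2 * (cubeI y * fejer N.+1 y) +
      (-1 * (cubeI y * char (delta_mx 0 i) y * fejer N.+1 y) +
       -1 * (cubeI y * char (- delta_mx 0 i) y * fejer N.+1 y))) =
    (\sum_(i < n) (2 - 2 * fejer_coef N.+1 (delta_mx 0 i : 'rV[int]_n)) : R)%:C%C.
    rewrite rmorph_sum; apply: eq_bigr => i _ /=.
    rewrite CintegralD; last 2 first.
    - exact: cintegrableZ.
    - by apply: cintegrableD; exact: cintegrableZ.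
    rewrite CintegralD; last 2 first.
    - exact: cintegrableZ.
    - exact: cintegrableZ.
    rewrite !CintegralZ // mass !Cintegral_cube_char_fejer fejer_coefN.
    have E2 : (2 : R)%:C%C = 2 :> C by exact: rmorph_nat.
    by move: (fejer_coef _ _) => w; rewrite rmorphB rmorphM /= !E2; ring.
  rewrite mulr1 -rmorphM -rmorphD /= lerD2l ler_wpM2l //.
  apply: (@le_trans _ _ (\sum_(i < n) (2 * N.+1%:R^-1))); last first.
    by rewrite sumr_const card_ord [n%:R * _]mulr_natl.
  apply: ler_sum => i _; have := fejer_coef_delta N i (R := R).
  by move: (fejer_coef _ _) (N.+1%:R^-1) => w v; lra.
(* This makes [2 K n / (N+1)] at most [e / 4]; the total [e / 4 + e / 4] is then doubled by
   [cabs_Cintegral_le]. *)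
have [N0 hN0] : exists N0 : nat, 8 * K * n%:R / e <= N0%:R.
  by exists (Num.truncn (8 * K * n%:R / e)).+1; apply/ltW; exact: truncnS_gt.
exists N0 => // N /= N0N.
rewrite sub0r normrN ger0_norm ?cabs_ge0 // diffE.
apply: le_trans (cabs_Cintegral_le _ (ig N) (bound N)) _.
  apply/bcs_cintegrable/bF; apply: bcs_cubeM.
    by apply: cmeasurableB => //; exact: cmeasurable_cst.
  exists (M + M) => y; apply: le_trans (cabsD _ _) _; rewrite cabsN lerD //.
apply: (@le_trans _ _ (2 * (e / 4 + K * (n%:R * (2 * N.+1%:R^-1))))).
  by rewrite ler_pM2l.
have Npos : 0 < N.+1%:R :> R by [].
have hN : 8 * K * n%:R / e <= N.+1%:R.
  by apply: le_trans hN0 _; rewrite ler_nat (leq_trans N0N).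
have : 8 * K * n%:R * N.+1%:R^-1 <= e.
  by rewrite ler_pdivrMr // [leRHS]mulrC -ler_pdivrMr.
by move: (N.+1%:R^-1) => v; lra.
Qed.

End fejer_approximation.

Section small_char.
Context {R : realType}.

Lemma expi_near (e : R) : 0 < e -> exists2 d : R, 0 < d &
  forall t, `|t| < d -> cabs (expi t - 1) <= e.
Proof.
move=> e0.
(* On the unit circle the squared distance to 1 is [2 - 2 cos], so the cosine has to be within
   [e^2 / 2] of 1. *)
have e2 : 0 < e ^+ 2 / 2 by rewrite divr_gt0 // exprn_gt0.
have /cvgrPdist_lt /(_ _ e2) /nbhs_ballP[d /= d0 hd] := @continuous_cos R 0.
have pi0 := pi_gt0 R.
exists (d / (2 * pi)); first by rewrite divr_gt0 // mulr_gt0.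
move=> t; rewrite ltr_pdivlMr ?mulr_gt0 // => td.
have := hd (2 * pi * t); rewrite /ball /= sub0r normrN.
have -> : `|2 * pi * t| = `|t| * (2 * pi).
  by rewrite normrM mulrC [`|2 * pi|]gtr0_norm // mulr_gt0.
move=> /(_ td); rewrite cos0 => hc.
rewrite -(@ler_pXn2r _ 2) ?nnegrE ?cabs_ge0 ?(ltW e0) // cabs_sqr ReD ImD /=.
have := cos2Dsin2 (2 * pi * t); move: hc; rewrite ltr_norml => /andP[_].
rewrite oppr0 addr0; move: (cos _) (sin _) => u v h1 h2.
have -> : (u - 1) ^+ 2 + v ^+ 2 = 2 - 2 * u by transitivity (u ^+ 2 + v ^+ 2 + 1 - 2 * u); [ring|rewrite h2; ring].
by lra.
Qed.

Lemma dot_near n (x : 'rV[R]_n) (d : R) : 0 < d -> exists2 delta : R, 0 < delta &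
  forall y : 'rV[R]_n, (forall i, `|y ord0 i| < delta) -> `|dot x y| < d.
Proof.
move=> d0; pose K := \sum_i `|x ord0 i| + 1.
have K0 : 0 < K by rewrite ltr_wpDl // sumr_ge0.
exists (d / K); first by rewrite divr_gt0.
move=> y yd; apply: (@le_lt_trans _ _ ((K - 1) * (d / K))).
  rewrite addrK mulr_suml; apply: le_trans (ler_norm_sum _ _ _) _.
  by apply: ler_sum => i _; rewrite normrM ler_wpM2l // ltW.
by rewrite mulrCA gtr_pMr // ltr_pdivrMr // mul1r ltrBlDr ltrDl.
Qed.

Lemma char_near n (x : 'rV[R]_n) (e : R) : 0 < e -> exists2 delta : R, 0 < delta &
  forall y : 'rV[R]_n, (forall i, `|y ord0 i| < delta) ->
    cabs (expi (dot x y) - 1) <= e.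
Proof.
move=> /expi_near[d d0 hd]; have [delta delta0 h] := dot_near x d0.
by exists delta => // y /h/hd.
Qed.

End small_char.

(** * Poisson summation for a nonnegative transform *)

Section poisson.
Context {R : realType} {n : nat}.
Local Notation C := R[i].
Local Notation iota := (@Defs.iota R n).

Lemma cvg_cabs_ReIm (u : nat -> C) (l : C) :
  (fun N => cabs (u N - l)) @ \oo --> (0 : R) ->
  ((fun N => complex.Re (u N)) @ \oo --> complex.Re l) /\
  ((fun N => complex.Im (u N)) @ \oo --> complex.Im l).
Proof.
move=> /cvgrPdist_le h; split; apply/cvgrPdist_le => e e0;
  have := h _ e0; apply: filterS => N /=;
  rewrite sub0r normrN ger0_norm ?cabs_ge0 // distrC; apply: le_trans.
- by rewrite -ReN -ReD Re_le_cabs.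
- by rewrite -ImN -ImD Im_le_cabs.
Qed.

Variables (H : 'rV[R]_n -> C) (M : nat) (r : 'rV[int]_n -> R).
Hypothesis bH : bcs H.
Hypothesis HM : forall y, H y != 0 -> forall i, `|y ord0 i| <= M%:R.
Hypothesis cH : forall g e, 0 < e -> exists2 delta : R, 0 < delta &
  forall y : 'rV[R]_n, (forall i, `|y ord0 i| < delta) ->
    cabs (H (y + iota g) - H (iota g)) <= e.
Hypothesis Hr : forall g, Cintegral (fun y => H y * char g y) = (r g)%:C%C.
Hypothesis r0 : forall g, 0 <= r g.

Let S := \sum_(g <- int_box M.+1) H (iota g).
Let A N : R := (N.+1 ^ n)%:R^-1 *
  \sum_(f : {ffun 'I_n -> 'I_N.+1}) \sum_(g : {ffun 'I_n -> 'I_N.+1})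
    r (fvec f - fvec g).

Let P y := \sum_(g <- int_box M.+1) H (y + iota g).

(** The integral of [H] against the Fejer kernel is computed twice. Expanding the kernel into
    characters gives the average [A N] of values of [r]; folding onto the cube gives a Fejer mean of
    the periodization [P], which tends to [P 0 = S]. Since [A N] is real, so is the limit. *)
Let cvgA : ((fun N => A N) @ \oo --> complex.Re S) /\ complex.Im S = 0.
Proof.
have mP : cmeasurable P.
  by apply: cmeasurable_sum => g; have [] := bcs_translate (iota g) bH.
have bP : exists K, forall y, cabs (P y) <= K.
  have [_ [K hK] _] := bH; exists (\sum_(g <- @int_box n M.+1) K) => y.
  by apply: le_trans (cabs_sum _ _ _) _; apply: ler_sum.
have cP (e : R) : 0 < e -> exists2 delta : R, 0 < delta &
    forall y : 'rV[R]_n, (forall i, `|y ord0 i| < delta) -> cabs (P y - P 0) <= e.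
  move=> e0; rewrite /P.
  suff : forall e, 0 < e -> exists2 delta : R, 0 < delta & forall y : 'rV[R]_n,
      (forall i, `|y ord0 i| < delta) ->
      cabs (\sum_(g <- int_box M.+1) H (y + iota g) - \sum_(g <- int_box M.+1) H (0 + iota g)) <= e by apply.
  elim: (int_box M.+1) => [|g s IH] {e0}e e0.
    by exists 1 => // y _; rewrite !big_nil subr0 cabs0 ltW.
  have e2 : 0 < e / 2 by rewrite divr_gt0.
  have [d1 d10 h1] := IH _ e2; have [d2 d20 h2] := cH g e2.
  exists (Num.min d1 d2); first by rewrite lt_min d10.
  move=> y yd; rewrite !big_cons opprD addrACA.
  apply: le_trans (cabsD _ _) _; rewrite [leRHS](splitr e) lerD //.
    by rewrite add0r; apply: h2 => i; apply: lt_le_trans (yd i) _; rewrite ge_min lexx orbT.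
  by apply: h1 => i; apply: lt_le_trans (yd i) _; rewrite ge_min lexx.
have E N : Cintegral (fun y => cubeI y * P y * fejer N.+1 y) = (A N)%:C%C.
  have -> : (A N)%:C%C = Cintegral (fun y => H y * fejer N.+1 y).
    rewrite Cintegral_fejer // rmorphM rmorph_sum; congr (_ * _); apply: eq_bigr => f _.
    by rewrite rmorph_sum; apply: eq_bigr => g _; rewrite Hr.
  have bHF : bcs (fun y => H y * fejer N.+1 y).
    by apply: (bcsM bH (cmeasurable_fejer _)); exact: fejer_bounded.
  rewrite [RHS](@Cintegral_unfold _ _ _ M) //; last first.
    by move=> y; rewrite mulf_eq0 negb_or => /andP[Hy _]; exact: HM.
  rewrite -Cintegral_sum.
    congr Cintegral; apply/funext => y; rewrite /P mulr_sumr mulr_suml.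
    by apply: eq_bigr => g _; rewrite fejer_periodic mulrA.
  move=> g; apply: bcs_cintegrable.
  have [mHF [K hK] _] := bcs_translate (iota g) bHF.
  by apply: bcs_cubeM => //; exists K.
have := fejer_approx mP bP cP.
under eq_fun do rewrite E.
have P0 : P 0 = S by apply: eq_bigr => g _; rewrite add0r.
rewrite P0 => /cvg_cabs_ReIm /= [h1 h2]; split => //.
by apply: (cvg_unique _ h2 (cvg_cst _)).
Qed.

(** Keeping in [A N] only the pairs whose difference lies in [s] decreases it, as [r] is
    nonnegative, and leaves the sum over [s] weighted by Fejer coefficients, which tend to 1. *)
Let sum_fin_le (s : seq 'rV[int]_n) : uniq s -> \sum_(k <- s) r k <= complex.Re S.
Proof.
move=> us; have [cA _] := cvgA.
(* The limit of each coefficient is the approximation theorem applied to a character. *)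
have cw (k : 'rV[int]_n) : (fun N => fejer_coef N.+1 k : R) @ \oo --> (1 : R).
  have bc : exists K, forall y : 'rV[R]_n, cabs (char k y) <= K.
    by exists 1 => y; rewrite cabs_char.
  have cc (e : R) : 0 < e -> exists2 delta : R, 0 < delta &
    forall y : 'rV[R]_n, (forall i, `|y ord0 i| < delta) -> cabs (char k y - char k 0) <= e.
    move=> /(char_near (iota k))[delta d0 h]; exists delta => // y /h.
    by rewrite /char [dot _ 0]dotC dot0l expi0.
  have := fejer_approx (cmeasurable_char k) bc cc.
  under eq_fun do rewrite Cintegral_cube_char_fejer.
  rewrite /char dotC dot0l expi0.
  by move=> /cvg_cabs_ReIm[].
(* The sign matches the convention of [fejer_coef]: its argument at [-k] counts the pairs with
   difference [k]. *)
have cs : (fun N => \sum_(k <- s) r k * fejer_coef N.+1 (- k)) @ \oo --> \sum_(k <- s) r k.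
  elim: (s) => [|k t IH].
    by under eq_fun do rewrite big_nil; rewrite big_nil; exact: cvg_cst.
  under eq_fun do rewrite big_cons; rewrite big_cons; apply: cvgD; last exact: IH.
  suff : (fun N => r k * fejer_coef N.+1 (- k)) @ \oo --> r k * 1 by rewrite mulr1.
  by apply: cvgM; [exact: cvg_cst|exact: cw].
apply: (ler_cvg_to cs cA); near=> N.
rewrite /A /fejer_coef; under eq_bigr do rewrite mulrCA.
rewrite -mulr_sumr ler_wpM2l ?invr_ge0 //.
under eq_bigr do rewrite mulr_sumr.
rewrite exchange_big; apply: ler_sum => f _.
under eq_bigr do rewrite mulr_sumr.
rewrite exchange_big; apply: ler_sum => g _ /=.
have kE (k x : 'rV[int]_n) : (- k + x == 0) = (x == k) by rewrite addrC subr_eq0.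
have [ms|nms] := boolP (fvec f - fvec g \in s).
  rewrite (bigD1_seq _ ms us) /= addNr eqxx mulr1 big1 ?addr0 // => k kfg.
  by rewrite kE eq_sym (negbTE kfg) mulr0.
rewrite big_seq big1 // => k ks.
have : k != fvec f - fvec g by apply: contraNneq nms => <-.
by rewrite kE eq_sym => /negbTE ->; rewrite mulr0.
Unshelve. all: by end_near. Qed.

(** One inequality is [sum_fin_le]. For the other, fix [f]: the differences [fvec f - fvec g] are
    distinct, so the inner sum of [A N] is at most the full sum, and so is the average over [f]. *)
Lemma poisson : complex.Im S = 0 /\
  (\esum_(k in [set: 'rV[int]_n]) (r k)%:E = (complex.Re S)%:E)%E.
Proof.
have [cA ImS] := cvgA; split => //.
apply/eqP; rewrite eq_le; apply/andP; split.
  apply: ge_ereal_sup => _ [X [finX _] <-].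
  rewrite fsbig_finite //= sumEFin lee_fin.
  exact: sum_fin_le (finmap.fset_uniq _).
have [->|ne] := eqVneq (\esum_(k in [set: 'rV[int]_n]) (r k)%:E)%E +oo%E; first by rewrite leey.
have fin : (\esum_(k in [set: 'rV[int]_n]) (r k)%:E)%E \is a fin_num.
  by rewrite ge0_fin_numE ?ltey // esum_ge0 // => k _; rewrite lee_fin.
rewrite -(fineK fin) lee_fin.
apply: (ler_cvg_to cA (cvg_cst _)); near=> N.
rewrite /A mulrC ler_pdivrMr ?ltr0n ?expn_gt0 //.
apply: (@le_trans _ _ (\sum_(f : {ffun 'I_n -> 'I_N.+1})
    fine (\esum_(k in [set: 'rV[int]_n]) (r k)%:E)%E)); last first.
  by rewrite sumr_const card_ffun !card_ord mulr_natr.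
apply: ler_sum => f _.
rewrite -lee_fin (fineK fin).
pose e (g : {ffun 'I_n -> 'I_N.+1}) := fvec f - fvec g.
have einj : injective e by move=> g h /addrI /oppr_inj /(@fvec_inj n N.+1).
have ue : uniq [seq e g | g <- index_enum {ffun 'I_n -> 'I_N.+1}].
  by rewrite map_inj_uniq // index_enum_uniq.
apply: esum_ge; exists [set` [seq e g | g <- index_enum {ffun 'I_n -> 'I_N.+1}]].
  by split => //; exact: finite_seq.
by rewrite -fsbig_seq // big_map sumEFin.
Unshelve. all: by end_near. Qed.

End poisson.

(** * The bracket as an autocorrelation *)

Section autocorrelation.
Context {R : realType} {n : nat}.
Local Notation C := R[i].
Local Notation iota := (@Defs.iota R n).
Implicit Types f g : 'rV[R]_n -> C.

(** Poisson summation asks for continuity of the autocorrelation at lattice points, and this is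
    inherited from uniform continuity of [f]. *)
Definition ucs f := bcs f /\ forall e : R, 0 < e -> exists2 delta : R, 0 < delta &
  forall x y : 'rV[R]_n, (forall i, `|y ord0 i| < delta) -> cabs (f (x + y) - f x) <= e.

Lemma ucs_linear f (A : 'M[R]_n) : A \in unitmx -> ucs f -> ucs (fun x => f (x *m A)).
Proof.
move=> uA [bf uf]; split; first exact: bcs_linear.
move=> e /uf[d d0 hd].
have [delta delta0 h] : exists2 delta : R, 0 < delta & forall y : 'rV[R]_n,
    (forall i, `|y ord0 i| < delta) -> forall j, `|(y *m A) ord0 j| < d.
  pose K := \sum_j \sum_i `|A i j| + 1.
  have K0 : 0 < K by rewrite ltr_wpDl // !sumr_ge0 // => j _; rewrite sumr_ge0.
  exists (d / K); first by rewrite divr_gt0.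
  move=> y yd j; apply: (@le_lt_trans _ _ ((K - 1) * (d / K))); last first.
    by rewrite mulrCA gtr_pMr // ltr_pdivrMr // mul1r ltrBlDr ltrDl.
  rewrite mxE addrK [X in _ <= X * _](bigD1 j) //= mulrDl ler_wpDr //.
    rewrite mulr_ge0 // ?divr_ge0 ?(ltW d0) ?(ltW K0) // sumr_ge0 // => k _.
    by rewrite sumr_ge0.
  rewrite mulr_suml; apply: le_trans (ler_norm_sum _ _ _) _.
  by apply: ler_sum => i _; rewrite normrM mulrC ler_wpM2l // ltW.
exists delta => // x y /h hy; rewrite mulmxDl; exact: hd.
Qed.

Definition autocorr f (y : 'rV[R]_n) : C := Cintegral (fun x => (f (x - y))^* * f x).

Let integrand_bcs f y : bcs f -> bcs (fun x => (f (x - y))^* * f x).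
Proof.
move=> bf; apply: bcsM.
- by apply: bcs_conj; exact: bcs_translate.
- by case: bf.
- by case: bf.
Qed.

Lemma autocorr_supp f (M : R) : (forall x, f x != 0 -> forall i, `|x ord0 i| <= M) ->
  forall y, autocorr f y != 0 -> forall i, `|y ord0 i| <= M + M.
Proof.
move=> fM y hy i; rewrite leNgt; apply: contra hy => My.
rewrite /autocorr (_ : (fun x => _) = fun=> 0) ?Cintegral0 //.
apply/funext => x; have [->|fx] := eqVneq (f x) 0; first by rewrite mulr0.
have [->|fxy] := eqVneq (f (x - y)) 0; first by rewrite conjC0 mul0r.
have := fM _ fx i; have := fM _ fxy i; rewrite !mxE => h1 h2.
exfalso; move: My; apply/negP; rewrite -leNgt.
have -> : y ord0 i = x ord0 i - (x ord0 i - y ord0 i) by rewrite opprB addrC subrK.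
by apply: le_trans (ler_normB _ _) _; rewrite lerD.
Qed.

Lemma measurable_rV_sub d (T : measurableType d) (f g : T -> 'rV[R]_n) :
  measurable_fun setT f -> measurable_fun setT g ->
  measurable_fun setT (fun x => f x - g x).
Proof. by move=> mf mg; apply: measurable_rV_add => //; exact: measurable_rV_opp. Qed.

Lemma cmeasurable_autocorr f : bcs f -> cmeasurable (autocorr f).
Proof.
move=> [mf _ _].
suff mF : cmeasurable (fun p : 'rV[R]_n * 'rV[R]_n => (f (p.2 - p.1))^* * f p.2).
  exact: (cmeasurable_Cintegral (F := fun y x : 'rV[R]_n => (f (x - y))^* * f x) mF).
apply: cmeasurableM.
- apply: cmeasurable_conj; apply: (cmeasurable_comp mf).
  by apply: measurable_rV_sub; [exact: measurable_snd|exact: measurable_fst].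
- exact: (cmeasurable_comp mf measurable_snd).
Qed.

Lemma bcs_autocorr f : bcs f -> bcs (autocorr f).
Proof.
move=> bf; have [mf [M hM] [N hN]] := bf; split.
- exact: cmeasurable_autocorr.
- exists (2 * complex.Re (Cintegral (fun x => M%:C%C * (cabs (f x))%:C%C))) => y.
  apply: cabs_Cintegral_le.
  + exact/bcs_cintegrable/integrand_bcs.
  + exact/bcs_cintegrable/bcsZ/bcs_abs.
  + move=> x; rewrite -rmorphM /= cabsM cabs_conj ler_wpM2r ?cabs_ge0 //.
- by exists (N + N); exact: autocorr_supp.
Qed.

Lemma ucs_autocorr f : ucs f -> ucs (autocorr f).
Proof.
move=> [bf uf]; split; first exact: bcs_autocorr.
move=> e e0; pose K := complex.Re (Cintegral (fun x => (cabs (f x))%:C%C)).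
have K0 : 0 <= K by apply: Rintegral_ge0 => x _; exact: cabs_ge0.
have K1 : 0 < 2 * (K + 1) by lra.
(* The 2 compensates the factor in [cabs_Cintegral_le], and the added 1 avoids division by 0 when
   [f] vanishes. *)
have [d d0 hd] := uf (e / (2 * (K + 1))) (divr_gt0 e0 K1).
exists d => // x y yd; rewrite /autocorr.
have -> : Cintegral (fun x0 => (f (x0 - (x + y)))^* * f x0) - Cintegral (fun x0 => (f (x0 - x))^* * f x0)
   = Cintegral (fun z => (f (z - (x + y)))^* * f z + -1 * ((f (z - x))^* * f z)).
  rewrite CintegralD.
  - by rewrite CintegralZ ?mulN1r //; exact/bcs_cintegrable/integrand_bcs.
  - exact/bcs_cintegrable/integrand_bcs.
  - exact/cintegrableZ/bcs_cintegrable/integrand_bcs.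
apply: (@le_trans _ _ (2 * complex.Re (Cintegral (fun z => (e / (2 * (K + 1)))%:C%C * (cabs (f z))%:C%C)))).
  apply: cabs_Cintegral_le.
  - apply: cintegrableD; first exact/bcs_cintegrable/integrand_bcs.
    exact/cintegrableZ/bcs_cintegrable/integrand_bcs.
  - exact/bcs_cintegrable/bcsZ/bcs_abs.
  - move=> z; rewrite -rmorphM /= mulN1r -mulNr -mulrDl cabsM ler_wpM2r ?cabs_ge0 //.
    rewrite -rmorphB /= cabs_conj -[f (z - x)](_ : f (z - (x + y) + y) = _); last first.
      by congr f; rewrite opprD addrA subrK.
    by rewrite -cabsN opprB; exact: hd.
rewrite CintegralZ; last exact/bcs_cintegrable/bcs_abs.
rewrite ReM /= mul0r subr0 -/K.
have K10 : K + 1 != 0 by rewrite gt_eqF // ltr_wpDl.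
have -> : 2 * (e / (2 * (K + 1)) * K) = e * (K / (K + 1)) by field.
rewrite ler_piMr ?(ltW e0) // ler_pdivrMr ?mul1r ?lerDl //.
by rewrite ltr_wpDl.
Qed.

(** The character splits as [dot y xi = dot x xi - dot (x - y) xi], so it is absorbed into [w] and
    the integrand becomes that of the autocorrelation of [w]. Fubini then separates the two
    factors. *)
Lemma fourier_autocorr f xi : bcs f ->
  Cintegral (fun y => autocorr f y * expi (dot y xi)) = (fourierR f xi)^* * fourierR f xi.
Proof.
move=> bf; have [mf [M hM] [N hN]] := bf.
pose w x := f x * expi (dot x xi).
have mE : cmeasurable (fun y : 'rV[R]_n => expi (dot y xi)).
  by apply: cmeasurable_expi; apply: measurable_dot => //; exact: measurable_cst.
have bE : exists M : R, forall y : 'rV[R]_n, cabs (expi (dot y xi)) <= M.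
  by exists 1 => y; rewrite cabs_expi.
have bw : bcs w by exact: bcsM.
pose F (y x : 'rV[R]_n) := (w (x - y))^* * w x.
have FE y x : (f (x - y))^* * f x * expi (dot y xi) = F y x.
  rewrite /F /w rmorphM /= -expiN -dotNl.
  have -> : expi (dot y xi) = expi (dot (- (x - y)) xi) * expi (dot x xi).
    by rewrite -expiD -dotDl opprB subrK.
  ring.
have mF : cmeasurable (fun p : 'rV[R]_n * 'rV[R]_n => F p.1 p.2).
  have [mw _ _] := bw; apply: cmeasurableM.
  - apply: cmeasurable_conj; apply: (cmeasurable_comp mw).
    by apply: measurable_rV_sub; [exact: measurable_snd|exact: measurable_fst].
  - exact: (cmeasurable_comp mw measurable_snd).
transitivity (Cintegral (fun y => Cintegral (F y))).
  congr Cintegral; apply/funext => y; rewrite mulrC -CintegralZ; last first.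
    exact/bcs_cintegrable/integrand_bcs.
  by congr Cintegral; apply/funext => x; rewrite mulrC FE.
have [mw [Mw hMw] [Nw hNw]] := bw.
(* The dominating factor in [y]: if [w] is nonzero at both [x] and [x - y], then the coordinates of
   [y] are at most [Nw + Nw] in absolute value. *)
pose B (y : 'rV[R]_n) : C := (Mw * \1_[set z : 'rV[R]_n | forall i, `|z ord0 i| <= Nw + Nw] y)%:C%C.
have bB : bcs B.
  split.
  - apply: cmeasurable_real; apply: measurable_funM => //; apply: measurable_indic.
    rewrite (_ : [set _ | _] = \bigcap_(i in [set: 'I_n])
      ((fun x : 'rV[R]_n => x ord0 i) @^-1` `[- (Nw + Nw), Nw + Nw])).
      apply: fin_bigcap_measurable => // i _.
      by rewrite -[X in measurable X]setTI; exact: measurable_coord.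
    apply/seteqP; split => x /= h i; first by rewrite /= in_itv /= -ler_norml.
    by have := h i I; rewrite /= in_itv /= -ler_norml.
  - exists `|Mw| => y; rewrite cabs_real normrM indicE.
    by case: (_ \in _); rewrite ?normr1 ?normr0 ?mulr1 ?mulr0.
  - exists (Nw + Nw) => y; rewrite /B indicE; case: (boolP (y \in _)) => [|_].
      by rewrite inE.
    by rewrite mulr0 eqxx.
rewrite (Cintegral_Fubini mF bB bw); last first.
  move=> y x; rewrite /F cabsM cabs_conj.
  have [->|wx] := eqVneq (w x) 0; first by rewrite cabs0 !mulr0.
  rewrite ler_wpM2r ?cabs_ge0 //.
  have [->|wxy] := eqVneq (w (x - y)) 0; first by rewrite cabs0 cabs_ge0.
  rewrite /B cabs_real indicE mem_set; first by rewrite mulr1 (le_trans (hMw _)) ?ler_norm.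
  move=> i; have := hNw _ wx i; have := hNw _ wxy i; rewrite !mxE => h1 h2.
  have -> : y ord0 i = x ord0 i - (x ord0 i - y ord0 i) by rewrite opprB addrC subrK.
  by apply: le_trans (ler_normB _ _) _; rewrite lerD.
have iw := bcs_cintegrable bw.
have inner x : Cintegral (F ^~ x) = (fourierR f xi)^* * w x.
  rewrite /F; under eq_fun do rewrite mulrC.
  rewrite CintegralZ.
    rewrite mulrC; congr (_ * _).
    have iwc : cintegrable (fun z => (w z)^*) by exact/bcs_cintegrable/bcs_conj.
    rewrite (_ : (fun y => _) = (fun y => (fun z => (w (z + x))^*) (- y))); last first.
      by apply/funext => y /=; rewrite addrC.
    rewrite (@Cintegral_opp _ _ (fun z => (w (z + x))^*)).
      by rewrite (@Cintegral_translate _ _ (fun z => (w z)^*)) // Cintegral_conj.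
    exact/bcs_cintegrable/(bcs_translate _ (bcs_conj bw)).
  apply: bcs_cintegrable; have bwx := bcs_translate x (bcs_conj bw).
  have uN : (- 1%:M : 'M[R]_n) \in unitmx.
    by rewrite -scaleN1r unitmxZ ?unitmx1 // unitrN unitr1.
  have := bcs_linear uN bwx; congr bcs; apply/funext => y.
  by rewrite mulmxN mulmx1 addrC.
under eq_fun do rewrite inner.
by rewrite CintegralZ.
Qed.

End autocorrelation.

(** * Boundedness and uniform continuity on C_c *)

Section Cc_functions.
Context {R : realType} {n : nat}.
Local Notation C := R[i].

Lemma coord_le_norm (x : 'rV[R]_n) i : `|x ord0 i| <= `|x|.
Proof.
rewrite [leRHS]mx_normrE.
exact: (le_bigmax _ (fun ij : 'I_1 * 'I_n => `|x ij.1 ij.2|) (ord0, i)).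
Qed.

Lemma rV_ballP (x y : 'rV[R]_n) (e : R) : 0 < e ->
  ball x e y <-> forall i, `|x ord0 i - y ord0 i| < e.
Proof.
move=> e0; split; first by move=> [_ h] i; exact: (h ord0 i).
by move=> h; split => // i j; rewrite (ord1 i); exact: h.
Qed.

Lemma Cc_continuous (f : Cc R n) : continuous (f : 'rV[R]_n -> C^o).
Proof. by case: f => f /= /asboolP[]. Qed.

Lemma Cc_compact (f : Cc R n) : compact (closure [set x | f x != 0]).
Proof. by case: f => f /= /asboolP[]. Qed.

Lemma Cc_near (f : Cc R n) (x : 'rV[R]_n) (e : R) : 0 < e ->
  exists2 d : R, 0 < d & forall y : 'rV[R]_n, (forall i, `|x ord0 i - y ord0 i| < d) ->
    cabs (f x - f y) < e.
Proof.
move=> e0.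
have h0 : (fun y => cabs (f x - f y)) @ x --> (0 : R).
  exact: (@cvg_complexE R _ (nbhs x) _ f (f x) (@Cc_continuous f x)).
have /nbhs_ballP[d /= d0 hd] : nbhs x [set y | `|0 - cabs (f x - f y)| < e].
  exact: (@cvgrPdist_lt _ _ _ _ _ _ _).1 h0 e e0.
exists d => // y /(rV_ballP _ _ d0)/hd /=.
by rewrite sub0r normrN ger0_norm ?cabs_ge0.
Qed.

Lemma Cc_bounded_support (f : Cc R n) :
  exists M : R, forall x, f x != 0 -> forall i, `|x ord0 i| <= M.
Proof.
have [M [Mr hM]] := compact_bounded (@Cc_compact f).
exists (M + 1) => x fx i; apply: le_trans (coord_le_norm _ _) _.
by apply: hM; [rewrite ltrDl|apply: subset_closure].
Qed.

Lemma Cc_unif_continuous (f : Cc R n) (e : R) : 0 < e ->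
  exists2 delta : R, 0 < delta & forall x y : 'rV[R]_n,
    (forall i, `|y ord0 i| < delta) -> cabs (f (x + y) - f x) <= e.
Proof.
move=> e0; have /compact_near_coveringP cK := @Cc_compact f.
have e2 : 0 < e / 2 by rewrite divr_gt0.
have := cK R (at_right (0 : R)) (fun d x => forall y : 'rV[R]_n,
  (forall i, `|y ord0 i| < d) -> cabs (f (x + y) - f x) <= e) _.
case.
  move=> x _; have [d d0 hd] := Cc_near f x e2.
  have d2 : 0 < d / 2 by rewrite divr_gt0.
  exists (ball x (d / 2), [set t : R | 0 < t < d / 2]) => /=.
    split; first exact: nbhsx_ballx.
    near=> t; apply/andP; split; near: t; [exact: nbhs_right_gt|exact: nbhs_right_lt].
  move=> [x' t] /= [/(rV_ballP _ _ d2) xx' /andP[t0 td]] y yt.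
  rewrite -[f (x' + y) - _](subrKA (f x)) addrC.
  have h1 : cabs (f x - f x') < e / 2.
    by apply: hd => i; apply: lt_le_trans (xx' i) _; lra.
  have h2 : cabs (f x - f (x' + y)) < e / 2.
    apply: hd => i; rewrite mxE opprD addrA; apply: le_lt_trans (ler_normB _ _) _.
    by rewrite [ltRHS]splitr ltrD // (lt_trans (yt i)).
  apply: le_trans (cabsD _ _) _; rewrite [leRHS]splitr lerD ?(ltW h1) //.
  by rewrite -cabsN opprB ltW.
move=> d /= d0 hd.
have d2 : 0 < d / 2 by rewrite divr_gt0.
have K x : closure [set x | f x != 0] x -> forall y : 'rV[R]_n,
    (forall i, `|y ord0 i| < d / 2) -> cabs (f (x + y) - f x) <= e.
  apply: (hd (d / 2)) => //=.
  by rewrite sub0r normrN gtr0_norm // ltr_pdivrMr //; lra.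
exists (d / 2) => // x y yd.
(* Compactness covers base points in the support only. If [f x = 0] and [f (x + y)] is not 0, the
   roles are exchanged: [x + y] becomes the base point and [- y] the increment. *)
have [fx|fx] := eqVneq (f x) 0; last by apply: K => //; exact: subset_closure.
have [fxy|fxy] := eqVneq (f (x + y)) 0.
  by rewrite fx fxy subr0 cabs0 ltW.
have cxy : closure [set x | f x != 0] (x + y) by exact: subset_closure.
have := K (x + y) cxy (- y).
rewrite addrK -cabsN opprB; apply => i.
by rewrite mxE normrN.
Unshelve. all: by end_near. Qed.

Lemma Cc_bounded (f : Cc R n) : exists M, forall x, cabs (f x) <= M.
Proof.
have cK := @Cc_compact f.
have cf : continuous (fun x => cabs (f x) : R^o).
  move=> x; apply/(@cvgrPdist_lt _ _ _ (nbhs x)) => e e0.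
  have [d d0 hd] := Cc_near f x e0.
  apply/nbhs_ballP; exists d => // y /(rV_ballP _ _ d0)/hd /=.
  apply: le_lt_trans; rewrite ler_norml lerBrDr lerBlDr addrC.
  have := cabsD (f y - f x) (f x); have := cabsD (f x - f y) (f y).
  rewrite !subrK -[f y - f x]opprB cabsN.
  by move=> h1 h2; apply/andP; split; lra.
have := continuous_compact (continuous_subspaceT cf) cK.
move=> /compact_bounded[M [_ hM]]; exists (`|M| + 1) => x.
have [->|fx] := eqVneq (f x) 0; first by rewrite cabs0 addr_ge0.
rewrite -[leLHS]ger0_norm ?cabs_ge0 //; apply: hM.
  by rewrite (le_lt_trans (ler_norm _)) // ltrDl.
by exists x => //; exact: subset_closure.
Qed.

Lemma Cc_ucs (f : Cc R n) : ucs f.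
Proof.
split; last by move=> e; exact: Cc_unif_continuous.
split; [|exact: Cc_bounded|exact: Cc_bounded_support].
exact: continuous_cmeasurable (@Cc_continuous f).
Qed.

End Cc_functions.

(** * Nonsingularity of the matrix of an embedding *)

Section A_theta.
Context {R : realType} {d : nat}.
Variable theta : {additive 'rV[int]_d -> 'rV[R]_d}.
Hypothesis htheta : is_embedding theta.

Let A : 'M[R]_d := \matrix_(i, j) theta (delta_mx 0 j) ord0 i.

Let thetaE g : theta g = Defs.iota R g *m A^T.
Proof.
rewrite {1}(matrix_sum_delta g) big_ord1 raddf_sum /=.
apply/rowP => i; rewrite summxE mxE; apply: eq_bigr => j _.
have -> : g ord0 j *: delta_mx ord0 j = delta_mx 0 j *~ g ord0 j :> 'rV[int]_d.
  by rewrite -scaler_int intz.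
by rewrite raddfMz !mxE -[theta _ *~ _]scaler_int mxE.
Qed.

(** A singleton is open in the discrete group, so its image is relatively open in the range of
    [theta]: some ball around 0 contains no other point of the range. *)
Let theta_discrete : exists2 e : R, 0 < e &
  forall g, (forall i, `|theta g ord0 i| < e) -> g = 0.
Proof.
have [injt _ opent] := htheta.
have [B oB BE] := opent [set 0] (discrete_open _).
have B0 : B (theta 0).
  have : [set theta x | x in [set 0]] (theta 0) by exists 0.
  by rewrite BE => -[].
have /nbhs_ballP[e /= e0 he] : nbhs (theta 0) B by exact: open_nbhs_nbhs.
exists e => // g ge; have : (range theta `&` B) (theta g).
  split; first by exists g.
  by apply: he; apply/(rV_ballP _ _ e0) => i; rewrite raddf0 mxE sub0r normrN.
by rewrite -BE => -[h -> /injt].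
Qed.

(* Otherwise rounding the multiples of a kernel vector of [A] gives infinitely
   many lattice points with images in a bounded set, and two of these images are
   closer than discreteness allows. *)
Let A_unit : A \in unitmx.
Proof.
have [e e0 he] := theta_discrete.
rewrite unitmxE unitfE -det_tr; apply/det0P => -[v v0 vA].
have [i vi] : exists i, v ord0 i != 0.
  apply/existsP; rewrite -negb_forall; apply: contra v0 => /forallP h.
  by apply/eqP/rowP => i; rewrite mxE; apply/eqP; exact: h.
(* After this normalization the [i]-th entry of the rounded multiple [g k] is exactly [k], so the
   [g k] are distinct. *)
pose w : 'rV[R]_d := (v ord0 i)^-1 *: v.
have wi : w ord0 i = 1 by rewrite mxE mulVf.
have wA : w *m A^T = 0 by rewrite -scalemxAl vA scaler0.
pose g (k : nat) : 'rV[int]_d := \row_j Num.floor (k%:R * w ord0 j).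
have gi k : g k ord0 i = k%:Z by rewrite mxE wi mulr1; exact: (intrKfloor k%:Z).
pose L := \sum_l \sum_j `|A^T j l|.
have gbound k l : `|theta (g k) ord0 l| <= L.
  have -> : theta (g k) = (Defs.iota R (g k) - k%:R *: w) *m A^T.
    by rewrite mulmxBl -scalemxAl wA scaler0 subr0 thetaE.
  rewrite mxE /L [leRHS](bigD1 l) //= ler_wpDr //.
    by apply: sumr_ge0 => ? _; apply: sumr_ge0.
  apply: le_trans (ler_norm_sum _ _ _) _; apply: ler_sum => j _.
  rewrite normrM ler_piMl // !mxE distrC.
  have := ge_floor (k%:R * w ord0 j); have := lt_succ_floor (k%:R * w ord0 j).
  rewrite intrD mulr1z ler_norml => h1 h2; rewrite !mxE in h1 h2.
  by apply/andP; split; lra.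
(* The grid cell of side [e] containing the image of [g k]. Finitely many cells meet the bounded
   set, so two indices share one, and their images then differ by less than [e] in every
   coordinate. *)
pose c (k : nat) : 'rV[int]_d := \row_l Num.floor (theta (g k) ord0 l / e).
pose M := (Num.truncn (L / e)).+2.
have cM k : c k \in @int_box d M.
  apply: mem_int_box => l; rewrite mxE.
  have h : `|theta (g k) ord0 l / e| <= L / e.
    by rewrite normrM [`|e^-1|]gtr0_norm ?invr_gt0 // ler_pM2r ?invr_gt0.
  have hM : L / e + 1 < M%:R.
    by rewrite -[M]addn1 natrD ltrD2r; exact: truncnS_gt.
  move: h; rewrite ler_norml => /andP[h1 h2].
  have f1 := ge_floor (theta (g k) ord0 l / e).
  have f2 := lt_succ_floor (theta (g k) ord0 l / e).
  rewrite intrD mulr1z in f2; move: f1 f2; set f := Num.floor _ => f1 f2.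
  have : (- M%:Z) <= f by rewrite -(ler_int R) intrN -[M%:Z%:~R]/(M%:R); lra.
  have : f <= M%:Z by rewrite -(ler_int R) -[M%:Z%:~R]/(M%:R); lra.
  by lia.
have [k [l [kl ckl]]] : exists k l, k <> l /\ c k = c l.
  apply: contrapT => h.
  have inj : injective c.
    move=> k l ckl; apply: contrapT => kl; apply: h; by exists k, l.
  pose N := size (@int_box d M).
  have := @uniq_leq_size _ (map c (seq.iota 0 N.+1)) (@int_box d M).
  rewrite map_inj_uniq // iota_uniq size_map size_iota ltnn => /(_ isT) sub.
  by suff : false by []; apply: sub => _ /mapP[k _ ->].
suff /eqP : g k - g l = 0.
  rewrite subr_eq0 => /eqP/rowP /(_ i); rewrite !gi => -[]; exact: kl.
apply: he => j; rewrite raddfB !mxE.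
have := congr1 (fun z : 'rV[int]_d => z ord0 j) ckl; rewrite !mxE => cE.
have a1 := ge_floor (theta (g k) ord0 j / e).
have a2 := lt_succ_floor (theta (g k) ord0 j / e).
have b1 := ge_floor (theta (g l) ord0 j / e).
have b2 := lt_succ_floor (theta (g l) ord0 j / e).
rewrite cE in a1 a2; rewrite !intrD !mulr1z in a2 b2.
rewrite -[ltRHS]mul1r -ltr_pdivrMr // -[X in _ / X]gtr0_norm // -normf_div mulrBl.
by rewrite ltr_norml; apply/andP; split; lra.
Qed.

Lemma A_theta_unit : A_theta theta \in unitmx.
Proof.
(* The matrix [A] inhabits the defining set, which rules out the default value of [xget]. *)
rewrite /A_theta; case: xgetP => [B _ []//|/(_ A)[]].
by split; [exact: A_unit|exact: thetaE].
Qed.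

Lemma A_thetaE g : theta g = Defs.iota R g *m (A_theta theta)^T.
Proof.
rewrite /A_theta; case: xgetP => [B _ [_ ->]//|/(_ A)[]].
by split; [exact: A_unit|exact: thetaE].
Qed.

End A_theta.

(** * Unordered sums with finite support or nonnegative terms *)

Section Csum.
Context {R : realType} {T : choiceType}.
Local Notation C := R[i].

Lemma esum_finite_support (s : seq T) (b : T -> R) : uniq s ->
  (forall i, 0 <= b i) -> (forall i, i \notin s -> b i = 0) ->
  (\esum_(i in [set: T]) (b i)%:E = (\sum_(i <- s) b i)%:E)%E.
Proof.
move=> us b0 bs.
have fs : finite_set [set` s] by exact: finite_seq.
rewrite -sumEFin fsbig_seq // -esum_fset // => [|i _]; last by rewrite lee_fin.
rewrite [RHS]esum_mkcond; apply: eq_esum => i _.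
by case: ifPn => //; rewrite notin_setE /= => /negP/bs ->.
Qed.

Lemma Rsum_finite_support (s : seq T) (a : T -> R) : uniq s ->
  (forall i, i \notin s -> a i = 0) -> Rsum setT a = \sum_(i <- s) a i.
Proof.
move=> us as0; rewrite /Rsum.
have pE i : (EFin \o a)^\+%E i = (Num.max (a i) 0)%:E.
  by rewrite funeposE /= EFin_max.
have nE i : (EFin \o a)^\-%E i = (Num.max (- a i) 0)%:E.
  by rewrite funenegE /= EFin_max.
under eq_esum do rewrite pE.
under [X in (_ - X)%E]eq_esum do rewrite nE.
rewrite (esum_finite_support us); last 2 first.
- by move=> i; rewrite le_max lexx orbT.
- by move=> i /as0 ->; rewrite maxxx.
rewrite (esum_finite_support us); last 2 first.
- by move=> i; rewrite le_max lexx orbT.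
- by move=> i /as0 ->; rewrite oppr0 maxxx.
rewrite -EFinB /= -sumrB; apply: eq_bigr => i _.
have [a0|a0] := leP 0 (a i).
- by rewrite max_r ?oppr_le0 // subr0.
- by rewrite max_l ?oppr_ge0 ?(ltW a0) // sub0r opprK.
Qed.

Lemma Csum_finite_support (s : seq T) (a : T -> C) : uniq s ->
  (forall i, i \notin s -> a i = 0) -> Csum setT a = \sum_(i <- s) a i.
Proof.
move=> us as0; apply: complexP; rewrite ?Re_sum ?Im_sum /=.
- by rewrite (Rsum_finite_support us) // => i /as0 ->.
- by rewrite (Rsum_finite_support us) // => i /as0 ->.
Qed.

Lemma Csummable_finite_support (s : seq T) (a : T -> C) : uniq s ->
  (forall i, i \notin s -> a i = 0) -> Csummable setT a.
Proof.
move=> us as0; rewrite /Csummable /summable.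
under eq_esum do rewrite gee0_abs ?lee_fin ?cabs_ge0 //.
rewrite (esum_finite_support us) ?ltry //.
- by move=> i; exact: cabs_ge0.
- by move=> i /as0 ->; exact: cabs0.
Qed.

Lemma Csum_ge0 (D : set T) (b : T -> R) : (forall i, 0 <= b i) ->
  Csum D (fun i => (b i)%:C%C) = (fine (\esum_(i in D) (b i)%:E)%E)%:C%C.
Proof.
move=> b0; rewrite /Csum /=; congr Complex; rewrite /Rsum.
- rewrite [X in (_ - X)%E]esum1 ?sube0; last first.
    by move=> i _; rewrite funenegE /= -EFin_max max_r // oppr_le0.
  congr fine; apply: eq_esum => i _.
  by rewrite funeposE /= -EFin_max max_l.
- rewrite !esum1 ?subee //.
  + by move=> i _; rewrite funenegE /= oppr0 maxxx.
  + by move=> i _; rewrite funeposE /= maxxx.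
Qed.

Lemma Csummable_ge0 (D : set T) (b : T -> R) : (forall i, 0 <= b i) ->
  (\esum_(i in D) (b i)%:E < +oo)%E -> Csummable D (fun i => (b i)%:C%C : C).
Proof.
move=> b0 h; rewrite /Csummable /summable; apply: le_lt_trans h.
by apply: le_esum => i _; rewrite gee0_abs ?lee_fin ?cabs_ge0 // cabs_real ger0_norm.
Qed.

End Csum.

Lemma cabs_mulB_le {R : realType} (a b u v : R[i]) : cabs u = 1 -> cabs v = 1 ->
  cabs (a * (u * v) - b * v) <= cabs (a - b) + cabs b * cabs (u - 1).
Proof.
move=> u1 v1.
have -> : a * (u * v) - b * v = (a - b) * (u * v) + b * v * (u - 1) by ring.
by apply: le_trans (cabsD _ _) _; rewrite !cabsM u1 v1 !mulr1.
Qed.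

(** * Poisson summation for the bracket *)

Section main_identity.
Context {R : realType} {d : nat}.
Variable theta : {additive 'rV[int]_d -> 'rV[R]_d}.
Hypothesis htheta : is_embedding theta.
Local Notation A := (A_theta theta).
Local Notation iota := (@Defs.iota R d).
Local Notation C := R[i].
Let uA : A \in unitmx := A_theta_unit htheta.
Implicit Types f : Cc R d.

Let pull (f : Cc R d) y := f (y *m A^T).

Let ucs_pull f : ucs (pull f).
Proof. by apply: (ucs_linear (f := f)); [rewrite unitmx_tr|exact: Cc_ucs]. Qed.

Let detA0 : 0 < `|\det A|.
Proof. by rewrite normr_gt0 -unitfE -unitmxE. Qed.

Lemma cintegrable_bracket f g : cintegrable (fun x => (f (x - theta g))^* * f x).
Proof.
have [bf _] := Cc_ucs f; apply: bcs_cintegrable; apply: bcsM.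
- by apply: bcs_conj; exact: bcs_translate.
- by case: bf.
- by case: bf.
Qed.

Lemma bracket_autocorr f g :
  bracket theta f f g = `|\det A|%:C%C * autocorr (pull f) (iota g).
Proof.
have := Cintegral_linear (A := A^T) _ (cintegrable_bracket f g).
rewrite unitmx_tr det_tr => /(_ uA).
rewrite /bracket /autocorr => E.
have -> : (fun x => (pull f (x - iota g))^* * pull f x) =
    (fun x => (f (x *m A^T - theta g))^* * f (x *m A^T)).
  by apply/funext => x; rewrite /pull mulmxBl (A_thetaE htheta).
by rewrite E mulrA -rmorphM /= divff ?mul1r // gt_eqF.
Qed.

Lemma fourier_pull f xi :
  fourierR (pull f) xi = (`|\det A|^-1)%:C%C * fourierR f (xi *m invmx A).
Proof.
have [bf _] := Cc_ucs f.
have bF : bcs (fun x => f x * expi (dot x (xi *m invmx A))).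
  apply: bcsM => //; last by exists 1 => x; rewrite cabs_expi.
  by apply: cmeasurable_expi; apply: measurable_dot => //; exact: measurable_cst.
have := Cintegral_linear (A := A^T) _ (bcs_cintegrable bF).
rewrite unitmx_tr det_tr => /(_ uA) <-.
congr Cintegral; apply/funext => y; rewrite /pull; congr (_ * expi _).
by rewrite dot_mul trmxK -mulmxA mulVmx // mulmx1.
Qed.

(* The common value of the two transforms at the class of [eta]. *)
Definition spectral f (eta : 'rV[R]_d) : \bar R :=
  (\esum_(k in [set: 'rV[int]_d])
    (`|\det A|^-1 * cabs (fourierR f ((eta + iota k) *m invmx A)) ^+ 2)%:E)%E.

(** [poisson] applies to the autocorrelation times the character of frequency [eta]: the modulation
    turns the frequencies [k] into [eta + iota k] and the lattice values into
    [bracket theta f f g * char g eta]. *)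
Lemma spectral_bracket f : exists2 N, forall g, g \notin int_box N -> bracket theta f f g = 0 &
  forall eta,
    complex.Im (\sum_(g <- int_box N) bracket theta f f g * char g eta) = 0 /\
    spectral f eta = (complex.Re (\sum_(g <- int_box N) bracket theta f f g * char g eta))%:E.
Proof.
have [bg ug] := ucs_pull f; have [_ _ [K hK]] := bg.
have [ba ua] := ucs_autocorr (ucs_pull f).
pose c : C := `|\det A|%:C%C.
pose G y := c * autocorr (pull f) y.
have cc : cabs c = `|\det A| by rewrite cabs_real normr_id.
pose M := (Num.truncn (K + K)).+1.
have hM y : G y != 0 -> forall i, `|y ord0 i| <= M%:R.
  rewrite mulf_eq0 negb_or => /andP[_ /(autocorr_supp hK) h] i.
  by apply: le_trans (h i) _; exact/ltW/truncnS_gt.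
have GE g : bracket theta f f g = G (iota g) by exact: bracket_autocorr.
have bG : bcs G by exact: bcsZ.
have uG (e : R) : 0 < e -> exists2 delta : R, 0 < delta & forall x y : 'rV[R]_d,
    (forall i, `|y ord0 i| < delta) -> cabs (G (x + y) - G x) <= e.
  move=> e0; have [delta delta0 h] := ua _ (divr_gt0 e0 detA0).
  exists delta => // x y yd; rewrite /G -mulrBr cabsM cc mulrC -ler_pdivlMr //.
  exact: h.
exists M.+1.
  move=> g gN; rewrite GE.
  apply/eqP; apply: contraNT gN => h; apply: mem_int_box => i.
  have := hM _ h i; rewrite mxE -intr_norm -natr_absz ler_nat => h1.
  exact: leq_trans h1 _.
move=> eta.
pose H y := G y * expi (dot y eta).
have mE : cmeasurable (fun y : 'rV[R]_d => expi (dot y eta)).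
  by apply: cmeasurable_expi; apply: measurable_dot => //; exact: measurable_cst.
have bH : bcs H by apply: bcsM => //; exists 1 => x; rewrite cabs_expi.
have HM y : H y != 0 -> forall i, `|y ord0 i| <= M%:R.
  by rewrite /H mulf_eq0 negb_or => /andP[/hM].
pose r (g : 'rV[int]_d) : R :=
  `|\det A|^-1 * cabs (fourierR f ((eta + iota g) *m invmx A)) ^+ 2.
have Hr g : Cintegral (fun y => H y * char g y) = (r g)%:C%C.
  transitivity (c * Cintegral (fun y => autocorr (pull f) y * expi (dot y (eta + iota g)))).
    rewrite -CintegralZ; last first.
      apply/bcs_cintegrable/bcsM => //; last by exists 1 => x; rewrite cabs_expi.
      by apply: cmeasurable_expi; apply: measurable_dot => //; exact: measurable_cst.
    congr Cintegral; apply/funext => y; rewrite /H /G /char -!mulrA -expiD dotDr.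
    by rewrite [dot (iota g) y]dotC.
  rewrite fourier_autocorr // conj_mul_cabs fourier_pull cabsM cabs_real.
  rewrite -rmorphM /r; congr (_%:C%C).
  (* The bracket contributes [|det A|] and each of the two transforms of [pull f] contributes its
     inverse. *)
  rewrite [`|_^-1|]ger0_norm ?invr_ge0 // exprMn mulrA; congr (_ * _).
  by rewrite expr2 mulrA mulfV ?mul1r // gt_eqF.
have r0 g : 0 <= r g by rewrite mulr_ge0 ?invr_ge0 // sqr_ge0.
have cH (g : 'rV[int]_d) (e : R) : 0 < e -> exists2 delta : R, 0 < delta &
    forall y : 'rV[R]_d, (forall i, `|y ord0 i| < delta) ->
    cabs (H (y + iota g) - H (iota g)) <= e.
  move=> e0; have e2 : 0 < e / 2 by rewrite divr_gt0.
  have [d1 d10 h1] := uG _ e2.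
  pose k := cabs (G (iota g)) + 1.
  have k0 : 0 < k by rewrite ltr_wpDl ?cabs_ge0.
  have [d2 d20 h2] := char_near eta (divr_gt0 e2 k0).
  exists (Num.min d1 d2); first by rewrite lt_min d10.
  move=> y yd; rewrite /H dotDl expiD.
  apply: le_trans (cabs_mulB_le _ _ (cabs_expi _) (cabs_expi _)) _.
  rewrite [leRHS]splitr lerD //.
    rewrite (addrC y); apply: h1 => i; apply: lt_le_trans (yd i) _.
    by rewrite ge_min lexx.
  apply: (@le_trans _ _ (k * (e / 2 / k))); last by rewrite mulrC divfK ?gt_eqF.
  apply: ler_pM; [exact: cabs_ge0|exact: cabs_ge0|by rewrite /k lerDl|].
  rewrite dotC; apply: h2 => i; apply: lt_le_trans (yd i) _.
  by rewrite ge_min lexx orbT.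
have [P1 P2] := poisson bH HM cH Hr r0.
have -> : \sum_(g <- int_box M.+1) bracket theta f f g * char g eta =
    \sum_(g <- int_box M.+1) H (iota g).
  by apply: eq_bigr => g _; rewrite GE.
by split.
Qed.

End main_identity.

(** One inequality for every positive factor is enough: applied to [c^-1] it gives the reverse
    one. *)
Lemma esumZ {R : realType} {T : choiceType} (D : set T) (c : R) (b : T -> R) :
  0 < c -> (forall i, 0 <= b i) ->
  (\esum_(i in D) (c * b i)%:E = c%:E * \esum_(i in D) (b i)%:E)%E.
Proof.
have le (k : R) (a : T -> R) : 0 < k -> (forall i, 0 <= a i) ->
    (\esum_(i in D) (k * a i)%:E <= k%:E * \esum_(i in D) (a i)%:E)%E.
  move=> k0 a0; apply: ge_ereal_sup => _ [X XD <-].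
  under eq_fsbigr do rewrite EFinM.
  rewrite -ge0_mule_fsumr; last by move=> i; rewrite lee_fin.
  by rewrite lee_pmul2l // ?ltr0n // esum_ge //; exists X.
move=> c0 b0; apply/eqP; rewrite eq_le le //=.
have := le c^-1 (fun i => c * b i); rewrite invr_gt0 => /(_ c0).
under eq_esum do rewrite mulrA mulVf ?gt_eqF // mul1r.
move=> /(_ (fun i => mulr_ge0 (ltW c0) (b0 i))) h.
rewrite -(@lee_pmul2l _ c^-1%:E) ?lte_fin ?invr_gt0 // muleA -EFinM mulVf ?gt_eqF //.
by rewrite mul1e.
Qed.

(* Locking prevents the unifier from unfolding the sums when it compares the
   values for two different functions. *)
Fact spectral_key : unit. Proof. exact: tt. Qed.

(** * The three expressions of the norm *)

Section torus_formula.
Context {R : realType} {d : nat}.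
Variable theta : {additive 'rV[int]_d -> 'rV[R]_d}.
Hypothesis htheta : is_embedding theta.
Local Notation A := (A_theta theta).
Local Notation iota := (@Defs.iota R d).
Local Notation C := R[i].
Let uA : A \in unitmx := A_theta_unit htheta.
Implicit Types f : Cc R d.

Definition spectralR f : 'rV[R]_d -> R :=
  locked_with spectral_key (fun eta => fine (spectral theta f eta)).

Lemma spectralRE f eta : spectralR f eta = fine (spectral theta f eta).
Proof. by rewrite /spectralR unlock. Qed.

Let detA0 : 0 < `|\det A|^-1.
Proof. by rewrite invr_gt0 normr_gt0 -unitfE -unitmxE. Qed.

Lemma spectralR_ge0 f eta : 0 <= spectralR f eta.
Proof.
rewrite spectralRE; apply/fine_ge0/esum_ge0 => k _.
by rewrite lee_fin mulr_ge0 ?sqr_ge0 // ltW.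
Qed.

Lemma spectral_fin f eta : spectral theta f eta = (spectralR f eta)%:E.
Proof.
have [N _ /(_ eta)[_ E]] := spectral_bracket htheta f.
by rewrite spectralRE E.
Qed.

(** As a trigonometric polynomial in [eta], [spectralR] is periodic, bounded and continuous, and its
    mean over a period is its constant coefficient; all four facts are drawn from this form. *)
Lemma bracket_expansion f : exists2 N, forall g, g \notin int_box N -> bracket theta f f g = 0 &
  forall eta, \sum_(g <- int_box N) bracket theta f f g * char g eta = (spectralR f eta)%:C%C.
Proof.
have [N h1 h2] := spectral_bracket htheta f; exists N => // eta.
have [i r] := h2 eta; apply: complexP => //=.
by rewrite spectralRE r.
Qed.

Lemma spectralR_periodic f eta k : spectralR f (eta + iota k) = spectralR f eta.
Proof.
have [N _ h] := bracket_expansion f.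
have : (spectralR f (eta + iota k))%:C%C = (spectralR f eta)%:C%C :> C.
  by rewrite -(h (eta + iota k)) -(h eta); apply: eq_bigr => g _; rewrite char_periodic.
by case.
Qed.

Lemma spectralR_bounded f : exists M, forall eta, spectralR f eta <= M.
Proof.
have [N _ h] := bracket_expansion f.
exists (\sum_(g <- int_box N) cabs (bracket theta f f g)) => eta.
have -> : spectralR f eta = cabs (spectralR f eta)%:C%C.
  by rewrite cabs_real ger0_norm // spectralR_ge0.
rewrite -h; apply: le_trans (cabs_sum _ _ _) _; apply: ler_sum => g _.
by rewrite cabsM cabs_char mulr1.
Qed.

Lemma fourierZ_bracket f (zeta : torus R d) :
  Csummable setT (fun g => bracket theta f f g * chi g zeta) /\
  fourierZ (bracket theta f f) zeta = (spectralR f (repr zeta))%:C%C.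
Proof.
have [N h1 h2] := bracket_expansion f.
have h g : g \notin int_box N -> bracket theta f f g * chi g zeta = 0.
  by move=> /h1 ->; rewrite mul0r.
split; first exact: Csummable_finite_support (int_box_uniq _) h.
by rewrite -h2; exact: Csum_finite_support (int_box_uniq _) h.
Qed.

Lemma iotahat_eq (x y : 'rV[R]_d) :
  iotahat x = iotahat y <-> exists k, x = y + iota k.
Proof.
split.
  move=> /eqP; rewrite /iotahat -Quotient.idealrBE => /forallP h.
  exists (\row_i Num.floor ((x - y) ord0 i)); apply/rowP => i.
  by rewrite !mxE floorK; [rewrite addrC subrK|have := h i; rewrite !mxE].
move=> [k ->]; apply/eqP; rewrite /iotahat -Quotient.idealrBE addrC addKr.
by apply/forallP => i; rewrite mxE intr_int.
Qed.

Lemma thetahat_repr (eta : 'rV[R]_d) (zeta : torus R d) :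
  iotahat eta = zeta -> exists k, eta = repr zeta + iota k.
Proof.
move=> h; apply/iotahat_eq; rewrite h /iotahat.
by rewrite reprK.
Qed.

(** With [eta] fixed, these points are the fibre of [thetahat] over the class of [eta], and equally
    the translate of the dual lattice by [eta *m invmx A]. *)
Let pull_point (eta : 'rV[R]_d) (k : 'rV[int]_d) := (eta + iota k) *m invmx A.

Let pull_point_inj eta : injective (pull_point eta).
Proof.
move=> k l /(congr1 (fun z => z *m A)); rewrite /pull_point !mulmxKV // => /addrI.
exact: iota_inj.
Qed.

Let esum_fiber f eta :
  (\esum_(xi in range (pull_point eta)) (cabs (fourierR f xi) ^+ 2)%:E =
  (`|\det A| * spectralR f eta)%:E)%E.
Proof.
rewrite esum_image; last by move=> x y _ _; exact: pull_point_inj.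
rewrite EFinM -spectral_fin /spectral esumZ // => [|k]; last exact: sqr_ge0.
rewrite muleA -EFinM divff ?mul1e // -(invrK `|_|) invr_eq0 gt_eqF //.
Qed.

(** Stated for an arbitrary index type, because the dual bracket sums over points of the fibre and
    the lattice sum over increments [beta]. *)
Let sum_fiber (T : choiceType) (D : set T) (p : T -> C) f eta :
  (\esum_(i in D) (cabs (p i) ^+ 2)%:E = (`|\det A| * spectralR f eta)%:E)%E ->
  Csummable D (fun i => (p i)^* * p i) /\
  (`|\det A|^-1)%:C%C * Csum D (fun i => (p i)^* * p i) = (spectralR f eta)%:C%C.
Proof.
move=> E.
have -> : (fun i => (p i)^* * p i) = (fun i => (cabs (p i) ^+ 2)%:C%C).
  by apply/funext => i; rewrite conj_mul_cabs.
split.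
  apply: Csummable_ge0; first by move=> i; exact: sqr_ge0.
  by rewrite E ltry.
rewrite Csum_ge0; last by move=> i; exact: sqr_ge0.
rewrite E /= -rmorphM mulrA mulVf ?mul1r // -(invrK `|_|) invr_eq0 gt_eqF //.
Qed.

Lemma dual_bracket_spectral f (zeta : torus R d) :
  Csummable [set xi | thetahat theta xi = zeta] (fun xi => (fourierR f xi)^* * fourierR f xi) /\
  dual_bracket theta (fourierR f) (fourierR f) zeta = (spectralR f (repr zeta))%:C%C.
Proof.
rewrite /dual_bracket.
have -> : [set xi | thetahat theta xi = zeta] = range (pull_point (repr zeta)).
  apply/seteqP; split => xi.
    move=> /thetahat_repr[k E]; exists k => //.
    by rewrite /pull_point -E mulmxK.
  move=> [k _ <-] /=; rewrite /thetahat /pull_point mulmxKV //.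
  rewrite -[RHS]reprK; apply/iotahat_eq; by exists k.
exact: sum_fiber (esum_fiber _ _).
Qed.

Lemma lattice_sum_spectral f (xi : 'rV[R]_d) :
  Csummable (dual_lattice theta)
    (fun beta => (fourierR f (xi + beta))^* * fourierR f (xi + beta)) /\
  lattice_sum theta (fourierR f) xi = (spectralR f (xi *m A))%:C%C.
Proof.
apply: (sum_fiber (p := fun beta => fourierR f (xi + beta))).
rewrite -esum_fiber /dual_lattice !esum_image.
- by apply: eq_esum => k _; rewrite /pull_point mulmxDl mulmxK.
- by move=> x y _ _; exact: pull_point_inj.
- by move=> x y _ _ /(congr1 (fun z => z *m A)); rewrite !mulmxKV // => /iota_inj.
Qed.

Lemma normXE f : normX theta f =
  ereal_sup (range (fun zeta : torus R d => (Num.sqrt (spectralR f (repr zeta)))%:E)).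
Proof.
rewrite /normX; set F := (fun zeta : torus R d => _); set G := (fun zeta : torus R d => _).
suff -> : F = G by [].
by apply/funext => zeta; rewrite /F /G; have [_ ->] := fourierZ_bracket f zeta.
Qed.

(** By periodicity, the chosen representatives of torus classes give the same values as all of
    R^d. *)
Lemma range_spectralR f :
  range (fun zeta : torus R d => (Num.sqrt (spectralR f (repr zeta)))%:E) =
  range (fun eta : 'rV[R]_d => (Num.sqrt (spectralR f eta))%:E).
Proof.
apply/seteqP; split => _ [z _ <-]; first by exists (repr z).
exists (iotahat z) => //.
have [k E] := @thetahat_repr z _ erefl.
by rewrite [in RHS]E spectralR_periodic.
Qed.

Lemma normX_fin f : normX theta f \is a fin_num.
Proof.
have [M hM] := spectralR_bounded f.
rewrite normXE range_spectralR fin_numE; apply/andP; split.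
  rewrite gt_eqF // (@lt_le_trans _ _ (Num.sqrt (spectralR f 0))%:E) ?ltNyr //.
  by apply: ereal_sup_ubound; exists 0.
rewrite lt_eqF // (@le_lt_trans _ _ (Num.sqrt M)%:E) ?ltry //.
by apply: ge_ereal_sup => _ [eta _ <-]; rewrite lee_fin ler_wsqrtr.
Qed.

Lemma fine_normX_ge0 f : 0 <= fine (normX theta f).
Proof.
rewrite -lee_fin (fineK (normX_fin f)) normXE range_spectralR.
apply: (@le_trans _ _ (Num.sqrt (spectralR f 0))%:E); first by rewrite lee_fin sqrtr_ge0.
by apply: ereal_sup_ubound; exists 0.
Qed.

Lemma spectralR_le_normX f eta : spectralR f eta <= fine (normX theta f) ^+ 2.
Proof.
have h : (Num.sqrt (spectralR f eta) <= fine (normX theta f)).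
  rewrite -lee_fin (fineK (normX_fin f)) normXE range_spectralR.
  by apply: ereal_sup_ubound; exists eta.
by rewrite -[leLHS]sqr_sqrtr ?spectralR_ge0 // lerXn2r // nnegrE ?sqrtr_ge0 ?fine_normX_ge0.
Qed.

Lemma normX_le_spectralR f (c : R) : c ^+ 2 < fine (normX theta f) ^+ 2 -> 0 <= c ->
  exists eta, c ^+ 2 < spectralR f eta.
Proof.
move=> cf c0; apply: contrapT => /forallNP h.
have hle : fine (normX theta f) <= c.
  rewrite -lee_fin (fineK (normX_fin f)) normXE range_spectralR.
  apply: ge_ereal_sup => _ [eta _ <-]; rewrite lee_fin -[leRHS]ger0_norm // -sqrtr_sqr.
  by apply: ler_wsqrtr; rewrite leNgt; exact/negP.
by move: cf; rewrite ltNge lerXn2r ?nnegrE ?fine_normX_ge0.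
Qed.

End torus_formula.

(** * Comparison with the L^2 norm *)

Section L2norm.
Context {R : realType} {d : nat}.
Local Notation C := R[i].
Implicit Types F G : 'rV[R]_d -> C.

Definition sqnorm F : \bar R := (\int[leb R d]_x (cabs (F x) ^+ 2)%:E)%E.

Lemma sqnorm_ge0 F : (0 <= sqnorm F)%E.
Proof. by apply: integral_ge0 => x _; rewrite lee_fin sqr_ge0. Qed.

Lemma L2norm_sqrt F : L2norm F = sqrte (sqnorm F).
Proof.
rewrite /L2norm unlock -poweR12_sqrt ?sqnorm_ge0 //; congr (_ `^ _)%E.
apply: eq_integral => x _; rewrite poweR_EFin; congr EFin.
by rewrite powR_mulrn ?normr_ge0 // ger0_norm ?cabs_ge0.
Qed.

Lemma L2norm_le F (s : R) : 0 <= s -> (L2norm F <= s%:E)%E = (sqnorm F <= (s ^+ 2)%:E)%E.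
Proof.
move=> s0; rewrite L2norm_sqrt; have := sqnorm_ge0 F.
case: (sqnorm F) => [r| |] //=; rewrite ?lee_fin => r0.
- apply/idP/idP => h.
    by rewrite -[r]sqr_sqrtr // lerXn2r // nnegrE sqrtr_ge0.
  by rewrite -[s]ger0_norm // -sqrtr_sqr ler_wsqrtr.
Qed.

Lemma L2norm_ge0 F : (0 <= L2norm F)%E.
Proof. exact: Lnorm_ge0. Qed.

Lemma L2norm_ltP F : (L2norm F < +oo)%E = (sqnorm F < +oo)%E.
Proof.
rewrite L2norm_sqrt; have := sqnorm_ge0 F.
by case: (sqnorm F) => [r| |] //= _; rewrite !ltry.
Qed.

Lemma measurable_sqnorm F : cmeasurable F ->
  measurable_fun setT (fun x => (cabs (F x) ^+ 2)%:E).
Proof.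
move=> mF; apply/measurable_EFinP.
by apply: (measurable_funX 2); exact: cmeasurable_cabs.
Qed.

Lemma sqnormD F G : cmeasurable F -> cmeasurable G ->
  (sqnorm (fun x => F x + G x)%R <= 2%:E * sqnorm F + 2%:E * sqnorm G)%E.
Proof.
move=> mF mG; have h F' : cmeasurable F' -> (2%:E * sqnorm F' = \int[leb R d]_x (2 * cabs (F' x) ^+ 2)%:E)%E.
  move=> mF'; rewrite -(ge0_integralZl _ measurableT (measurable_sqnorm mF')) //.
  by move=> x _; rewrite lee_fin sqr_ge0.
have m2 F' : cmeasurable F' -> measurable_fun setT (fun x => (2 * cabs (F' x) ^+ 2)%:E).
  move=> mF'; apply/measurable_EFinP; apply: measurable_funM => //.
  by apply: (measurable_funX 2); exact: cmeasurable_cabs.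
rewrite !h // -ge0_integralD //.
- apply: ge0_le_integral => //.
  + by move=> x _; rewrite lee_fin sqr_ge0.
  + exact: measurable_sqnorm (cmeasurableD mF mG).
  + by apply: emeasurable_funD; exact: m2.
  + by move=> x _; rewrite -EFinD lee_fin cabs_sqrD.
- by move=> x _; rewrite lee_fin mulr_ge0 // sqr_ge0.
- exact: m2.
- by move=> x _; rewrite lee_fin mulr_ge0 // sqr_ge0.
- exact: m2.
Qed.

End L2norm.

Section cube_average.
Context {R : realType} {d : nat}.
Variable theta : {additive 'rV[int]_d -> 'rV[R]_d}.
Hypothesis htheta : is_embedding theta.
Local Notation C := R[i].
Implicit Types f : Cc R d.

Lemma sqnorm_bracket f : sqnorm f = (complex.Re (bracket theta f f 0))%:E.
Proof.
have [bf _] := Cc_ucs f.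
have E : (fun x => (f (x - theta 0))^* * f x) = (fun x => (cabs (f x) ^+ 2)%:C%C).
  by apply/funext => x; rewrite raddf0 subr0 conj_mul_cabs.
have [h _] : cintegrable (fun x => (cabs (f x) ^+ 2)%:C%C).
  by rewrite -E; exact: cintegrable_bracket.
rewrite /bracket E /= /Rintegral /= fineK //.
exact: (integrable_fin_num measurableT h).
Qed.

(** Orthogonality of characters retains only the coefficient at 0. The shift by [eta0] centres the
    period at a point of choice, namely the peak in the proof of injectivity. *)
Lemma cube_average f eta0 :
  bcs (fun eta => cubeI eta * (spectralR theta f (eta0 + eta))%:C%C) /\
  Cintegral (fun eta => cubeI eta * (spectralR theta f (eta0 + eta))%:C%C) =
    bracket theta f f 0.
Proof.
have [N hN h] := bracket_expansion htheta f.
have E : (fun eta => cubeI eta * (spectralR theta f (eta0 + eta))%:C%C) =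
    (fun eta => \sum_(g <- int_box N) bracket theta f f g * char g eta0 * (cubeI eta * char g eta)).
  apply/funext => eta; rewrite -h mulr_sumr; apply: eq_bigr => g _.
  by rewrite /char dotDr expiD; ring.
have bg g : bcs (fun eta : 'rV[R]_d => bracket theta f f g * char g eta0 * (cubeI eta * char g eta)).
  by apply: bcsZ; exact: bcs_cube_char.
rewrite E; split.
  elim: (int_box N) => [|g s IH]; first by under eq_fun do rewrite big_nil; exact: bcs0.
  by under eq_fun do rewrite big_cons; exact: bcsD.
rewrite Cintegral_sum; last by move=> g; exact: bcs_cintegrable.
under eq_bigr => g _.
  rewrite CintegralZ; last exact/bcs_cintegrable/bcs_cube_char.
  rewrite Cintegral_cube_char; over.
have [z|nz] := boolP (0 \in @int_box d N).
  rewrite (bigD1_seq _ z (int_box_uniq _)) /= eqxx mulr1 char0 mulr1.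
  by rewrite big1 ?addr0 // => g /negbTE ->; rewrite mulr0.
rewrite (hN _ nz) big_seq big1 // => g gs.
by rewrite (_ : g == 0 = false) ?mulr0 //; apply: contraNF nz => /eqP <-.
Qed.

Lemma sqnorm_le f (c : R) : (forall eta, spectralR theta f eta <= c) -> (sqnorm f <= c%:E)%E.
Proof.
move=> hc; rewrite sqnorm_bracket lee_fin.
have [b <-] := cube_average f 0.
have bc : bcs (fun eta : 'rV[R]_d => c%:C%C * cubeI eta) by exact/bcsZ/bcs_cubeI.
have -> : c = complex.Re (Cintegral (fun eta : 'rV[R]_d => c%:C%C * cubeI eta)).
  rewrite CintegralZ; last exact/bcs_cintegrable/bcs_cubeI.
  have -> : Cintegral (@cubeI R d) = 1.
    have := @Cintegral_cube_char R d 0; rewrite eqxx => h; rewrite -[RHS]h.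
    by congr Cintegral; apply/funext => y; rewrite char0 mulr1.
  by rewrite mulr1.
have [i1 _] := bcs_cintegrable b; have [i2 _] := bcs_cintegrable bc.
apply: le_Rintegral => // eta _.
rewrite /cubeI -!rmorphM /= mulrC ler_wpM2r // add0r.
Qed.

(** Since [spectralR] is nonnegative, its average is at least the part over a small cube, and
    [delta < 1/2] keeps that cube inside the period. *)
Lemma sqnorm_ge f (eta0 : 'rV[R]_d) (c delta : R) : 0 <= c -> 0 < delta -> delta < 2^-1 ->
  (forall eta : 'rV[R]_d, (forall i, `|eta ord0 i| <= delta) ->
     c <= spectralR theta f (eta0 + eta)) ->
  ((c * (delta + delta) ^+ d)%:E <= sqnorm f)%E.
Proof.
move=> c0 d0 d2 hc; rewrite sqnorm_bracket lee_fin.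
have [b <-] := cube_average f eta0.
pose B := [set x : 'rV[R]_d | forall i, (const_mx (- delta) : 'rV[R]_d) ord0 i <= x ord0 i <= (const_mx delta : 'rV[R]_d) ord0 i].
have mB : measurable B.
  rewrite (_ : B = \bigcap_(i in [set: 'I_d])
      ((fun x : 'rV[R]_d => x ord0 i) @^-1` `[- delta, delta])).
    apply: fin_bigcap_measurable => // i _.
    by rewrite -[X in measurable X]setTI; exact: measurable_coord.
  apply/seteqP; split => x /= h i; have := h i; first by rewrite /= in_itv /= !mxE.
  by move=> /(_ I); rewrite /= in_itv /= !mxE.
have [i1 _] := bcs_cintegrable b.
rewrite -lee_fin /= /Rintegral fineK; last exact: (integrable_fin_num measurableT i1).
have -> : ((c * (delta + delta) ^+ d)%:E = \int[leb R d]_x (c * \1_B x)%:E)%E.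
  under eq_integral do rewrite EFinM.
  have mI : measurable_fun setT (fun x : 'rV[R]_d => (\1_B x : R)%:E).
    exact/measurable_EFinP/measurable_indic.
  rewrite (ge0_integralZl _ measurableT mI) // integral_indic // setIT.
  have volB : leb R d B = ((delta + delta) ^+ d)%:E.
    apply: etrans (leb_box _) _; first by move=> i; rewrite !mxE; lra.
    under eq_bigr do rewrite !mxE opprK.
    by rewrite prodr_const card_ord.
  by rewrite [X in _ = (_ * X)%E]volB.
apply: ge0_le_integral => //.
- by move=> x _; rewrite lee_fin mulr_ge0.
- by apply/measurable_EFinP; apply: measurable_funM => //; exact: measurable_indic.
- by have /integrableP[h' _] := i1.
- move=> x _; rewrite lee_fin mul0r subr0 !indicE.
  have [xB|_] := boolP (x \in B); last by rewrite mulr0 mulr_ge0 // spectralR_ge0.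
  rewrite mulr1 mem_set ?mul1r.
    apply: hc => i; move: xB; rewrite inE => /(_ i); rewrite !mxE.
    by rewrite ler_norml.
  by move=> i; move: xB; rewrite inE => /(_ i); rewrite !mxE => /andP[h1 h2]; apply/andP; split; lra.
Qed.

Lemma L2norm_le_normX f : (L2norm f <= normX theta f)%E.
Proof.
rewrite -(fineK (normX_fin htheta f)) L2norm_le; last exact: fine_normX_ge0.
by apply: sqnorm_le => eta; exact: spectralR_le_normX.
Qed.

Lemma spectralR_near f eta0 (e : R) : 0 < e -> exists2 delta : R, 0 < delta &
  forall eta : 'rV[R]_d, (forall i, `|eta ord0 i| < delta) ->
    `|spectralR theta f (eta0 + eta) - spectralR theta f eta0| <= e.
Proof.
move=> e0; have [N _ h] := bracket_expansion htheta f.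
have key (s : seq 'rV[int]_d) (e' : R) : 0 < e' -> exists2 delta : R, 0 < delta &
    forall eta : 'rV[R]_d, (forall i, `|eta ord0 i| < delta) ->
      cabs (\sum_(g <- s) bracket theta f f g * char g (eta0 + eta) -
        \sum_(g <- s) bracket theta f f g * char g eta0) <= e'.
  elim: s e' => [|g s IH] e' e'0.
    by exists 1 => // eta _; rewrite !big_nil subr0 cabs0 ltW.
  have e2 : 0 < e' / 2 by rewrite divr_gt0.
  have [d1 d10 h1] := IH _ e2.
  (* The added 1 keeps the divisor positive when the coefficient vanishes. *)
  pose k := cabs (bracket theta f f g) + 1.
  have k0 : 0 < k by rewrite ltr_wpDl ?cabs_ge0.
  have [d2 d20 h2] := char_near (Defs.iota R g) (divr_gt0 e2 k0).
  exists (Num.min d1 d2); first by rewrite lt_min d10.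
  move=> eta hd; rewrite !big_cons opprD addrACA.
  apply: le_trans (cabsD _ _) _; rewrite [leRHS]splitr lerD //; last first.
    by apply: h1 => i; apply: lt_le_trans (hd i) _; rewrite ge_min lexx.
  rewrite -mulrBr cabsM.
  have -> : char g (eta0 + eta) - char g eta0 = char g eta0 * (char g eta - 1).
    by rewrite /char dotDr expiD; ring.
  rewrite cabsM cabs_char mul1r.
  apply: (@le_trans _ _ (k * (e' / 2 / k))); last by rewrite mulrC divfK ?gt_eqF.
  apply: ler_pM; [exact: cabs_ge0|exact: cabs_ge0|by rewrite /k lerDl|].
  by apply: h2 => i; apply: lt_le_trans (hd i) _; rewrite ge_min lexx orbT.
have [delta delta0 hd] := key (int_box N) e e0.
exists delta => // eta /hd; rewrite (h (eta0 + eta)) (h eta0).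
by rewrite -rmorphB cabs_real.
Qed.

(* Half of the parallelogram law, applied termwise to the sum over the fibre. *)
Lemma spectralRD f g eta :
  spectralR theta (f + g) eta <= 2 * spectralR theta f eta + 2 * spectralR theta g eta.
Proof.
have fD xi : fourierR (f + g) xi = fourierR f xi + fourierR g xi.
  have ci (k : Cc R d) : cintegrable (fun x => k x * expi (dot x xi)).
    have [bk _] := Cc_ucs k; apply: bcs_cintegrable; apply: bcsM => //.
      by apply: cmeasurable_expi; apply: measurable_dot => //; exact: measurable_cst.
    by exists 1 => x; rewrite cabs_expi.
  rewrite /fourierR -CintegralD //; congr Cintegral; apply/funext => x.
  by rewrite -mulrDl.
have A0 : 0 < `|\det (A_theta theta)|^-1.
  by rewrite invr_gt0 normr_gt0 -unitfE -unitmxE; exact: A_theta_unit.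
rewrite -lee_fin EFinD !EFinM -!(spectral_fin htheta) /spectral.
have t0 k (u : Cc R d) : 0 <= `|\det (A_theta theta)|^-1 *
    cabs (fourierR u ((eta + Defs.iota R k) *m invmx (A_theta theta))) ^+ 2.
  by rewrite mulr_ge0 ?sqr_ge0 // ltW.
rewrite -!esumZ // -esumD //.
- apply: le_esum => k _; rewrite -EFinD lee_fin fD.
  rewrite [2 * (_ * _)]mulrCA [X in _ <= _ + X]mulrCA -mulrDr ler_pM2l //.
  exact: cabs_sqrD.
- by move=> k _; rewrite lee_fin mulr_ge0.
- by move=> k _; rewrite lee_fin mulr_ge0.
Qed.

End cube_average.

(** * Limits of fast Cauchy sequences in L^2 *)

Section L2_limit.
Context {R : realType} {d : nat}.
Local Notation C := R[i].
Local Notation mu := (leb R d).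

Lemma cvg_of_geometric_steps (u : nat -> R) (K : R) :
  (forall n, `|u n.+1 - u n| <= K * 2^-1 ^+ n) -> cvgn u.
Proof.
move=> h; have K0 : 0 <= K by have := le_trans (normr_ge0 _) (h 0%N); rewrite mulr1.
have c1 : cvgn (series (geometric K 2^-1)).
  by apply: is_cvg_geometric_series; rewrite ger0_norm //; lra.
have c2 : cvgn (series (telescope u)).
  apply: normed_cvg; apply: series_le_cvg c1 => n //=; last exact: h.
  by rewrite mulr_ge0 // exprn_ge0.
rewrite (_ : u = (fun n => u 0%N + series (telescope u) n)).
  by apply: is_cvgD => //; exact: is_cvg_cst.
by apply/funext => n; rewrite -eq_sum_telescope.
Qed.

(* The weighted sum of the [4 ^ n * |u n.+1 - u n| ^ 2] has a finite integral; at
   every point where it is finite, the steps decrease geometrically. *)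
Lemma L2_limit (u : nat -> 'rV[R]_d -> C) (K : R) :
  (forall n, cmeasurable (u n)) ->
  (forall n, (sqnorm (fun x => (u n.+1 x - u n x)%R) <= (K * 8^-1 ^+ n)%:E)%E) ->
  exists F (N : set 'rV[R]_d), [/\ cmeasurable F, measurable N, mu N = 0 &
    forall x, ~ N x -> (fun n => cabs (u n x - F x)) @ \oo --> (0 : R)].
Proof.
move=> mu_ hK.
have K0 : 0 <= K.
  by have := le_trans (sqnorm_ge0 _) (hK 0%N); rewrite lee_fin mulr1.
(* Against the bound [8^-n] the weight [4^n] leaves the summable [2^-n]; at a point where the sum is
   finite, a square root turns the weight into decay of the steps like [2^-n]. *)
pose t n x := (4 ^+ n * cabs (u n.+1 x - u n x) ^+ 2)%:E.
have mt n : measurable_fun setT (t n).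
  apply/measurable_EFinP; apply: measurable_funM => //.
  by apply: (measurable_funX 2); apply: cmeasurable_cabs; exact: cmeasurableB.
have t0 n x : (0 <= t n x)%E by rewrite lee_fin; apply: mulr_ge0; [exact: exprn_ge0|exact: sqr_ge0].
pose S x := (\sum_(n <oo) t n x)%E.
have mS : measurable_fun setT S.
  by apply: ge0_emeasurable_sum.
have S0 x : (0 <= S x)%E by apply: nneseries_ge0.
have IS : (\int[mu]_x S x < +oo)%E.
  rewrite integral_nneseries //.
  apply: (@le_lt_trans _ _ (2 * K)%:E); last by rewrite ltry.
  apply: lime_le.
    by apply: is_cvg_nneseries => n _ _; apply: integral_ge0.
  apply: nearW => m.
  apply: (@le_trans _ _ (\sum_(0 <= n < m) (K * 2^-1 ^+ n)%:E)%E).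
    apply: lee_sum => n _; rewrite /t.
    under eq_integral do rewrite EFinM.
    rewrite ge0_integralZl ?lee_fin ?exprn_ge0 //; last first.
    - by move=> x _; rewrite lee_fin sqr_ge0.
    - by apply: measurable_sqnorm; exact: cmeasurableB.
    apply: (@le_trans _ _ ((4 ^+ n)%:E * (K * 8^-1 ^+ n)%:E)%E).
      by rewrite lee_pmul2l ?lte_fin ?exprn_gt0 //; exact: hK.
    rewrite -EFinM lee_fin mulrCA -exprMn.
    by rewrite (_ : 4 * 8^-1 = 2^-1) //; lra.
  rewrite sumEFin lee_fin -mulr_sumr mulrC ler_wpM2r //.
  suff E2 : \sum_(0 <= n < m) 2^-1 ^+ n = 2 - 2 * 2^-1 ^+ m :> R.
    by rewrite E2 lerBlDr lerDl mulr_ge0 // exprn_ge0.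
  elim: m => [|m IH]; first by rewrite big_nil expr0 mulr1 subrr.
  by rewrite big_nat_recr //= IH exprS; lra.
have iS : mu.-integrable setT S.
  apply/integrableP; split => //.
  by under eq_integral do rewrite gee0_abs //.
have [N [mN N0 SN]] := integrable_ae measurableT iS.
have cvgN x : ~ N x -> cvgn (fun n => complex.Re (u n x)) /\ cvgn (fun n => complex.Im (u n x)).
  move=> Nx; have Sx : S x \is a fin_num.
    by apply: contrapT => h; apply: Nx; apply: SN => /(_ I).
  pose B := Num.sqrt (fine (S x)).
  have step n : cabs (u n.+1 x - u n x) <= B * 2^-1 ^+ n.
    have tS : (t n x <= S x)%E.
      apply: le_trans (nneseries_lim_ge n.+1 _) => //.
      by rewrite big_nat_recr //= leeDr // sume_ge0.
    have h : 4 ^+ n * cabs (u n.+1 x - u n x) ^+ 2 <= fine (S x).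
      by rewrite -lee_fin fineK.
    rewrite -[X in _ <= _ * X]/((2^-1) ^+ n) exprVn ler_pdivlMr ?exprn_gt0 //.
    rewrite -[leLHS]ger0_norm ?mulr_ge0 ?cabs_ge0 ?exprn_ge0 // -sqrtr_sqr.
    apply: ler_wsqrtr; apply: le_trans h; rewrite exprMn mulrC exprAC.
    by rewrite (_ : 2 ^+ 2 = 4) //; rewrite -natrX.
  split.
  - apply: (@cvg_of_geometric_steps _ B) => n.
    by apply: le_trans (step n); rewrite -ReN -ReD Re_le_cabs.
  - apply: (@cvg_of_geometric_steps _ B) => n.
    by apply: le_trans (step n); rewrite -ImN -ImD Im_le_cabs.
(* Multiplication by this indicator makes the sequences converge everywhere, to 0 on [N], so that
   their limits are measurable. *)
pose ind x : R := \1_(~` N) x.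
pose F x := Complex (limn (fun n => complex.Re (u n x) * ind x)) (limn (fun n => complex.Im (u n x) * ind x)).
have mI : measurable_fun setT ind by apply: measurable_indic; exact: measurableC.
have cR x : cvgn (fun n => complex.Re (u n x) * ind x).
  rewrite /ind indicE; case: (boolP (x \in ~` N)) => [|_] /=.
    by rewrite inE => /cvgN[c _]; under eq_fun do rewrite mulr1.
  by under eq_fun do rewrite mulr0; exact: is_cvg_cst.
have cI x : cvgn (fun n => complex.Im (u n x) * ind x).
  rewrite /ind indicE; case: (boolP (x \in ~` N)) => [|_] /=.
    by rewrite inE => /cvgN[_ c]; under eq_fun do rewrite mulr1.
  by under eq_fun do rewrite mulr0; exact: is_cvg_cst.
exists F, N; split => //.
- split => /=.
  + apply: (@measurable_fun_cvg _ _ _ setT (fun n x => complex.Re (u n x) * ind x)) => [n|x _].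
      by apply: measurable_funM => //; case: (mu_ n).
    exact: cR.
  + apply: (@measurable_fun_cvg _ _ _ setT (fun n x => complex.Im (u n x) * ind x)) => [n|x _].
      by apply: measurable_funM => //; case: (mu_ n).
    exact: cI.
- move=> x Nx.
  have i1 : ind x = 1 by rewrite /ind indicE mem_set.
  have eR : (fun n => complex.Re (u n x) * ind x) = (fun n => complex.Re (u n x)).
    by apply/funext => n; rewrite i1 mulr1.
  have eI : (fun n => complex.Im (u n x) * ind x) = (fun n => complex.Im (u n x)).
    by apply/funext => n; rewrite i1 mulr1.
  have cRx := cR x; have cIx := cI x; rewrite eR in cRx; rewrite eI in cIx.
  have FR : complex.Re (F x) = limn (fun n => complex.Re (u n x)) by rewrite /F /= eR.
  have FI : complex.Im (F x) = limn (fun n => complex.Im (u n x)) by rewrite /F /= eI.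
  have dR : (fun n => `|complex.Re (u n x - F x)|) @ \oo --> (0 : R).
    apply/norm_cvg0P; under eq_fun do rewrite ReD ReN FR.
    by apply/subr_cvg0.
  have dI : (fun n => `|complex.Im (u n x - F x)|) @ \oo --> (0 : R).
    apply/norm_cvg0P; under eq_fun do rewrite ImD ImN FI.
    by apply/subr_cvg0.
  have dRI : (fun n => `|complex.Re (u n x - F x)| + `|complex.Im (u n x - F x)|) @ \oo --> (0 + 0 : R).
    by apply: cvgD.
  rewrite addr0 in dRI.
  apply/cvgrPdist_le => e e0; move/cvgrPdist_le : dRI => /(_ e e0).
  apply: filterS => n; rewrite !sub0r !normrN [`|cabs _|]ger0_norm ?cabs_ge0 //.
  apply: le_trans; rewrite ger0_norm ?addr_ge0 //.
  exact: cabs_le_ReIm.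
Qed.

End L2_limit.

Section L2_space.
Context {R : realType} {d : nat}.
Local Notation C := R[i].
Local Notation mu := (leb R d).
Implicit Types F G : 'rV[R]_d -> C.

(** Lower semicontinuity of the squared norm, by Fatou's lemma off the null set [N]. *)
Lemma sqnorm_limit_le (u : nat -> 'rV[R]_d -> C) F G (N : set 'rV[R]_d) (b : R) :
  (forall n, cmeasurable (u n)) -> cmeasurable F -> cmeasurable G ->
  measurable N -> mu N = 0%E ->
  (forall x, ~ N x -> (fun n => cabs (u n x - F x)) @ \oo --> (0 : R)) ->
  (\forall n \near \oo, (sqnorm (fun x => (u n x - G x)%R) <= b%:E)%E) ->
  (sqnorm (fun x => (F x - G x)%R) <= b%:E)%E.
Proof.
move=> mu_ mF mG mN N0 cv [n0 _ hb].
(* The shift by [n0] turns the eventual bound into one valid for every term. *)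
pose v n x := (cabs (u (n + n0)%N x - G x) ^+ 2)%:E.
have mv n : measurable_fun setT (v n) by apply: measurable_sqnorm; exact: cmeasurableB.
have mNC : measurable (~` N) by exact: measurableC.
rewrite /sqnorm (ge0_negligible_integral mN) //; last 2 first.
- by apply: measurable_sqnorm; exact: cmeasurableB.
- by move=> x _; rewrite lee_fin sqr_ge0.
rewrite setTD.
have -> : (\int[mu]_(x in ~` N) (cabs (F x - G x) ^+ 2)%:E = \int[mu]_(x in ~` N) limn_einf (v ^~ x))%E.
  apply: eq_integral => x; rewrite inE => Nx.
  have cx := cv _ Nx.
  have c2 : (v ^~ x) @ \oo --> (cabs (F x - G x) ^+ 2)%:E.
    apply: cvg_EFin; first by apply: nearW.
    rewrite /v /comp /=.
    have c3 : (fun n => cabs (u n x - G x)) @ \oo --> cabs (F x - G x).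
      apply/cvgrPdist_le => e e0; move/cvgrPdist_le : cx => /(_ e e0).
      apply: filterS => n; rewrite sub0r normrN ger0_norm ?cabs_ge0 //; apply: le_trans.
      have h1 := cabsD (F x - u n x) (u n x - G x).
      have h2 := cabsD (u n x - F x) (F x - G x).
      rewrite !subrKA in h1 h2; rewrite -[F x - u n x]opprB cabsN in h1.
      by rewrite ler_norml; apply/andP; split; lra.
    have c4 : (fun n => cabs (u (n + n0)%N x - G x)) @ \oo --> cabs (F x - G x).
      by move: c3; rewrite -(cvg_shiftn n0).
    by under eq_fun do rewrite expr2; rewrite expr2; apply: cvgM.
  by have [-> _] := cvg_limn_einf_sup c2.
apply: le_trans (fatou _ _ _ _) _ => //.
- by move=> n; exact: measurable_funTS.
- by move=> n x _; rewrite lee_fin sqr_ge0.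
have vb n : (\int[mu]_(x in ~` N) v n x <= b%:E)%E.
  apply: le_trans (hb (n + n0)%N _); last by rewrite /= leq_addl.
  apply: ge0_subset_integral => //.
  by move=> x _; rewrite lee_fin sqr_ge0.
rewrite limn_einf_lim; apply: lime_le; first exact: is_cvg_einfs.
apply: nearW => n; apply: le_trans (vb n).
by apply: ereal_inf_lbound; exists n => /=.
Qed.

Lemma sqnorm_ae F G : cmeasurable F -> cmeasurable G ->
  F = G %[ae mu] -> sqnorm F = sqnorm G.
Proof.
move=> mF mG FG; apply: ae_eq_integral => //.
- exact: measurable_sqnorm.
- exact: measurable_sqnorm.
- by move: FG; apply: filterS => x /= h /h ->.
Qed.

Lemma L2fun_cmeasurable (F : L2fun R d) : cmeasurable F.
Proof. by case: F => F /= /asboolP[]. Qed.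

Lemma repr_pi_ae (F : L2fun R d) :
  (repr (\pi_(L2 R d) F) : 'rV[R]_d -> C) = (F : 'rV[R]_d -> C) %[ae mu].
Proof.
have : repr (\pi_(L2 R d) F) = F %[mod L2 R d] by rewrite reprK.
by move=> /eqmodP /asboolP.
Qed.

Lemma L2norm_eq0 F : cmeasurable F -> (L2norm F <= 0)%E -> F = (fun=> 0) %[ae mu].
Proof.
move=> mF F0.
have mc : measurable_fun setT (fun x => (cabs (F x))%:E).
  by apply/measurable_EFinP; exact: cmeasurable_cabs.
have : L2norm F = 0%E by apply/eqP; rewrite eq_le F0 L2norm_ge0.
move=> /(Lnorm_eq0_eq0 mc) => /(_ _); move/(_ (ltr0n _ _)).
by apply: filterS => x /= h /h [/cabs_eq0].
Qed.

Lemma L2funP F : cmeasurable F -> (sqnorm F < +oo)%E -> F \in @L2fun_pred R d.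
Proof. by move=> [rF iF] h; apply/asboolP; split => //; rewrite L2norm_ltP. Qed.

End L2_space.

(** * The extension to the completion *)

Section complex_norm.
Context {R : realType} {X : normedModType R[i]}.
Implicit Types x y : X.

(* The norm of [X] takes values in the complex numbers. *)
Definition rnorm x : R := complex.Re `|x|.

Lemma rnormE x : `|x| = (rnorm x)%:C%C.
Proof. by apply: complexP => //=; apply: ger0_Im. Qed.

Lemma rnorm_ge0 x : 0 <= rnorm x.
Proof. by rewrite -ler0c -rnormE. Qed.

Lemma rnormD x y : rnorm (x + y) <= rnorm x + rnorm y.
Proof. by rewrite -lecR rmorphD /= -!rnormE ler_normD. Qed.

Lemma rnormN x : rnorm (- x) = rnorm x.
Proof. by rewrite /rnorm normrN. Qed.

Lemma rnorm_eq0 x : rnorm x = 0 -> x = 0.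
Proof. by move=> x0; apply/eqP; rewrite -normr_eq0 rnormE x0. Qed.

Lemma rnorm_triangle x y z : rnorm (x - z) <= rnorm (x - y) + rnorm (y - z).
Proof. by have := rnormD (x - y) (y - z); rewrite subrKA. Qed.

Lemma nbhs_rnormP x (A : set X) : nbhs x A <->
  exists2 e : R, 0 < e & forall y, rnorm (x - y) < e -> A y.
Proof.
split.
  move=> /nbhs_ballP[e /= e0 h].
  (* A positive complex radius is real. *)
  have eE : e = (complex.Re e)%:C%C.
    by apply: complexP => //=; exact: ger0_Im (ltW e0).
  exists (complex.Re e); first by rewrite -ltcR -eE.
  move=> y xy; apply: h; rewrite -ball_normE /ball_ /=.
  by rewrite rnormE eE ltcR.
move=> [e e0 h]; apply/nbhs_ballP; exists e%:C%C => /=; first by rewrite ltcR.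
move=> y; rewrite -ball_normE /ball_ /= rnormE ltcR.
exact: h.
Qed.

Lemma dense_rnorm (S : set X) x (A : set X) : dense S -> nbhs x A -> exists2 y, A y & S y.
Proof.
move=> dS xA.
have [y [yA yS]] := dS (A^°) (ex_intro _ x xA) (@open_interior _ _).
by exists y => //; exact: interior_subset.
Qed.

End complex_norm.

Section extension.
Context {R : realType} {d : nat}.
Variable theta : {additive 'rV[int]_d -> 'rV[R]_d}.
Hypothesis htheta : is_embedding theta.
Local Notation C := R[i].
Variables (X : completeNormedModType R[i]) (j : {linear Cc R d -> X}).
Hypothesis cj : is_completion theta j.
Implicit Types f g : Cc R d.

Lemma rnorm_jE f : rnorm (j f) = fine (normX theta f).
Proof. by rewrite /rnorm; case: cj => -> _. Qed.

Lemma Cc_approx x (e : R) : 0 < e -> exists f, rnorm (x - j f) < e.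
Proof.
move=> e0; have [_ dj] := cj.
have [y h [f _ jf]] : exists2 y, rnorm (x - y) < e & range j y.
  apply: (@dense_rnorm _ _ _ x [set y | rnorm (x - y) < e]) => //.
  by apply/nbhs_rnormP; exists e.
by exists f; rewrite jf.
Qed.

Lemma Cc_cmeasurable f : cmeasurable f.
Proof. by have [[]] := Cc_ucs f. Qed.

Lemma Cc_subE f g : ((f - g : Cc R d) : 'rV[R]_d -> C) = (fun x => f x - g x).
Proof. by []. Qed.

Lemma sqnorm_Cc_sub f g :
  (sqnorm (fun x => f x - g x)%R <= (rnorm (j f - j g) ^+ 2)%:E)%E.
Proof.
rewrite -raddfB rnorm_jE -Cc_subE.
apply: (sqnorm_le htheta) => eta; exact: spectralR_le_normX.
Qed.

Lemma sqnorm_Cc_fin f : (sqnorm f < +oo)%E.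
Proof. by rewrite (sqnorm_bracket theta f) ltry. Qed.

(* The inequality that a value of the extension at [x] has to satisfy; it
   determines the value and makes the extension Lipschitz. *)
Lemma L2_value x : exists u : L2 R d, forall f,
  (sqnorm (fun y => (repr u : 'rV[R]_d -> C) y - f y)%R <= (rnorm (x - j f)%R ^+ 2)%:E)%E.
Proof.
have e0 n : 0 < 8^-1 ^+ n :> R by rewrite exprn_gt0 // invr_gt0.
(* The steps then have norm at most [2 * 8^-n], and the square [4 * 64^-n] is below the [4 * 8^-n]
   that [L2_limit] takes. *)
have [u hu] := @choice _ _ (fun n f => rnorm (x - j f) < 8^-1 ^+ n) (fun n => Cc_approx x (e0 n)).
have step n : (sqnorm (fun y => u n.+1 y - u n y)%R <= (4 * 8^-1 ^+ n)%:E)%E.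
  apply: le_trans (sqnorm_Cc_sub _ _) _; rewrite lee_fin.
  have h1 : rnorm (j (u n.+1) - j (u n)) <= 2 * 8^-1 ^+ n.
    apply: le_trans (rnorm_triangle _ x _) _.
    rewrite -[j _ - x]opprB rnormN mulr_natl mulr2n lerD ?(ltW (hu n)) //.
    apply/ltW/(lt_le_trans (hu n.+1)); rewrite exprS ler_piMl ?(ltW (e0 n)) //; lra.
  apply: (@le_trans _ _ ((2 * 8^-1 ^+ n) ^+ 2)).
    by rewrite lerXn2r // ?nnegrE ?rnorm_ge0 // mulr_ge0 // ltW.
  rewrite exprMn (_ : 2 ^+ 2 = 4) -?natrX // ler_wpM2l // expr2 ler_piMr ?(ltW (e0 n)) //.
  by apply: exprn_ile1; lra.
have [F [N [mF mN N0 cv]]] := L2_limit (fun n => Cc_cmeasurable (u n)) step.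
have FQ f : (sqnorm (fun y => F y - f y)%R <= (rnorm (x - j f)%R ^+ 2)%:E)%E.
  apply/lee_addgt0Pr => e ep.
  pose r := rnorm (x - j f).
  have r0 : 0 <= r := rnorm_ge0 _.
  (* From [t <= 1] one gets [t^2 <= t], so [(r + t)^2] exceeds [r^2] by at most
     [t (2 r + 1) <= e]. *)
  pose t := Num.min 1 (e / (2 * r + 1)).
  have k0 : 0 < 2 * r + 1 by lra.
  have t0 : 0 < t by rewrite lt_min ltr01 divr_gt0.
  have tb : (r + t) ^+ 2 <= r ^+ 2 + e.
    have t1 : t <= 1 by rewrite ge_min lexx.
    have t2 : t * (2 * r + 1) <= e by rewrite -ler_pdivlMr // ge_min lexx orbT.
    have : t ^+ 2 <= t by rewrite expr2 ler_piMr // ltW.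
    by rewrite sqrrD; move: t2; rewrite mulrDr mulr1; lra.
  apply: (@le_trans _ _ ((r + t) ^+ 2)%:E); last by rewrite -EFinD lee_fin.
  apply: (sqnorm_limit_le (fun n => Cc_cmeasurable (u n)) mF (Cc_cmeasurable f) mN N0 cv).
  have c8 : (fun n => 8^-1 ^+ n : R) @ \oo --> (0 : R).
    by apply: cvg_expr; rewrite ger0_norm //; lra.
  move/cvgrPdist_le : c8 => /(_ t t0); apply: filterS => n.
  rewrite sub0r normrN ger0_norm ?(ltW (e0 n)) // => nt.
  apply: le_trans (sqnorm_Cc_sub _ _) _; rewrite lee_fin lerXn2r ?nnegrE ?rnorm_ge0 //.
    by rewrite addr_ge0 // ltW.
  apply: le_trans (rnorm_triangle _ x _) _.
  rewrite -[j _ - x]opprB rnormN addrC lerD //.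
  by apply: le_trans (ltW (hu n)) nt.
have Ffin : F \in @L2fun_pred R d.
  apply: L2funP => //; have := FQ 0.
  have -> : (fun y => F y - (0 : Cc R d) y) = F by apply/funext => y; exact: subr0.
  by move/le_lt_trans; apply; rewrite ltry.
pose G : L2fun R d := Build_L2fun Ffin.
exists (\pi_(L2 R d) G) => f.
rewrite (sqnorm_ae (G := fun y => F y - f y)) //.
- by apply: cmeasurableB; [exact: L2fun_cmeasurable|exact: Cc_cmeasurable].
- by apply: cmeasurableB => //; exact: Cc_cmeasurable.
- by have := repr_pi_ae G; apply: filterS => y /= h /h ->.
Qed.

(** At [x = j f] the inequality of [L2_value], taken for this very [f], has right side 0 and forces
    the value to be [f]. For continuity at [x], the values at [x] and at a nearby [y] are both
    compared with a single [f] close to [x]. *)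
Lemma L2_extension_exists : exists T : X -> L2 R d, is_L2_extension j T.
Proof.
have [T hT] := choice L2_value.
have mT x : cmeasurable (repr (T x) : 'rV[R]_d -> C) by exact: L2fun_cmeasurable.
exists T; split.
  move=> f; split; first exact: L2funP (Cc_cmeasurable f) (sqnorm_Cc_fin f).
  have /(_ f) := hT (j f); rewrite subrr.
  have -> : rnorm (0 : X) = 0 by rewrite /rnorm normr0.
  move=> h0; have m0 := cmeasurableB (mT (j f)) (Cc_cmeasurable f).
  have := L2norm_eq0 m0; rewrite L2norm_le // => /(_ h0).
  by apply: filterS => y /= h /h /eqP; rewrite subr_eq0 => /eqP.
move=> x.
have near (e : R) : 0 < e -> \forall y \near x, (L2dist (T y) (T x) <= e%:E)%E.
  move=> e0; have e4 : 0 < e / 4 by rewrite divr_gt0.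
  have [f hf] := Cc_approx x e4.
  apply/nbhs_rnormP; exists (e / 4) => // y hy.
  rewrite /L2dist L2norm_le ?(ltW e0) //.
  have -> : ((repr (T y) : 'rV[R]_d -> C) - (repr (T x) : 'rV[R]_d -> C)) =
      (fun z => ((repr (T y) : 'rV[R]_d -> C) z - f z) + (-1 * ((repr (T x) : 'rV[R]_d -> C) z - f z))).
    by apply/funext => z; rewrite !fctE; ring.
  apply: le_trans (sqnormD _ _) _.
  - by apply: cmeasurableB => //; exact: Cc_cmeasurable.
  - apply: cmeasurableM; first exact: cmeasurable_cst.
    by apply: cmeasurableB => //; exact: Cc_cmeasurable.
  have -> : sqnorm (fun z => -1 * ((repr (T x) : 'rV[R]_d -> C) z - f z)) =
      sqnorm (fun z => (repr (T x) : 'rV[R]_d -> C) z - f z).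
    by apply: eq_integral => z _; rewrite mulN1r cabsN.
  have yf : rnorm (y - j f) <= e / 2.
    apply: le_trans (rnorm_triangle _ x _) _; rewrite -[y - x]opprB rnormN; lra.
  (* The sum is [5/8 e^2], below the required [e^2]. *)
  apply: (@le_trans _ _ (2%:E * ((e / 2) ^+ 2)%:E + 2%:E * ((e / 4) ^+ 2)%:E)%E).
    apply: leeD; rewrite lee_pmul2l // ?lte_fin //.
    - apply: le_trans (hT y f) _; rewrite lee_fin lerXn2r ?nnegrE ?rnorm_ge0 //; lra.
    - apply: le_trans (hT x f) _; rewrite lee_fin lerXn2r ?nnegrE ?rnorm_ge0 ?(ltW hf) //; lra.
  rewrite -!EFinM -EFinD lee_fin.
  have := sqr_ge0 e; rewrite !exprMn; lra.
apply/fine_cvgP; split.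
  apply: filterS (near 1 ltr01) => y h.
  by rewrite ge0_fin_numE ?L2norm_ge0 // (le_lt_trans h) // ltry.
apply/cvgrPdist_le => e e0; apply: filterS (near e e0) => y h.
rewrite sub0r normrN ger0_norm /=; last by apply: fine_ge0; exact: L2norm_ge0.
by rewrite -lee_fin fineK // ge0_fin_numE ?L2norm_ge0 // (le_lt_trans h) // ltry.
Qed.

End extension.

(** * Injectivity of the extension *)

Section injectivity.
Context {R : realType} {d : nat}.
Variable theta : {additive 'rV[int]_d -> 'rV[R]_d}.
Hypothesis htheta : is_embedding theta.
Local Notation C := R[i].
Variables (X : completeNormedModType R[i]) (j : {linear Cc R d -> X}).
Hypothesis cj : is_completion theta j.
Variable T : X -> L2 R d.
Hypothesis hT : is_L2_extension j T.

(** Density meets continuity: a neighbourhood of [x] on which [T] stays close to [T x] contains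
    points of the range of [j]. *)
Lemma extension_near x (e : R) : 0 < e ->
  exists f : Cc R d, rnorm (x - j f) <= e /\
    (sqnorm (fun y => (repr (T (j f)) : 'rV[R]_d -> C) y - (repr (T x) : 'rV[R]_d -> C) y)%R
       <= (e ^+ 2)%:E)%E.
Proof.
move=> e0; have [_ dj] := cj.
have /fine_cvgP[Tfin /cvgrPdist_le /(_ e e0) Tnear] := hT.2 x.
have xe : nbhs x [set y | rnorm (x - y) < e] by apply/nbhs_rnormP; exists e.
have [y [[yfin yT] ye] [f _ jf]] := dense_rnorm dj (filterI (filterI Tfin Tnear) xe).
exists f; rewrite jf; split; first exact: ltW.
rewrite -(L2norm_le _ (ltW e0)).
move: yfin yT => /=; rewrite /L2dist => yfin.
rewrite sub0r normrN ger0_norm; last by apply: fine_ge0; exact: L2norm_ge0.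
by rewrite -lee_fin fineK.
Qed.

(** Linearity of [T] is not at hand, so [a] and [b] are approximated separately by [f] and [g]. As
    [T a = T b], almost everywhere [f - g] is the difference of the two L^2 errors, although
    [j (f - g)] is close to [a - b]. *)
Lemma kernel_approx a b (e : R) : T a = T b -> 0 < e ->
  exists h : Cc R d, rnorm (j h - (a - b)) <= 2 * e /\ (sqnorm h <= (4 * e ^+ 2)%:E)%E.
Proof.
move=> Tab e0.
have mT x : cmeasurable (repr (T x) : 'rV[R]_d -> C) by exact: L2fun_cmeasurable.
have [f [fa fT]] := extension_near a e0.
have [g [gb gT]] := extension_near b e0.
exists (f - g); split.
  have -> : j (f - g) - (a - b) = (b - j g) - (a - j f).
    by rewrite raddfB !opprB addrACA [j f + b]addrC addrACA.
  apply: le_trans (rnormD _ _) _; rewrite rnormN mulr_natl mulr2n; exact: lerD.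
have mD x y : cmeasurable (fun z => (repr (T x) : 'rV[R]_d -> C) z - (repr (T y) : 'rV[R]_d -> C) z).
  exact: cmeasurableB.
pose u z := (repr (T (j f)) : 'rV[R]_d -> C) z - (repr (T a) : 'rV[R]_d -> C) z.
pose v z := (repr (T (j g)) : 'rV[R]_d -> C) z - (repr (T b) : 'rV[R]_d -> C) z.
have mv : cmeasurable (fun z => -1 * v z).
  by apply: cmeasurableM; [exact: cmeasurable_cst|exact: mD].
rewrite (sqnorm_ae (G := fun z => u z + -1 * v z)).
- apply: le_trans (sqnormD (mD _ _) mv) _.
  have -> : sqnorm (fun z => -1 * v z) = sqnorm v.
    by apply: eq_integral => z _; rewrite mulN1r cabsN.
  have -> : (4 * e ^+ 2)%:E = (2%:E * (e ^+ 2)%:E + 2%:E * (e ^+ 2)%:E)%E.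
    by rewrite -!EFinM -EFinD; congr EFin; ring.
  by apply: leeD; rewrite lee_pmul2l // ?lte_fin.
- exact: Cc_cmeasurable.
- by apply: cmeasurableD => //; exact: mD.
have [_ hf] := hT.1 f; have [_ hg] := hT.1 g.
apply: (@filterS2 _ _ _ _ _ _ _ hf hg) => z /= h1 h2 _.
change (f z - g z = u z + -1 * v z); rewrite /u /v Tab (h1 I) (h2 I); ring.
Qed.

Lemma L2_extension_injective : injective T.
Proof.
move=> a b Tab; apply/eqP; rewrite -subr_eq0; apply/eqP/rnorm_eq0.
set z := a - b; set r := rnorm z.
have := rnorm_ge0 z; rewrite -/r le_eqVlt => /orP[/eqP //|r0]; exfalso.
(* [kernel_approx] doubles this to [r / 16], so [j h0] has norm at least [15/16 r], which leaves
   room for the strict bound [7/8 r]. *)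
have r16 : 0 < r / 32 by rewrite divr_gt0.
have [h0 [h0z _]] := kernel_approx Tab r16.
have nh0 : 15 / 16 * r <= rnorm (j h0).
  have := rnorm_triangle z (j h0) 0; rewrite !subr0 -/r -[z - _]opprB rnormN => h.
  by move: h0z; rewrite -/z; lra.
have [eta0 heta0] : exists eta, (7 / 8 * r) ^+ 2 < spectralR theta h0 eta.
  apply: (normX_le_spectralR htheta); last by rewrite mulr_ge0 // ltW.
  rewrite -(rnorm_jE cj) ltrXn2r // ?nnegrE ?rnorm_ge0 //; first by rewrite mulr_ge0 // ltW.
  by apply: lt_le_trans nh0; lra.
have r20 : 0 < r ^+ 2 by rewrite exprn_gt0.
have e0 : 0 < r ^+ 2 / 8 by rewrite divr_gt0.
have [delta d0 near0] := spectralR_near htheta h0 eta0 e0.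
(* Below [delta], so that [S_h0] stays above [49/64 r^2 - r^2/8 = 41/64 r^2]; below [1/2], so that
   the small cube fits in a period. *)
pose dl := Num.min (delta / 2) 4^-1.
have dl0 : 0 < dl by rewrite lt_min divr_gt0 //= invr_gt0.
have dl2 : dl < 2^-1 by rewrite gt_min; apply/orP; right; lra.
have dld : dl < delta by rewrite gt_min; apply/orP; left; lra.
pose k := r ^+ 2 / 4 * (dl + dl) ^+ d.
have k0 : 0 < k by rewrite mulr_gt0 ?divr_gt0 // exprn_gt0 // addr_gt0.
(* The bound [r / 32] puts [h] within [r / 8] of [h0]; the bounds 1 and [k / 8] give
   [4 e^2 <= 4 e <= k / 2], which contradicts the lower bound [k]. *)
pose e := Num.min (r / 32) (Num.min 1 (k / 8)).
have ep : 0 < e by rewrite !lt_min r16 ltr01 divr_gt0.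
have er : e <= r / 32 by rewrite ge_min lexx.
have e1 : e <= 1 by rewrite !ge_min lexx !orbT.
have ek : e <= k / 8 by rewrite !ge_min lexx !orbT.
have [h [hz hs]] := kernel_approx Tab ep.
have hh0 : rnorm (j (h0 - h)) <= r / 8.
  rewrite raddfB; apply: le_trans (rnorm_triangle _ z _) _.
  by rewrite -[z - j h]opprB rnormN; move: h0z hz; rewrite -/z; lra.
have : (k%:E <= sqnorm h)%E.
  apply: (sqnorm_ge htheta (eta0 := eta0)) => //; first by rewrite divr_ge0 // ltW.
  move=> eta heta.
  have := near0 eta (fun i => le_lt_trans (heta i) dld).
  rewrite ler_norml => /andP[n1 _].
  have : spectralR theta (h0 - h) (eta0 + eta) <= (r / 8) ^+ 2.
    apply: le_trans (spectralR_le_normX htheta _ _) _.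
    by rewrite -(rnorm_jE cj) lerXn2r ?nnegrE ?rnorm_ge0 // ltW // divr_gt0.
  (* Hence [2 S_h] is at least [41/64 r^2 - 2/64 r^2], which exceeds [r^2 / 2]. *)
  have := spectralRD htheta h (h0 - h) (eta0 + eta).
  rewrite [h + _]addrC subrK; move: heta0 n1 r20; rewrite !exprMn.
  move: (spectralR _ _ _) (spectralR _ _ _) (spectralR _ _ _) (spectralR _ _ _) (r ^+ 2) => *.
  lra.
move=> /le_trans /(_ hs); rewrite lee_fin => kk.
have : e ^+ 2 <= e by rewrite expr2 ler_piMr // ltW.
by move: kk; lra.
Qed.

End injectivity.

Theorem lemma3p9 (R : realType) (d : nat)
    (theta : {additive 'rV[int]_d -> 'rV[R]_d}) (htheta : is_embedding theta) :
  (forall f : Cc R d,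
    [/\ (* the sums involved converge and take values in [0, +oo) *)
        (forall zeta : torus R d,
          Csummable setT (fun gamma => bracket theta f f gamma * chi gamma zeta)
          /\ 0 <= fourierZ (bracket theta f f) zeta),
        (forall zeta : torus R d,
          Csummable [set xi | thetahat theta xi = zeta]
            (fun xi => (fourierR f xi)^* * fourierR f xi)
          /\ 0 <= dual_bracket theta (fourierR f) (fourierR f) zeta),
        (forall xi : 'rV[R]_d,
          Csummable (dual_lattice theta)
            (fun beta => (fourierR f (xi + beta))^* * fourierR f (xi + beta))
          /\ 0 <= lattice_sum theta (fourierR f) xi),
        normX theta f \is a fin_num &
        [/\ normX theta f = ereal_sup (range (fun zeta : torus R d =>
              (Num.sqrt (complex.Re
                (dual_bracket theta (fourierR f) (fourierR f) zeta)))%:E)),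
            normX theta f = ereal_sup (range (fun xi : 'rV[R]_d =>
              (Num.sqrt (complex.Re
                (lattice_sum theta (fourierR f) xi)))%:E)) &
            (L2norm f <= normX theta f)%E]]) /\
  (forall (X : completeNormedModType R[i]) (j : {linear Cc R d -> X}),
    is_completion theta j ->
    (exists T : X -> L2 R d, is_L2_extension j T) /\
    (forall T : X -> L2 R d, is_L2_extension j T -> injective T)).
Proof.
split=> [f|X j cj]; last first.
  split; first exact: (L2_extension_exists htheta cj).
  by move=> T hT; exact: (L2_extension_injective htheta cj hT).
have s0 eta : 0 <= (spectralR theta f eta)%:C%C by rewrite ler0c spectralR_ge0.
split=> [zeta|zeta|xi||].
- by have [? ->] := fourierZ_bracket htheta f zeta.
- by have [? ->] := dual_bracket_spectral htheta f zeta.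
- by have [? ->] := lattice_sum_spectral htheta f xi.
- exact: normX_fin.
split; last exact: L2norm_le_normX.
- rewrite (normXE htheta); congr ereal_sup; apply: eq_imagel => zeta _.
  by rewrite (dual_bracket_spectral htheta f zeta).2.
rewrite (normXE htheta) (range_spectralR htheta); congr ereal_sup.
(* The lattice sum at [xi] is [spectralR] at [xi *m A], and [xi *m A] runs over the whole space
   because [A] is invertible. *)
apply/seteqP; split => _ [eta _ <-].
  exists (eta *m invmx (A_theta theta)) => //.
  by rewrite (lattice_sum_spectral htheta f _).2 mulmxKV // A_theta_unit.
exists (eta *m A_theta theta) => //.
by rewrite (lattice_sum_spectral htheta f _).2.
Qed.
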